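(* Let $(\Omega,\mathcal F,\mathbb P)$ be an atomless probability space and let $\rho:L^\infty\to\mathbb R$ be a monetary risk measure. Then $\rho$ satisfies lower semicontinuity, $\rho(0)=0$, and $\mathcal D$-aversion for some maximal bivariate concentration class $\mathcal D$, if and only if $\rho=\mathrm{ES}_p$ on $L^\infty$ for some $p\in(0,1)$.
   Context: $(\Omega,\mathcal F,\mathbb P)$ is atomless; $L^\infty$ is the space of essentially bounded random variables and $L^\infty_c\subseteq L^\infty$ the subset of those with continuous distribution. $X\overset{d}{=}Y$ means equality in law. For $p\in(0,1)$, $\mathrm{VaR}_p(X)=\inf\{x\in\mathbb R:\mathbb P(X\le x)\ge p\}$ and $\mathrm{ES}_p(X)=\frac1{1-p}\int_p^1\mathrm{VaR}_s(X)\,ds$. A monetary risk measure $\rho:L^\infty\to\mathbb R$ is one satisfying: $\rho(X)\le\rho(Y)$ whenever $X\le Y$ pointwise; and $\rho(X+c)=\rho(X)+c$ for all $c\in\mathbb R$. Lower semicontinuity: $\liminf_{n\to\infty}\rho(X_n)\ge\rho(X)$ whenever $X,X_1,X_2,\dots\in L^\infty$ and $X_n\to X$ pointwise. $\mathcal C_2$ is the set of bivariate copulas (joint distribution functions with standard uniform marginals). A copula of $(X,Y)$ is a $C\in\mathcal C_2$ with $\mathbb P(X\le x,Y\le y)=C(F_X(x),F_Y(y))$ for all $x,y$, where $F_X,F_Y$ are the distribution functions of $X,Y$; it is unique if $X$ and $Y$ have continuous distributions. For $\mathcal D\subseteq\mathcal C_2$, $\rho$ satisfies $\mathcal D$-aversion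 if $\rho(X+Y)\le\rho(Z+W)$ for all $X,Y,Z,W\in L^\infty$ with $X\overset{d}{=}Z$, $Y\overset{d}{=}W$ and such that a copula of $(Z,W)$ is in $\mathcal D$. For $C\in\mathcal C_2$, a sequence $(X_n)_{n\in\mathbb N}$ in $L^\infty_c$ is sequentially $C$-coupled if $X_n\overset{d}{=}X_{n+1}$ and $C$ is the copula of $(X_n,X_{n+1})$ for each $n\in\mathbb N$. $C$ is non-diversifiable if for every sequentially $C$-coupled sequence $(X_n)_{n\in\mathbb N}$ in $L^\infty_c$, $\frac1n\sum_{i=1}^nX_i-\mathbb E[X_1]$ does not converge to $0$ in probability as $n\to\infty$. A bivariate concentration class is a subset $\mathcal D\subseteq\mathcal C_2$ satisfying: [ND] each $C\in\mathcal D$ is non-diversifiable; [DM] if $C\in\mathcal D$, $C'\in\mathcal C_2$ and $C\le C'$ pointwise, then $C'\in\mathcal D$; [Cx] if $C_n\in\mathcal D$ for all $n\in\mathbb N$, then $\sum_{n\in\mathbb N}\lambda_nC_n\in\mathcal D$ for all $\lambda_n\ge0$ with $\sum_{n\in\mathbb N}\lambda_n=1$. A bivariate concentration class $\mathcal D$ is maximal if there is no bivariate concentration class $\mathcal D'\ne\mathcal D$ with $\mathcal D\subseteq\mathcal D'$. *)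

(* Defs.v *)
From HB Require Import structures.
From mathcomp Require Export all_boot all_order all_algebra.
From mathcomp Require Export all_classical all_reals all_analysis.
From mathcomp Require Import ess_sup_inf.

Set Implicit Arguments.
Unset Strict Implicit.
Unset Printing Implicit Defensive.

Import Order.TTheory GRing.Theory Num.Theory.
Import numFieldNormedType.Exports.

Local Open Scope classical_set_scope.
Local Open Scope ring_scope.

(* Essentially bounded random variables.  These are functions, not classes
   modulo almost sure equality: [X w] makes sense for every outcome [w]. *)
Notation Linf P := (LfunType P (leey 1%E)).

Section random_variables.
Context {d : measure_display} {T : measurableType d} {R : realType}.
Variable P : probability T R.

Definition atomless : Prop :=
  forall A : set T, measurable A -> (0 < P A)%E ->
    exists B : set T,
      [/\ measurable B, B `<=` A, (0 < P B)%E & (P B < P A)%E].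

Lemma Lfun_cst_pinfty (c : R) : (cst c : T -> R) \in Lfun P +oo%E.
Proof.
apply/andP; split; first by rewrite inE; exact: measurable_cst.
rewrite inE/= /finite_norm unlock; case: ifP => _; last exact: ltry.
apply: (@le_lt_trans _ _ (`|c|%:E)); last exact: ltry.
by apply/ess_supP; apply: nearW => x /=.
Qed.

Definition Linf_cst (c : R) : Linf P := Lfun_Sub (leey 1%E) (Lfun_cst_pinfty c).

(* Restricted to Borel sets: on other sets the value of [P] carries no
   meaning, so [distribution P X = distribution P Y] would be too strong. *)
Definition eq_in_law (X Y : Linf P) : Prop :=
  forall A : set R, measurable A -> distribution P X A = distribution P Y A.

Definition dfun (X : Linf P) (x : R) : R := fine (cdf (P := P) X x).

Definition Linf_continuous (X : Linf P) : Prop := continuous (dfun X).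

Definition cvg_in_probability (X_ : nat -> T -> R) (X : T -> R) : Prop :=
  forall e : R, 0 < e ->
    P [set w | e < `|X_ n w - X w|] @[n --> \oo] --> (0 : \bar R)%E.

Definition VaR (p : R) (X : Linf P) : R :=
  inf [set x : R | (p%:E <= P [set w | (X w <= x)%R])%E].

Definition ES (p : R) (X : Linf P) : R :=
  (1 - p)^-1 * (\int[lebesgue_measure]_(s in `]p, 1[) VaR s X).

Definition monetary_risk_measure (rho : Linf P -> R) : Prop :=
  (forall X Y : Linf P, (forall w, X w <= Y w) -> rho X <= rho Y) /\
  (forall (X : Linf P) (c : R), rho (X + Linf_cst c) = rho X + c).

(* The inferior limit is taken in the extended reals. *)
Definition pointwise_lsc (rho : Linf P -> R) : Prop :=
  forall (X_ : nat -> Linf P) (X : Linf P),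
    (forall w, X_ n w @[n --> \oo] --> X w) ->
    ((rho X)%:E <= limn_einf (fun n => (rho (X_ n))%:E))%E.

End random_variables.

(* A bivariate copula as a distribution function on the whole plane (not only
   on the unit square, on which it is determined). *)
Definition copula {R : realType} : set (R -> R -> R) :=
  [set C | exists mu : probability (R * R)%type R,
    [/\ (forall A : set R, measurable A ->
           mu (A `*` setT) = uniform_prob (@ltr01 R) A),
        (forall A : set R, measurable A ->
           mu (setT `*` A) = uniform_prob (@ltr01 R) A) &
        (forall u v : R,
           (C u v)%:E = mu ([set` `]-oo, u]] `*` [set` `]-oo, v]]))]].

Section concentration.
Context {d : measure_display} {T : measurableType d} {R : realType}.
Variable P : probability T R.
Implicit Types (C : R -> R -> R) (D : set (R -> R -> R)).

Definition copula_of (X Y : Linf P) C : Prop :=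
  copula C /\
  forall x y : R,
    P [set w | X w <= x /\ Y w <= y] = (C (dfun X x) (dfun Y y))%:E.

Definition averse D (rho : Linf P -> R) : Prop :=
  forall X Y Z W : Linf P,
    eq_in_law X Z -> eq_in_law Y W ->
    (exists2 C, D C & copula_of Z W C) ->
    rho (X + Y) <= rho (Z + W).

Definition sequentially_coupled C (X : nat -> Linf P) : Prop :=
  forall n : nat,
    [/\ Linf_continuous (X n), eq_in_law (X n) (X n.+1) &
        copula_of (X n) (X n.+1) C].

(* Sequences are indexed from 0: the average at index [n] has [n.+1] terms. *)
Definition non_diversifiable C : Prop :=
  forall X : nat -> Linf P, sequentially_coupled C X ->
    ~ cvg_in_probability P
        (fun n w => n.+1%:R^-1 * (\sum_(i < n.+1) X i w) - fine ('E_P[X 0%N])%E)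
        (cst 0).

Definition concentration_class D : Prop :=
  [/\ D `<=` copula,
      forall C, D C -> non_diversifiable C,
      forall C C', D C -> copula C' -> (forall u v, C u v <= C' u v) -> D C' &
      forall (C_ : nat -> R -> R -> R) (lam : nat -> R),
        (forall n, D (C_ n)) -> (forall n, 0 <= lam n) ->
        series lam @ \oo --> (1 : R) ->
        D (fun u v => limn (series (fun n => lam n * C_ n u v)))].

Definition maximal_concentration_class D : Prop :=
  concentration_class D /\
  ~ exists D', [/\ concentration_class D', D' <> D & D `<=` D'].

End concentration.

(* Main.v *)
(* For p in (0,1) let D_p be the set of copulas C with C(p,p) = p. A coupled
   sequence with copula in D_p almost surely never leaves or enters the event
   {X_n <= p-quantile}, so its averages cannot converge to the mean, and D_p is a
   concentration class. Conversely, suppose that a concentration class contains,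
   for every p, a copula C with C(p,p) < p. If J is a short interval around p,
   such a C lies below the copula of one step of the chain that moves a state in J
   to a fresh uniform variable whenever the latter falls in J. By [DM] and [Cx]
   the class contains the copula of the chain that first picks J at random among
   countably many rational intervals covering (0,1). This chain is stationary with
   correlations tending to 0, so its averages converge to the mean, contradicting
   [ND]. Reflecting (0,p] and (p,1) in themselves gives a member of D_p outside
   every other D_q, hence the maximal classes are exactly the D_p.

   ES_p is D_p-averse by the formula
     (1 - p) ES_p(X) = c (1 - p) + E (X - c)^+ at a p-quantile c, with <= for any c.
   Conversely, let rho be D_p-averse and lower semicontinuous, and let q be the
   quantile function of X. The reflection copula yields
   rho(q(U)) = rho((q(U) + q(U')) / 2), which halves the oscillation of the
   quantile function on (0,p] and on (p,1). For two-point variables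
   -K 1_{U <= t} it gives rho(-2K 1_{U <= t/2}) = rho(-K 1_{U <= t}) for t <= p, so
   rho(-K 1_{U <= p}) = 0 by lower semicontinuity. These two facts determine rho,
   and ES_p has both. *)

(* [Cx] allows only countable mixtures, while a deficient copula is at hand separately at each point
   of (0,1). Hence the rational end points: each deficient copula is traded, through [DM], for the
   refresh copula of a short interval, and of these countably many suffice. Convergence of the
   averages reduces to covariances. One step lowers the mean square of a function by exactly its
   mean conditional variance, so along the iterates of the transition operator these variances
   vanish. Small variance forces near constancy on each interval, and overlapping intervals carry
   the constant across (0,1). In the converse no limit of the averaging procedure is computed. The
   variable with halved oscillation does not depend on the functional, so after n rounds the values
   of any two functionals with the assumed properties lie in one interval of length [r / 2 ^+ n];
   [ES p] is such a functional. The quantiles below [p] leave no trace in that interval, because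
   subtracting a constant on {U <= p} costs nothing. *)
From HB Require Import structures.
Require Import Defs.
From mathcomp Require Import ring lra zify measurable_realfun realfun archimedean ess_sup_inf.
Set Implicit Arguments.
Unset Strict Implicit.
Unset Printing Implicit Defensive.
Import Order.TTheory GRing.Theory Num.Theory.
Import numFieldNormedType.Exports.
Local Open Scope classical_set_scope.
Local Open Scope ring_scope.

(** * Integration of bounded functions *)

Section bounded_integral.
Context {d} {S : measurableType d} {R : realType}.
Implicit Types (m : probability S R) (f g : S -> R).

Lemma measurable_ler f c : measurable_fun setT f -> measurable [set x | f x <= c].
Proof.
move=> mf; rewrite (_ : [set x | _] = setT `&` f @^-1` `]-oo, c]).
  exact: mf.
by rewrite setTI; apply/seteqP; split => x /=; rewrite in_itv.
Qed.

Lemma measurable_ltr f c : measurable_fun setT f -> measurable [set x | f x < c].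
Proof.
move=> mf; rewrite (_ : [set x | _] = setT `&` f @^-1` `]-oo, c[).
  exact: mf.
by rewrite setTI; apply/seteqP; split => x /=; rewrite in_itv.
Qed.

Lemma measurable_ger f c : measurable_fun setT f -> measurable [set x | c <= f x].
Proof.
move=> mf; rewrite (_ : [set x | _] = setT `&` f @^-1` `[c, +oo[).
  exact: mf.
by rewrite setTI; apply/seteqP; split => x /=; rewrite in_itv/= andbT.
Qed.

Lemma measurable_gtr f c : measurable_fun setT f -> measurable [set x | c < f x].
Proof.
move=> mf; rewrite (_ : [set x | _] = setT `&` f @^-1` `]c, +oo[).
  exact: mf.
by rewrite setTI; apply/seteqP; split => x /=; rewrite in_itv/= andbT.
Qed.

(** Bounded everywhere, not almost surely: the class is closed under algebra and sections, and its
    members are integrable for every probability, so linearity and Fubini need no further side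
    condition. *)
Definition bounded_measurable f :=
  measurable_fun setT f /\ exists M : R, forall x, `|f x| <= M.

Lemma bm_integrable m f : bounded_measurable f -> m.-integrable setT (EFin \o f).
Proof.
move=> [mf [M hM]]; apply: measurable_bounded_integrable => //.
  by rewrite -ge0_fin_numE// fin_num_measure.
exists M; split; first exact: num_real.
by move=> x Mx y _ /=; rewrite (le_trans (hM y))// ltW.
Qed.

Lemma bm_cst c : bounded_measurable (cst c : S -> R).
Proof. by split; [exact: measurable_cst|exists `|c|]. Qed.

Lemma bmD f g : bounded_measurable f -> bounded_measurable g ->
  bounded_measurable (fun x => f x + g x).
Proof.
move=> [mf [M hM]] [mg [N hN]]; split; first exact: measurable_funD.
by exists (M + N) => x; rewrite (le_trans (ler_normD _ _))// lerD.
Qed.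

Lemma bmN f : bounded_measurable f -> bounded_measurable (fun x => - f x).
Proof.
move=> [mf [M hM]]; split; first exact: measurableT_comp.
by exists M => x; rewrite normrN.
Qed.

Lemma bmB f g : bounded_measurable f -> bounded_measurable g ->
  bounded_measurable (fun x => f x - g x).
Proof. by move=> bf bg; exact/bmD/bmN. Qed.

Lemma bmM f g : bounded_measurable f -> bounded_measurable g ->
  bounded_measurable (fun x => f x * g x).
Proof.
move=> [mf [M hM]] [mg [N hN]]; split; first exact: measurable_funM.
by exists (M * N) => x; rewrite normrM ler_pM.
Qed.

Lemma bmZ c f : bounded_measurable f -> bounded_measurable (fun x => c * f x).
Proof. by move=> bf; exact: (bmM (bm_cst c)). Qed.

Lemma bmX n f : bounded_measurable f -> bounded_measurable (fun x => f x ^+ n).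
Proof.
move=> bf; elim: n => [|n ih].
  by under eq_fun do rewrite expr0; exact: bm_cst.
by under eq_fun do rewrite exprS; exact: bmM.
Qed.

Lemma bm_indic (A : set S) : measurable A -> bounded_measurable (\1_A : S -> R).
Proof.
move=> mA; split; first exact: measurable_indic.
by exists 1 => x; rewrite indicE; case: (_ \in _); rewrite ?normr1 ?normr0.
Qed.

Lemma bm_sum (I : Type) (s : seq I) (F : I -> S -> R) :
  (forall i, bounded_measurable (F i)) ->
  bounded_measurable (fun x => \sum_(i <- s) F i x).
Proof.
move=> bF; elim: s => [|i s ih].
  by under eq_fun do rewrite big_nil; exact: bm_cst.
by under eq_fun do rewrite big_cons; exact: bmD.
Qed.

Lemma EFin_int m f : bounded_measurable f ->
  (\int[m]_x f x)%:E = (\int[m]_x (f x)%:E)%E.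
Proof.
by move=> bf; rewrite fineK//; apply: integrable_fin_num => //; exact: bm_integrable.
Qed.

Lemma int_cst m c : \int[m]_(x in setT) c = c.
Proof. by rewrite Rintegral_cst//= probability_setT mulr1. Qed.

Lemma intD m f g : bounded_measurable f -> bounded_measurable g ->
  \int[m]_x (f x + g x) = \int[m]_x f x + \int[m]_x g x.
Proof. by move=> bf bg; rewrite RintegralD//; exact: bm_integrable. Qed.

Lemma intB m f g : bounded_measurable f -> bounded_measurable g ->
  \int[m]_x (f x - g x) = \int[m]_x f x - \int[m]_x g x.
Proof. by move=> bf bg; rewrite RintegralB//; exact: bm_integrable. Qed.

Lemma intZ m c f : bounded_measurable f ->
  \int[m]_x (c * f x) = c * \int[m]_x f x.
Proof. by move=> bf; rewrite RintegralZl//; exact: bm_integrable. Qed.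

Lemma int_le m f g : bounded_measurable f -> bounded_measurable g ->
  (forall x, f x <= g x) -> \int[m]_x f x <= \int[m]_x g x.
Proof. by move=> bf bg fg; apply: le_Rintegral => //; exact: bm_integrable. Qed.

Lemma int_sum m (I : Type) (s : seq I) (F : I -> S -> R) :
  (forall i, bounded_measurable (F i)) ->
  \int[m]_x (\sum_(i <- s) F i x) = \sum_(i <- s) \int[m]_x F i x.
Proof.
move=> bF; elim: s => [|i s ih].
  by under eq_Rintegral do rewrite big_nil; rewrite int_cst big_nil.
under eq_Rintegral do rewrite big_cons.
by rewrite intD ?ih ?big_cons//; exact: bm_sum.
Qed.

Lemma int_indic m (A : set S) : measurable A -> \int[m]_x (\1_A x : R) = fine (m A).
Proof. by move=> mA; rewrite /Rintegral integral_indic// setIT. Qed.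

Lemma int_norm_le m f (M : R) : bounded_measurable f -> (forall x, `|f x| <= M) ->
  `|\int[m]_x f x| <= M.
Proof.
move=> bf fM; rewrite ler_norml; apply/andP; split.
  rewrite -[leLHS](int_cst m); apply: int_le => //; first exact: (bm_cst (- M)).
  by move=> x; have := fM x; rewrite ler_norml => /andP[].
rewrite -[leRHS](int_cst m); apply: int_le => //; first exact: (bm_cst M).
by move=> x; have := fM x; rewrite ler_norml => /andP[].
Qed.

(* [int (f - c)^2 >= 0] at the mean [c] of [f]. *)
Lemma int_sq_ge m f : bounded_measurable f ->
  (\int[m]_x f x) ^+ 2 <= \int[m]_x (f x ^+ 2).
Proof.
move=> bf; set c := \int[m]_x f x.
have := @Rintegral_ge0 _ _ _ m setT (fun x => (f x - c) ^+ 2) (fun x _ => sqr_ge0 _).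
have -> : (fun x => (f x - c) ^+ 2) = (fun x => (f x ^+ 2 - 2 * c * f x) + c ^+ 2).
  by apply/funext => x; ring.
have b1 : bounded_measurable (fun x => f x ^+ 2) by exact: bmX.
have b2 : bounded_measurable (fun x => 2 * c * f x) by exact: bmZ.
have b3 : bounded_measurable (fun=> c ^+ 2 : R) by exact: bm_cst.
rewrite (intD m (bmB b1 b2) b3) (intB m b1 b2) intZ// int_cst -/c.
set I := \int[m]_x _; move: I c {b2 b3} => I c; nra.
Qed.

(** Chebyshev: the indicator of the event is at most [f ^+ 2 / e ^+ 2] pointwise. *)
Lemma markov_bm m f (e : R) : 0 < e -> bounded_measurable f ->
  (m [set x | (e < `|f x|)%R] <= ((e ^+ 2)^-1 * \int[m]_x (f x ^+ 2))%:E)%E.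
Proof.
move=> e0 bf; set A := [set x | _].
have mA : measurable A.
  by apply: measurable_gtr; apply: measurableT_comp => //; exact: bf.1.
rewrite -[m A]fineK ?fin_num_measure// lee_fin -(int_indic m mA) -intZ; last exact: bmX.
apply: int_le; [exact: bm_indic|exact/bmZ/bmX|move=> x].
rewrite indicE.
have [|_] := boolP (x \in A); last by rewrite mulr_ge0 ?invr_ge0 ?sqr_ge0.
rewrite inE /A/= => ex; rewrite mulrC ler_pdivlMr ?exprn_gt0// mul1r.
by rewrite -[leRHS]real_normK ?num_real// ler_sqr ?nnegrE// ?ltW.
Qed.

End bounded_integral.


(** * Image laws, change of variables and Fubini *)

Section laws.
Context {d1 d2} {S1 : measurableType d1} {S2 : measurableType d2} {R : realType}.
Variables (m1 : probability S1 R) (m2 : probability S2 R).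
Implicit Types f : S1 -> S2.

Definition has_law f := measurable_fun setT f /\ forall A, measurable A -> m1 (f @^-1` A) = m2 A.

Lemma ge0_int_law f (h : S2 -> \bar R) : has_law f ->
  measurable_fun setT h -> (forall y, 0 <= h y)%E ->
  (\int[m1]_x h (f x) = \int[m2]_y h y)%E.
Proof.
move=> [mf fA] mh h0.
pose F : {mfun S1 >-> S2} := HB.pack f (@isMeasurableFun.Build _ _ _ _ f mf).
rewrite -(@ge0_integral_distribution _ _ _ _ _ m1 F h mh h0).
by apply: eq_measure_integral => A mA _; exact: fA.
Qed.

Lemma bm_comp (g : S2 -> R) f : bounded_measurable g -> measurable_fun setT f ->
  bounded_measurable (fun x => g (f x)).
Proof.
move=> [mg [M hM]] mf; split; first exact: measurableT_comp.
by exists M => x; exact: hM.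
Qed.

Lemma int_law f (g : S2 -> R) : has_law f -> bounded_measurable g ->
  \int[m1]_x g (f x) = \int[m2]_y g y.
Proof.
move=> [mf fA] bg; apply: EFin_inj; rewrite !EFin_int//; last exact: bm_comp.
pose F : {mfun S1 >-> S2} := HB.pack f (@isMeasurableFun.Build _ _ _ _ f mf).
rewrite -(@integral_distribution _ _ _ _ _ m1 F (EFin \o g)).
- by apply: eq_measure_integral => A mA _; exact: fA.
- by apply: measurableT_comp => //; exact: bg.1.
- by apply: bm_integrable; exact: bm_comp.
Qed.

End laws.

Lemma has_law_comp {d1 d2 d3} {S1 : measurableType d1} {S2 : measurableType d2}
    {S3 : measurableType d3} {R : realType} (m1 : probability S1 R)
    (m2 : probability S2 R) (m3 : probability S3 R) (f : S1 -> S2) (g : S2 -> S3) :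
  has_law m1 m2 f -> has_law m2 m3 g -> has_law m1 m3 (g \o f).
Proof.
move=> [mf fA] [mg gA]; split; first exact: measurableT_comp.
move=> A mA; rewrite comp_preimage fA ?gA//.
by rewrite -[X in measurable X]setTI; exact: mg.
Qed.

Section fubini.
Context {d1 d2} {S1 : measurableType d1} {S2 : measurableType d2} {R : realType}.
Variables (m1 : probability S1 R) (m2 : probability S2 R).
Implicit Types f : S1 * S2 -> R.

Lemma bm_section f x : bounded_measurable f -> bounded_measurable (fun y => f (x, y)).
Proof. by move=> bf; apply: (bm_comp bf); exact: measurable_pair1. Qed.

Lemma bm_section2 f y : bounded_measurable f -> bounded_measurable (fun x => f (x, y)).
Proof. by move=> bf; apply: (bm_comp bf); exact: measurable_pair2. Qed.

Lemma prod_prob_bm_integrable f : bounded_measurable f ->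
  (m1 \x m2)%E.-integrable setT (EFin \o f).
Proof.
exact: (@bm_integrable _ _ _ (m1 \x m2)%E).
Qed.

Lemma bm_fubini_F f : bounded_measurable f ->
  bounded_measurable (fun x => \int[m2]_y f (x, y)).
Proof.
move=> bf; split.
  apply/measurable_EFinP; have := measurable_fubini_F (prod_prob_bm_integrable bf).
  apply: eq_measurable_fun => x _ /=.
  by rewrite /fubini_F EFin_int//; exact: bm_section.
have [mf [M hM]] := bf; exists M => x; apply: int_norm_le; first exact: bm_section.
by move=> y; exact: hM.
Qed.

Lemma bm_fubini_G f : bounded_measurable f ->
  bounded_measurable (fun y => \int[m1]_x f (x, y)).
Proof.
move=> bf; split.
  apply/measurable_EFinP; have := measurable_fubini_G (prod_prob_bm_integrable bf).
  apply: eq_measurable_fun => y _ /=.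
  by rewrite /fubini_G EFin_int//; exact: bm_section2.
have [mf [M hM]] := bf; exists M => x; apply: int_norm_le; first exact: bm_section2.
by move=> y; exact: hM.
Qed.

Lemma int_fubini f : bounded_measurable f ->
  \int[m1]_x \int[m2]_y f (x, y) = \int[m2]_y \int[m1]_x f (x, y).
Proof.
move=> bf; apply: EFin_inj; rewrite !EFin_int; [|exact: bm_fubini_G|exact: bm_fubini_F].
transitivity (\int[m1]_x \int[m2]_y (f (x, y))%:E)%E.
  by apply: eq_integral => x _; rewrite EFin_int//; exact: bm_section.
rewrite (Fubini (prod_prob_bm_integrable bf)).
by apply: eq_integral => y _; rewrite EFin_int//; exact: bm_section2.
Qed.

Lemma int_prod f : bounded_measurable f ->
  \int[(m1 \x m2)%E]_z f z = \int[m1]_x \int[m2]_y f (x, y).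
Proof.
move=> bf; apply: EFin_inj; rewrite EFin_int; last exact: bm_fubini_F.
rewrite (@EFin_int _ _ _ (m1 \x m2)%E)//.
rewrite -(integral12_prod_meas1 (prod_prob_bm_integrable bf)).
by apply: eq_integral => x _; rewrite EFin_int//; exact: bm_section.
Qed.

End fubini.

(** * Uniform laws and distribution functions *)

Section finite_measures_on_reals.
Context {R : realType}.

(** Open right rays form a generating pi-system; finite total mass turns agreement on []-oo, x]]
    into agreement on their complements. *)
Lemma eq_measure_cdf (m1 m2 : {measure set R -> \bar R}) :
  m1 setT = m2 setT -> (m1 setT < +oo)%E ->
  (forall x : R, m1 `]-oo, x]%classic = m2 `]-oo, x]%classic) ->
  forall A : set R, measurable A -> m1 A = m2 A.
Proof.
move=> m12T m1fin m12 A mA.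
have m2fin : (m2 setT < +oo)%E by rewrite -m12T.
apply: (measure_unique (@RGenOInfty.G R) (fun n => `]- n%:R, +oo[%classic)) => //.
- exact: RGenOInfty.measurableE.
- move=> _ _ [x ->] [y ->]; exists (Num.max x y).
  by apply/seteqP; split => z /=; rewrite !in_itv/= !andbT gt_max => /andP.
- by move=> n; exists (- n%:R).
- rewrite -subTset => x _; exists (Num.bound `|x|) => //=; rewrite in_itv/= andbT.
  by rewrite ltrNl (le_lt_trans _ (archi_boundP (normr_ge0 x)))// -normrN ler_norm.
- move=> _ [x ->]; rewrite -setCitvl -!setTD !measureD//; congr (_ - _)%E; first exact: m12T.
  by rewrite !setTI; exact: m12.
- move=> n; apply: le_lt_trans m1fin.
  by apply: le_measure; rewrite ?inE.
Qed.

Let bounded_mul_cdf (m : {measure set R -> \bar R}) (c : R) (p : probability R R) :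
  0 <= c -> m setT = c%:E ->
  (forall x : R, m `]-oo, x]%classic = c%:E * p `]-oo, x]%classic)%E ->
  forall A : set R, measurable A -> m A = (c%:E * p A)%E.
Proof.
move=> c0 mT mE A mA.
rewrite (@eq_measure_cdf m (mscale (NngNum c0) p))//.
- rewrite mT /mscale/= -[LHS]mule1; congr (_ * _)%E.
  exact/esym/probability_setT.
- by rewrite mT ltry.
Qed.

(** Two passes of the one-dimensional uniqueness: over a fixed ray the second coordinate is freed,
    then over a fixed Borel set the first. The measures restricted to such strips have mass at most
    1, hence the factor [c] in [bounded_mul_cdf]. *)
Lemma eq_prob_cdf2 (m : probability (R * R)%type R) (m1 m2 : probability R R) :
  (forall x y : R, m (`]-oo, x]%classic `*` `]-oo, y]%classic) =
    (m1 `]-oo, x]%classic * m2 `]-oo, y]%classic)%E) ->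
  (forall x : R, m (`]-oo, x]%classic `*` setT) = m1 `]-oo, x]%classic) ->
  (forall y : R, m (setT `*` `]-oo, y]%classic) = m2 `]-oo, y]%classic) ->
  forall A : set (R * R), measurable A -> m A = (m1 \x m2)%E A.
Proof.
move=> mE mE1 mE2 A mA; apply/esym.
apply: (@product_measure_unique _ _ _ _ _ m1 m2 m) => // {A mA}.
have step1 x B : measurable B -> m (`]-oo, x]%classic `*` B) = (m1 `]-oo, x]%classic * m2 B)%E.
  move=> mB.
  have mX : measurable (`]-oo, x]%classic `*` [set: R]) by exact: measurableX.
  pose n' : {measure set R -> \bar R} := pushforward (mrestr m mX) snd.
  pose n := n' measurable_snd.
  have nE C : n C = m (`]-oo, x]%classic `*` C).
    rewrite /n/= /pushforward /mrestr; congr (m _); apply/seteqP.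
    by split => -[u v] /=; tauto.
  rewrite -nE -[m1 _]fineK ?fin_num_measure//.
  apply: bounded_mul_cdf => //; first by rewrite fine_ge0.
    by rewrite nE mE1 fineK ?fin_num_measure.
  by move=> y; rewrite nE fineK ?fin_num_measure.
move=> A B mA mB.
have mX : measurable ([set: R] `*` B) by exact: measurableX.
pose n' : {measure set R -> \bar R} := pushforward (mrestr m mX) fst.
pose n := n' measurable_fst.
have nE C : n C = m (C `*` B).
  rewrite /n/= /pushforward /mrestr; congr (m _); apply/seteqP.
  by split => -[u v] /=; tauto.
have mTB : m (setT `*` B) = m2 B.
  pose k' : {measure set R -> \bar R} := pushforward m snd.
  pose k := k' measurable_snd.
  have nE' C : k C = m (setT `*` C).
    rewrite /k/= /pushforward; congr (m _); apply/seteqP.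
    by split => -[u v] /=; tauto.
  rewrite -nE'; apply: eq_measure_cdf => //.
  - rewrite nE' setXTT; transitivity (1 : \bar R)%E; [|apply/esym]; exact: probability_setT.
  - by rewrite nE' setXTT [ltLHS]probability_setT ltry.
  - by move=> y; rewrite nE'.
transitivity (n A); first by rewrite nE.
transitivity ((fine (m2 B))%:E * m1 A)%E; last first.
  by rewrite muleC fineK// fin_num_measure.
apply: bounded_mul_cdf => //; first by rewrite fine_ge0.
  by rewrite nE mTB fineK ?fin_num_measure.
by move=> y; rewrite nE fineK ?fin_num_measure// step1// muleC.
Qed.

Lemma has_law_cdf {d} {S : measurableType d} (P : probability S R)
    (m : probability R R) (f : S -> R) : measurable_fun setT f ->
  (forall x, P [set w | f w <= x] = m `]-oo, x]%classic) -> has_law P m f.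
Proof.
move=> mf fE; split => // A mA.
pose F : {mfun S >-> R} := HB.pack f (@isMeasurableFun.Build _ _ _ _ f mf).
have := @eq_measure_cdf (distribution P F) m; apply => //.
- by transitivity (1 : \bar R)%E; [|apply/esym]; exact: probability_setT.
- by rewrite [ltLHS]probability_setT ltry.
Qed.

Lemma has_law_cdf2 {d} {S : measurableType d} (P : probability S R)
    (m1 m2 : probability R R) (f g : S -> R) :
  measurable_fun setT f -> measurable_fun setT g ->
  (forall x y, P [set w | f w <= x /\ g w <= y] =
    (m1 `]-oo, x]%classic * m2 `]-oo, y]%classic)%E) ->
  (forall x, P [set w | f w <= x] = m1 `]-oo, x]%classic) ->
  (forall y, P [set w | g w <= y] = m2 `]-oo, y]%classic) ->
  has_law P (m1 \x m2)%E (fun w => (f w, g w)).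
Proof.
move=> mf mg fgE fE gE.
have mfg : measurable_fun setT (fun w => (f w, g w)) by exact: measurable_fun_pair.
split => // A mA.
pose F : {mfun S >-> (R * R)%type} :=
  HB.pack (fun w => (f w, g w)) (@isMeasurableFun.Build _ _ _ _ _ mfg).
have := @eq_prob_cdf2 (distribution P F) m1 m2; apply => //.
- move=> x; rewrite -fE; congr (P _); apply/seteqP.
  by split => w /=; rewrite !in_itv//= => -[].
- move=> x; rewrite -gE; congr (P _); apply/seteqP.
  by split => w /=; rewrite !in_itv//= => -[].
Qed.

End finite_measures_on_reals.

Section uniform01.
Context {R : realType}.

(* [uniform_prob] lives on [measurableTypeR R], whose display differs from the
   one used by [copula] and [distribution]. *)
Definition unif (A : set R) : \bar R := uniform_prob (@ltr01 R) A.

Let unif0 : unif set0 = 0%E. Proof. exact: measure0. Qed.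

Let unif_ge0 A : (0 <= unif A)%E.
Proof. exact: (measure_ge0 (uniform_prob (@ltr01 R)) A). Qed.

Let unif_sigma_additive : semi_sigma_additive unif.
Proof. exact: (@measure_semi_sigma_additive _ _ _ (uniform_prob (@ltr01 R))). Qed.

HB.instance Definition _ := isMeasure.Build _ R R unif
  unif0 unif_ge0 unif_sigma_additive.

Let unifT : unif setT = 1%E.
Proof. exact: (@probability_setT _ _ _ (uniform_prob (@ltr01 R))). Qed.

HB.instance Definition _ := @Measure_isProbability.Build _ _ R unif unifT.

Local Notation lam := unif.

(** The distribution function of the uniform law. Copulas live on the whole plane here, so their
    margins are [clip] rather than the identity. *)
Definition clip (u : R) := Num.max 0 (Num.min u 1).

Lemma clip_id u : 0 <= u <= 1 -> clip u = u.
Proof. by move=> /andP[u0 u1]; rewrite /clip (min_idPl u1) (max_idPr u0). Qed.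

Lemma clip_ge0 u : 0 <= clip u. Proof. by rewrite /clip le_max lexx. Qed.

Lemma clip_le1 u : clip u <= 1.
Proof. by rewrite /clip ge_max ler01 ge_min lexx orbT. Qed.

Lemma clip_le u v : u <= v -> clip u <= clip v.
Proof.
by move=> uv; rewrite /clip ge_max !le_max lexx/= le_min !ge_min uv lexx !orbT.
Qed.

Lemma unif_lebesgueE (A : set R) : measurable A -> lam A = lebesgue_measure (A `&` `[0, 1]%classic).
Proof.
move=> mA; rewrite /unif -[LHS]mul1e -[LHS]mule1.
have := @integral_uniform R 0 1 (@ltr01 R) (EFin \o \1_A).
rewrite subr0 invr1 mul1e integral_indic// setIT => ->//.
- by rewrite integral_indic// mul1e mule1.
- exact/measurable_EFinP/measurable_indic.
- by move=> x; rewrite lee_fin.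
Qed.

Lemma unif_cdf (u : R) : lam `]-oo, u]%classic = (clip u)%:E.
Proof.
rewrite unif_lebesgueE//.
have -> : `]-oo, u]%classic `&` `[0, 1]%classic = `[0, Num.min u 1]%classic.
  by apply/seteqP; split => x /=; rewrite !in_itv/= le_min; move=> *; lra.
rewrite lebesgue_measure_itv/= lte_fin /clip /Num.max.
by case: ifP => // _; rewrite oppr0 adde0.
Qed.

Lemma unif_itvoc (a b : R) : a <= b -> lam `]a, b]%classic = (clip b - clip a)%:E.
Proof.
move=> ab; have -> : `]a, b]%classic = `]-oo, b]%classic `\` `]-oo, a]%classic.
  by apply/seteqP; split => x /=; rewrite !in_itv/= => *; lra.
rewrite measureD//; last by rewrite (le_lt_trans (probability_le1 _ _)) ?ltry.
rewrite setIidr; last by move=> x /=; rewrite !in_itv/= => *; lra.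
rewrite EFinB; exact: (congr2 (fun x y => x - y)%E (unif_cdf b) (unif_cdf a)).
Qed.

Lemma unif_set1 (a : R) : lam [set a] = 0%E.
Proof.
rewrite unif_lebesgueE//; apply/eqP; rewrite eq_le measure_ge0 andbT.
by rewrite -(lebesgue_measure_set1 a); apply: le_measure; rewrite ?inE//; exact: measurableI.
Qed.

Lemma unif_itvoo (a b : R) : a < b -> lam `]a, b[%classic = (clip b - clip a)%:E.
Proof.
move=> ab; rewrite -(unif_itvoc (ltW ab)).
have -> : `]a, b]%classic = `]a, b[%classic `|` [set b].
  apply/seteqP; split => x /=; rewrite !in_itv/=.
    by rewrite (le_eqVlt x) => /andP[-> /predU1P[->|->]]; [right|left].
  by move=> [/andP[-> /ltW->]//|->]; rewrite ab lexx.
rewrite measureU//; last first.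
  by apply/seteqP; split => x //=; rewrite in_itv/= => -[/andP[_ /lt_eqF/eqP]].
by rewrite [X in (_ + X)%E]unif_set1 adde0.
Qed.

Lemma unif_itv01 : lam `]0, 1[%classic = 1%E.
Proof. by rewrite unif_itvoo// /clip minxx (min_idPl ler01) maxxx (max_idPr ler01) subr0. Qed.

End uniform01.

(** * Independent uniform variables on an atomless space *)

Section real_probability.
Context {d} {T : measurableType d} {R : realType}.
Variable P : probability T R.

Definition pr (A : set T) : R := fine (P A).

Lemma prE A : measurable A -> P A = (pr A)%:E.
Proof. by move=> mA; rewrite fineK// fin_num_measure. Qed.

Lemma pr_ge0 A : 0 <= pr A. Proof. by rewrite fine_ge0. Qed.

Lemma pr0 : pr set0 = 0. Proof. by rewrite /pr measure0. Qed.

Lemma prT : pr setT = 1. Proof. by rewrite /pr probability_setT. Qed.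

Lemma le_pr A B : measurable A -> measurable B -> A `<=` B -> pr A <= pr B.
Proof. by move=> mA mB AB; rewrite -lee_fin -!prE// le_measure ?inE. Qed.

Lemma pr_le1 A : measurable A -> pr A <= 1.
Proof. by move=> mA; rewrite -prT; apply: le_pr. Qed.

Lemma prDI A B : measurable A -> measurable B -> pr A = pr (A `\` B) + pr (A `&` B).
Proof.
move=> mA mB; apply: EFin_inj; rewrite EFinD -!prE//; last 2 first.
  exact: measurableI.
  exact: measurableD.
exact: measureDI.
Qed.

Lemma pr_sub A B : measurable A -> measurable B -> B `<=` A -> pr (A `\` B) = pr A - pr B.
Proof. by move=> mA mB BA; rewrite (prDI mA mB) (setIidr BA) addrK. Qed.

Lemma prC A : measurable A -> pr (~` A) = 1 - pr A.
Proof. by move=> mA; rewrite -setTD pr_sub// prT. Qed.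

Lemma prU A B : measurable A -> measurable B -> A `&` B = set0 ->
  pr (A `|` B) = pr A + pr B.
Proof.
move=> mA mB AB; apply: EFin_inj; rewrite EFinD -!prE ?measureU//.
exact: measurableU.
Qed.

Lemma pr_bigcup_ub (F : nat -> set T) t : (forall n, measurable (F n)) ->
  nondecreasing_seq F -> (forall n, pr (F n) <= t) -> pr (\bigcup_n F n) <= t.
Proof.
move=> mF ndF Ft; have mU : measurable (\bigcup_n F n) by exact: bigcup_measurable.
rewrite -lee_fin -prE//.
have cF := @nondecreasing_cvg_mu _ _ _ P F mF mU ndF.
rewrite -(cvg_lim _ cF)//; apply: lime_le; first by apply/cvg_ex; eexists; exact: cF.
by apply: nearW => n /=; rewrite prE// lee_fin.
Qed.

End real_probability.

Section atomless.
Context {d} {T : measurableType d} {R : realType}.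
Variable P : probability T R.
Hypothesis hP : atomless P.
Local Notation pr := (pr P).

(** When a set is cut in two, one of the parts has at most half the mass; choosing the lighter part
    repeatedly gives mass below [pr A / 2 ^+ n]. *)
Lemma atomless_small A (e : R) : measurable A -> 0 < pr A -> 0 < e ->
  exists B, [/\ measurable B, B `<=` A, 0 < pr B & pr B <= e].
Proof.
move=> mA A0 e0.
have half : forall B, measurable B -> 0 < pr B ->
    exists C, [/\ measurable C, C `<=` B, 0 < pr C & pr C <= pr B / 2].
  move=> B mB B0; have [|C [mC CB]] := hP mB; first by rewrite prE ?lte_fin.
  rewrite !prE ?lte_fin// => C0 CltB.
  have [h|h] := leP (pr C) (pr B / 2); first by exists C.
  exists (B `\` C); rewrite pr_sub//; split; [exact: measurableD|by move=> ? []| |]; lra.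
have iter n : exists C, [/\ measurable C, C `<=` A, 0 < pr C & pr C <= pr A / 2 ^+ n].
  elim: n => [|n [B [mB BA B0 Bn]]]; first by exists A; rewrite expr0 divr1; split.
  have [C [mC CB C0 Cn]] := half B mB B0; exists C; split => //.
    exact: subset_trans BA.
  by rewrite exprSr invfM mulrA; lra.
have [n hn] : exists n, 2 ^- n < e.
  exists (Num.bound e^-1); rewrite -[ltRHS]invrK ltf_pV2 ?posrE ?invr_gt0 ?exprn_gt0//.
  by apply: upper_nthrootP.
have [C [mC CA C0 Cn]] := iter n; exists C; split => //.
apply: (le_trans Cn); apply: le_trans (ltW hn).
by rewrite ler_pdivrMr ?exprn_gt0// mulVf ?expf_neq0//; exact: pr_le1.
Qed.

(** Sierpinski's theorem by greedy exhaustion: each step adds a set of at least half the largest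
    mass still admissible. If the union stayed below [t], a small set [C] left over would have been
    admissible at every step, so every step would have added [pr C / 2]. *)
Lemma atomless_intermediate A (t : R) : measurable A -> 0 <= t <= pr A ->
  exists B, [/\ measurable B, B `<=` A & pr B = t].
Proof.
move=> mA /andP[t0 tA].
pose good B := [/\ measurable B, B `<=` A & pr B <= t].
pose step B G := good B -> [/\ good G, B `<=` G & forall C, measurable C ->
  C `<=` A `\` B -> pr C <= t - pr B -> pr C / 2 <= pr G - pr B].
have /choice[g gP] : forall B, exists G, step B G.
  move=> B; have [[mB BA Bt]|nB] := pselect (good B); last by exists B.
  pose S := [set pr C | C in [set C | [/\ measurable C, C `<=` A `\` B & pr C <= t - pr B]]].
  have S0 : S 0 by exists set0; [split => //; rewrite pr0; lra|exact: pr0].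
  have hS : has_sup S.
    by split; [exists 0|exists 1 => _ [C [mC _ _] <-]; exact: pr_le1].
  have [s0|s0] := leP (sup S) 0.
    exists B => _; split => // C mC CA Ct; rewrite subrr.
    suff : pr C <= 0 by lra.
    by apply: le_trans s0; apply: sup_upper_bound => //; exists C.
  have [_ [C [mC CA Ct] <-] hC] := @sup_adherent _ S (sup S / 2) (divr_gt0 s0 (ltr0Sn _ 1)) hS.
  have dBC : B `&` C = set0 by apply/seteqP; split => // x [Bx /CA[]].
  exists (B `|` C) => _; rewrite /good !prU//; split.
  - split; [exact: measurableU|by move=> x [/BA//|/CA[]]|lra].
  - by move=> x; left.
  - move=> D mD DA Dt; have : pr D <= sup S by apply: sup_upper_bound => //; exists D.
    lra.
pose B_ n := iter n g set0.
have good0 : good set0 by split => //; rewrite pr0.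
have gB n : good (B_ n).
  by elim: n => [//|n ih] /=; have [] := gP (B_ n) ih.
have ndB : nondecreasing_seq B_.
  by apply/nondecreasing_seqP => n; apply/subsetPset; have [] := gP _ (gB n).
have mB n : measurable (B_ n) by have [] := gB n.
exists (\bigcup_n B_ n); split; first exact: bigcup_measurable.
  by move=> x [n _]; have [_ h _] := gB n; exact: h.
have mU : measurable (\bigcup_n B_ n) by exact: bigcup_measurable.
have UA : \bigcup_n B_ n `<=` A by move=> x [n _]; have [_ h _] := gB n; exact: h.
have Ut : pr (\bigcup_n B_ n) <= t by apply: pr_bigcup_ub => // n; have [] := gB n.
apply/eqP; rewrite eq_le Ut/= leNgt; apply/negP => ltUt.
have [|||C [mC CA C0 Ct]] := @atomless_small (A `\` \bigcup_n B_ n) (t - pr (\bigcup_n B_ n)).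
- exact: measurableD.
- by rewrite pr_sub//; lra.
- by lra.
have BU n : B_ n `<=` \bigcup_n B_ n by move=> x Bx; exists n.
have inc n : pr (B_ n) + pr C / 2 <= pr (B_ n.+1).
  have [_ _ /(_ C mC)] := gP _ (gB n); have := le_pr P (mB n) mU (BU n).
  rewrite -[g (B_ n)]/(B_ n.+1) => h1 h2; rewrite -lerBrDl; apply: h2; last lra.
  by move=> x /CA[Ax nx]; split => // /BU.
have lin n : pr C / 2 *+ n <= pr (B_ n).
  elim: n => [|n ih]; first by rewrite mulr0n pr_ge0.
  by rewrite mulrS addrC; apply: le_trans (inc n); rewrite lerD2r.
have C2 : 0 < pr C / 2 by lra.
have := archi_boundP (ltW (divr_gt0 ltr01 C2)); set N := Num.bound _ => hN.
have := le_trans (lin N) (pr_le1 P (mB N)).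
by rewrite -mulr_natr -ler_pdivlMl// mulr1 leNgt -[_^-1]mul1r hN.
Qed.

Lemma atomless_halve : exists h : set T -> set T, forall A, measurable A ->
  [/\ measurable (h A), h A `<=` A & pr (h A) = pr A / 2].
Proof.
have /choice[h hh] : forall A, exists B, measurable A ->
    [/\ measurable B, B `<=` A & pr B = pr A / 2].
  move=> A; have [mA|nA] := pselect (measurable A); last by exists A.
  have [|B hB] := @atomless_intermediate A (pr A / 2) mA; last by exists B.
  by have := pr_ge0 P A; lra.
by exists h.
Qed.

End atomless.

(* [K n i] is the event that the first [n] binary digits form the number [i]. *)
Section digits.
Context {d} {T : measurableType d} {R : realType}.
Variable K : nat -> nat -> set T.
Hypothesis K_ex : forall n w, exists i, K n i w.
Hypothesis K_uniq : forall n i j w, K n i w -> K n j w -> i = j.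
Hypothesis K_nest : forall n i w, K n.+1 i w -> K n i./2 w.
Hypothesis K_lt : forall n i w, K n i w -> (i < 2 ^ n)%N.

Definition from_digits (w : T) : R :=
  sup [set x | exists n i, K n i w /\ x = i%:R / 2 ^+ n].

Let nest n k i w : K (n + k)%N i w -> K n (i %/ 2 ^ k)%N w.
Proof.
elim: k i => [|k ih] i; first by rewrite addn0 expn0 divn1.
by rewrite addnS => /K_nest/ih; rewrite -divn2 -divnMA expnS mulnC.
Qed.

Let S w := [set x : R | exists n i, K n i w /\ x = i%:R / 2 ^+ n].

Let ub n i w : K n i w -> ubound (S w) (i.+1%:R / 2 ^+ n).
Proof.
move=> Kni x [m [j [Kmj ->]]].
have p2 k : 0 < 2 ^+ k :> R by rewrite exprn_gt0.
rewrite ler_pdivrMr// mulrAC ler_pdivlMr// -!natrX -!natrM ler_nat.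
have [nm|mn] := leqP n m.
  move: Kmj; rewrite -(subnKC nm) => /nest Kn; rewrite (K_uniq Kni Kn) expnD.
  rewrite [(2 ^ n * _)%N]mulnC mulnA leq_mul2r; apply/orP; right.
  exact/ltnW/ltn_ceil/expn_gt0.
move: Kni; rewrite -(subnKC (ltnW mn)) => /nest Km; rewrite (K_uniq Kmj Km) expnD.
rewrite mulnCA mulnC leq_mul2r; apply/orP; right; rewrite mulnC.
by rewrite mulnC (leq_trans (leq_trunc_div _ _)).
Qed.

Lemma from_digits_itv n i w : K n i w ->
  i%:R / 2 ^+ n <= from_digits w <= i.+1%:R / 2 ^+ n.
Proof.
move=> Kni; have inS : S w (i%:R / 2 ^+ n) by exists n, i.
apply/andP; split.
  by apply: sup_upper_bound => //; split; [exists (i%:R / 2 ^+ n)|exists (i.+1%:R / 2 ^+ n); exact: ub].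
by apply: ge_sup; [exists (i%:R / 2 ^+ n)|exact: ub].
Qed.

(** The value exceeds [x] exactly when the left end of some dyadic interval of [w] does, and these
    events form a countable union. *)
Lemma from_digits_measurable : (forall n i, measurable (K n i)) ->
  measurable_fun setT from_digits.
Proof.
move=> mK; apply: (measurability (@RGenOInfty.G R)).
  exact: RGenOInfty.measurableE.
move=> _ [_ [x ->] <-]; rewrite setTI.
rewrite (_ : _ @^-1` _ = \bigcup_n \bigcup_(i in [set i | x < i%:R / 2 ^+ n]) K n i).
  by apply: bigcup_measurable => n _; apply: bigcup_measurable.
apply/seteqP; split => w /=; rewrite in_itv/= andbT.
  have [i0 K0] := K_ex 0 w.
  have hS : has_sup (S w) by split; [exists (i0%:R / 2 ^+ 0), 0%N, i0|exists (i0.+1%:R / 2 ^+ 0); exact: ub].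
  move=> /(sup_gt hS.1)[_ [n [i [Kni ->]]] xi].
  by exists n => //; exists i.
by move=> [n _ [i /= xi /from_digits_itv /andP[h _]]]; exact: lt_le_trans h.
Qed.

End digits.

Section count.
Context {R : realType}.

Lemma sum_double (V : nmodType) (f : nat -> V) m :
  \sum_(0 <= i < m.*2) f i = \sum_(0 <= i < m) (f i.*2 + f i.*2.+1).
Proof.
elim: m => [|m ih]; first by rewrite !big_nil.
by rewrite doubleS !big_nat_recr//= ih addrA.
Qed.

(** Among the first [m] unit intervals, [below] counts those to the left of [z] and [upto] those
    that meet the ray ending at [z]. They enclose [z] truncated to [0, m] and differ by at most
    one. *)
Let below m (z : R) : R := \sum_(0 <= i < m) (i.+1%:R <= z)%R%:R.
Let upto m (z : R) : R := \sum_(0 <= i < m) (i%:R <= z)%R%:R.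

Lemma below_le m z : below m z <= Num.max 0 (Num.min z m%:R).
Proof.
elim: m => [|m ih]; first by rewrite /below big_nil le_max lexx.
rewrite /below big_nat_recr//= -/(below m z).
have [mz|zm] := leP m.+1%:R z; last first.
  by rewrite addr0 (le_trans ih)// ge_max !le_max lexx/= !ge_min lexx !orbT.
rewrite le_max; apply/orP; right.
rewrite -natr1 lerD2r (le_trans ih)// ge_max ler0n/= ge_min lexx orbT//.
Qed.

Lemma upto_ge m z : Num.max 0 (Num.min z m%:R) <= upto m z.
Proof.
elim: m => [|m ih]; first by rewrite /upto big_nil ge_max lexx/= ge_min lexx orbT.
rewrite /upto big_nat_recr//= -/(upto m z).
have [mz|zm] := leP m%:R z; last first.
  rewrite addr0; apply: le_trans ih; rewrite ge_max !le_max lexx/= le_min !ge_min lexx/=.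
  by rewrite (ltW zm) !orbT.
rewrite (le_trans _ (lerD ih (lexx 1)))// (min_idPr mz) (max_idPr (ler0n _ _)) natr1.
by rewrite ge_max ler0n ge_min lexx orbT.
Qed.

Lemma upto_below m z : upto m z <= below m z + 1.
Proof.
have : upto m.+1 z = (0 <= z)%R%:R + below m z by rewrite /upto big_nat_recl.
rewrite /upto big_nat_recr//= -/(upto m z); case: (0 <= z); case: (m%:R <= z) => /=; lra.
Qed.

End count.

Section quadtree.
Context {d} {T : measurableType d} {R : realType}.
Variable P : probability T R.
Local Notation pr := (pr P).
Variable h : set T -> set T.
Hypothesis hh : forall A, measurable A ->
  [/\ measurable (h A), h A `<=` A & pr (h A) = pr A / 2].

Let half (b : bool) A := if b then A `\` h A else h A.

(** Each level halves twice, once for the next digit of [i] and once for that of [j], which makes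
    the two digit sequences independent. Under [hh], indices from [2 ^ n] on give the empty set. *)
Fixpoint cell n i j : set T :=
  if n is n'.+1 then half (odd j) (half (odd i) (cell n' i./2 j./2))
  else if (i == 0%N) && (j == 0%N) then setT else set0.

Let half_measurable b A : measurable A -> measurable (half b A).
Proof. by move=> mA; have [mh _ _] := hh mA; case: b => //=; exact: measurableD. Qed.

Let half_sub b A : measurable A -> half b A `<=` A.
Proof. by move=> mA; have [_ hA _] := hh mA; case: b => //= x []. Qed.

Let pr_half b A : measurable A -> pr (half b A) = pr A / 2.
Proof. by move=> mA; have [mh hA hE] := hh mA; case: b => //=; rewrite pr_sub// hE; lra. Qed.

Let half_inj b c A w : half b A w -> half c A w -> b = c.
Proof. by case: b; case: c => //= p q; exfalso; [case: p|case: q] => _; apply. Qed.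

Lemma cell_measurable n i j : measurable (cell n i j).
Proof.
elim: n i j => [|n ih] i j /=; first by case: ifP.
exact/half_measurable/half_measurable.
Qed.

Lemma pr_cell n i j : pr (cell n i j) <= (2 ^+ n * 2 ^+ n)^-1.
Proof.
elim: n i j => [|n ih] i j /=.
  by case: ifP => _; rewrite ?prT ?pr0 mulr1 invr1.
rewrite !pr_half//; [|exact: cell_measurable|exact/half_measurable/cell_measurable].
have := ih i./2 j./2; rewrite !exprS; set c := 2 ^+ n => hc.
have c0 : 0 < c by rewrite exprn_gt0.
rewrite [leRHS](_ : _ = (c * c)^-1 / 2 / 2); first lra.
by field; rewrite gt_eqF.
Qed.

Lemma pr_cell_ge n i j : (i < 2 ^ n)%N -> (j < 2 ^ n)%N ->
  (2 ^+ n * 2 ^+ n)^-1 <= pr (cell n i j).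
Proof.
elim: n i j => [|n ih] i j /=.
  by rewrite expn0 !ltnS !leqn0 => /eqP-> /eqP->; rewrite eqxx/= prT mulr1 invr1.
rewrite !pr_half//; [|exact: cell_measurable|exact/half_measurable/cell_measurable].
rewrite expnS => i2 j2.
have := ih i./2 j./2 ltac:(have := odd_double_half i; lia) ltac:(have := odd_double_half j; lia).
rewrite !exprS; set c := 2 ^+ n => hc.
have c0 : 0 < c by rewrite exprn_gt0.
rewrite [leLHS](_ : _ = (c * c)^-1 / 2 / 2); first lra.
by field; rewrite gt_eqF.
Qed.

Lemma cell_uniq n i j i' j' w : cell n i j w -> cell n i' j' w -> i = i' /\ j = j'.
Proof.
elim: n i j i' j' => [|n ih] i j i' j' /=.
  by case: ifP => // /andP[/eqP-> /eqP->] _; case: ifP => // /andP[/eqP-> /eqP->].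
move=> h1 h2; have mc := cell_measurable.
have g1 := half_sub (half_measurable _ (mc _ _ _)) h1.
have g2 := half_sub (half_measurable _ (mc _ _ _)) h2.
have [ei ej] := ih _ _ _ _ (half_sub (mc _ _ _) g1) (half_sub (mc _ _ _) g2).
rewrite ei ej in g1 h1; have oi := half_inj g1 g2; rewrite oi in h1.
have oj := half_inj h1 h2.
by rewrite -[i]odd_double_half -[j]odd_double_half ei ej oi oj !odd_double_half.
Qed.

Lemma cell_ex n w : exists i j, cell n i j w.
Proof.
elim: n => [|n [i [j cw]]]; first by exists 0%N, 0%N.
have half_ex A : A w -> exists b : bool, half b A w.
  by move=> Aw; have [?|?] := pselect (h A w); [exists false|exists true].
have [a aw] := half_ex _ cw; have [b bw] := half_ex _ aw.
exists (a + i.*2)%N, (b + j.*2)%N; rewrite /= !half_bit_double !oddD !odd_double !addbF.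
by case: a aw bw; case: b.
Qed.

Lemma cell_half n i j w : cell n.+1 i j w -> cell n i./2 j./2 w.
Proof.
move=> /= /(half_sub (half_measurable _ (cell_measurable _ _ _))).
by move/(half_sub (cell_measurable _ _ _)).
Qed.

Lemma pr_cells n E : measurable E ->
  pr E = \sum_(0 <= i < 2 ^ n) \sum_(0 <= j < 2 ^ n) pr (E `&` cell n i j).
Proof.
move=> mE; elim: n => [|n ih]; first by rewrite expn0 !big_nat1/= setIT.
have prhalf A : measurable A -> pr (E `&` A) = pr (E `&` half false A) + pr (E `&` half true A).
  move=> mA; have [mh hA _] := hh mA.
  rewrite (@prDI _ _ _ P (E `&` A) (h A))//; last exact: measurableI.
  rewrite addrC; congr (_ + _); last by rewrite /= setIDA.
  by rewrite -setIA (setIidr hA).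
rewrite ih expnS mul2n sum_double; apply: eq_bigr => i _.
rewrite !sum_double -big_split/=; apply: eq_bigr => j _.
rewrite /= !doubleK !uphalf_double !odd_double/=.
have mc := cell_measurable n i j.
rewrite (prhalf _ mc) (prhalf _ (half_measurable false mc)) (prhalf _ (half_measurable true mc)).
lra.
Qed.

End quadtree.

(** The factor 3 comes from [u * e + e * v + e * e], all factors being at most 1. *)
Lemma mul_approx {R : realFieldType} (u v e ax ay bx by' p : R) :
  0 <= u -> u <= 1 -> 0 <= v -> v <= 1 -> 0 < e <= 1 ->
  [/\ 0 <= bx, bx <= u, u <= ax & ax <= bx + e] ->
  [/\ 0 <= by', by' <= v, v <= ay & ay <= by' + e] ->
  p <= ax * ay -> bx * by' <= p -> p - u * v <= 3 * e /\ u * v - p <= 3 * e.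
Proof.
move=> u0 u1 v0 v1 /andP[e0 e1] [bx0 bxu uax axb] [by0 byv vay ayb] h1 h2; split.
  have : ax * ay <= (u + e) * (v + e) by apply: ler_pM; lra.
  have : u * e <= e by rewrite ler_piMl// ltW.
  have : e * v <= e by rewrite ler_piMr// ltW.
  have : e * e <= e by rewrite ler_piMr// ltW.
  rewrite mulrDl !mulrDr; lra.
have : u * v - bx * by' = u * (v - by') + (u - bx) * by' by ring.
have : u * (v - by') <= 1 * e by apply: ler_pM; lra.
have : (u - bx) * by' <= e * 1 by apply: ler_pM; lra.
lra.
Qed.

Section independent_uniforms.
Context {d} {T : measurableType d} {R : realType}.
Variable P : probability T R.
Hypothesis hP : atomless P.
Local Notation lam := (unif : probability R R).

Let squeeze0 (a : R) : (forall n, a <= 3 / 2 ^+ n) -> a <= 0.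
Proof.
move=> ha; rewrite leNgt; apply/negP => a0.
have := ha (Num.bound (3 / a)); rewrite leNgt => /negP; apply.
rewrite ltr_pdivrMr ?exprn_gt0// mulrC -ltr_pdivrMr//.
by apply: upper_nthrootP.
Qed.

(** The joint distribution function at (x, y) lies between the mass of the cells inside the quadrant
    and that of the cells meeting it. Both masses are products of one counting factor per axis, so
    the distance to [clip x * clip y] is at most [3 / 2 ^+ n]. *)
Lemma exists_independent_uniforms : exists U V : T -> R,
  [/\ has_law P (lam \x lam)%E (fun w => (U w, V w)),
      forall w, 0 <= U w <= 1 & forall w, 0 <= V w <= 1].
Proof.
have [h hh] := atomless_halve hP.
have mc := cell_measurable hh; have exc := cell_ex h.
pose K1 n i := \bigcup_j cell h n i j.
pose K2 n j := \bigcup_i cell h n i j.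
have K1ex n w : exists i, K1 n i w by have [i [j c]] := exc n w; exists i, j.
have K2ex n w : exists i, K2 n i w by have [i [j c]] := exc n w; exists j, i.
have K1u n i i' w : K1 n i w -> K1 n i' w -> i = i'.
  by move=> [j _ c] [j' _ c']; have [] := cell_uniq hh c c'.
have K2u n i i' w : K2 n i w -> K2 n i' w -> i = i'.
  by move=> [j _ c] [j' _ c']; have [] := cell_uniq hh c c'.
have K1n n i w : K1 n.+1 i w -> K1 n i./2 w.
  by move=> [j _ /(cell_half hh)]; exists j./2.
have K2n n i w : K2 n.+1 i w -> K2 n i./2 w.
  by move=> [j _ /(cell_half hh)]; exists j./2.
have mK1 n i : measurable (K1 n i) by exact: bigcup_measurable.
have mK2 n i : measurable (K2 n i) by exact: bigcup_measurable.
pose U := @from_digits _ _ R K1; pose V := @from_digits _ _ R K2.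
have mU : measurable_fun setT U by exact: from_digits_measurable.
have mV : measurable_fun setT V by exact: from_digits_measurable.
have [Ub Vb] : (forall w, 0 <= U w <= 1) /\ (forall w, 0 <= V w <= 1).
  split=> w; have [i [j c]] := exc 0%N w; move: (c) => /=; case: ifP => // /andP[/eqP i0 /eqP j0] _;
  rewrite i0 j0 in c.
    have := @from_digits_itv _ _ R K1 K1u K1n 0%N 0%N w; rewrite mul0r divr1; apply.
    by exists 0%N.
  have := @from_digits_itv _ _ R K2 K2u K2n 0%N 0%N w; rewrite mul0r divr1; apply.
  by exists 0%N.
have mE x y : measurable [set w | U w <= x /\ V w <= y].
  by apply: measurableI; exact: measurable_ler.
have UV x y : pr P [set w | U w <= x /\ V w <= y] = clip x * clip y.
  set E := [set w | _].
  have p2 n : 0 < 2 ^+ n :> R by rewrite exprn_gt0.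
  have cell_itv n i j w : cell h n i j w ->
      [/\ i%:R <= 2 ^+ n * U w <= i.+1%:R & j%:R <= 2 ^+ n * V w <= j.+1%:R].
    move=> c; have := @from_digits_itv _ _ R K1 K1u K1n n i w (ex_intro2 _ _ j I c).
    have := @from_digits_itv _ _ R K2 K2u K2n n j w (ex_intro2 _ _ i I c).
    by rewrite -/U -/V !ler_pdivrMr// !ler_pdivlMr// ![_ * 2 ^+ n]mulrC.
  pose b n (z : R) := \sum_(0 <= i < 2 ^ n) (i.+1%:R <= 2 ^+ n * z)%R%:R / 2 ^+ n : R.
  pose a n (z : R) := \sum_(0 <= i < 2 ^ n) (i%:R <= 2 ^+ n * z)%R%:R / 2 ^+ n : R.
  have clipE n (z : R) : Num.max 0 (Num.min (2 ^+ n * z) (2 ^ n)%:R) / 2 ^+ n = clip z.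
    rewrite natrX /clip; set c := 2 ^+ n; have c0 : 0 < c by exact: p2.
    have -> : Num.min (c * z) c = c * Num.min z 1 by rewrite -{2}[c]mulr1 minr_pMr ?ltW.
    have -> (m : R) : Num.max 0 (c * m) = c * Num.max 0 m by rewrite maxr_pMr ?mulr0 ?ltW.
    by rewrite mulrC mulKf// gt_eqF.
  have ab n z : [/\ 0 <= b n z, b n z <= clip z, clip z <= a n z & a n z <= b n z + 2 ^- n].
    rewrite -(clipE n) /a /b -!mulr_suml; set ai := 2 ^- n.
    have ai0 : 0 < ai by rewrite invr_gt0.
    split.
    - by apply: mulr_ge0; [exact: sumr_ge0|exact: ltW].
    - by apply: ler_wpM2r; [exact: ltW|exact: below_le].
    - by apply: ler_wpM2r; [exact: ltW|exact: upto_ge].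
    rewrite -[X in _ + X]mul1r -mulrDl; apply: ler_wpM2r; [exact: ltW|exact: upto_below].
  have ub n : pr P E <= a n x * a n y.
    rewrite (pr_cells hh n)//; last exact: mE.
    rewrite /a big_distrl/=; apply: ler_sum => i _; rewrite big_distrr/=; apply: ler_sum => j _.
    have [/= [w [[Ux Vy] c]]|none] := pselect (exists w, (E `&` cell h n i j) w).
      have [/andP[i1 _] /andP[j1 _]] := cell_itv _ _ _ _ c.
      have -> : i%:R <= 2 ^+ n * x by apply: le_trans i1 _; exact: (ler_wpM2l (ltW (p2 n))).
      have -> : j%:R <= 2 ^+ n * y by apply: le_trans j1 _; exact: (ler_wpM2l (ltW (p2 n))).
      rewrite !mul1r -invfM; apply: le_trans (pr_cell hh n i j).
      by apply: le_pr; [apply: measurableI; [exact: mE|exact: mc]|exact: mc|exact: subIsetr].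
    rewrite (_ : E `&` _ = set0) ?pr0; first by rewrite mulr_ge0// divr_ge0 ?ler0n ?ltW.
    by apply/seteqP; split => // w Ew; apply: none; exists w.
  have lb n : b n x * b n y <= pr P E.
    rewrite (pr_cells hh n)//; last exact: mE.
    rewrite /b big_distrl/=; apply: ler_sum_nat => i /andP[_ i2].
    rewrite big_distrr/=; apply: ler_sum_nat => j /andP[_ j2].
    have [ix|_] := leP i.+1%:R (2 ^+ n * x); last by rewrite !mul0r pr_ge0.
    have [jy|_] := leP j.+1%:R (2 ^+ n * y); last by rewrite mul0r mulr0 pr_ge0.
    rewrite !mul1r -invfM (setIidr _); first exact: pr_cell_ge.
    move=> w c; have [/andP[_ i1] /andP[_ j1]] := cell_itv _ _ _ _ c.
    by split; rewrite -(ler_pM2l (p2 n)); [exact: le_trans ix|exact: le_trans jy].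
  have cx := clip_ge0 x; have cy := clip_ge0 y; have cx1 := clip_le1 x; have cy1 := clip_le1 y.
  have small n : (0 < (2 ^- n : R)) && ((2 ^- n : R) <= 1).
    by rewrite invr_gt0 p2/= invf_le1 ?p2// exprn_ege1// ler1n.
  have close n := mul_approx cx cx1 cy cy1 (small n) (ab n x) (ab n y) (ub n) (lb n).
  apply/eqP; rewrite eq_le -[_ <= _ * _]subr_le0 -[_ * _ <= _]subr_le0.
  by apply/andP; split; apply: squeeze0 => n; have [] := close n.
exists U, V; split => //; apply: has_law_cdf2 => //.
- move=> x y; rewrite (prE P (mE x y)) UV EFinM; congr (_ * _)%E; exact/esym/unif_cdf.
- move=> x; rewrite [RHS]unif_cdf.
  rewrite (_ : [set w | _] = [set w | U w <= x /\ V w <= 1]).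
    by rewrite (prE P (mE _ _)) UV (@clip_id _ 1) ?ler01 ?lexx// mulr1.
  by apply/seteqP; split => w /=; [move=> ->; have /andP[] := Vb w|case].
- move=> y; rewrite [RHS]unif_cdf.
  rewrite (_ : [set w | _] = [set w | U w <= 1 /\ V w <= y]).
    by rewrite (prE P (mE _ _)) UV (@clip_id _ 1) ?ler01 ?lexx// mul1r.
  by apply/seteqP; split => w /=; [move=> ->; have /andP[] := Ub w|case].
Qed.

End independent_uniforms.

(** * Copulas *)

Section unif_pr.
Context {R : realType}.
Local Notation unif := (unif : probability R R).

Lemma pr_unif_cdf (u : R) : pr unif `]-oo, u]%classic = clip u.
Proof. by rewrite -[RHS]/(fine (clip u)%:E); congr fine; exact: unif_cdf. Qed.

Lemma pr_unif_itvoc (a b : R) : a <= b -> pr unif `]a, b]%classic = clip b - clip a.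
Proof. by move=> ab; rewrite -[RHS]/(fine (clip b - clip a)%:E); congr fine; exact: unif_itvoc. Qed.

Lemma pr_unif_itvoo (a b : R) : a < b -> pr unif `]a, b[%classic = clip b - clip a.
Proof. by move=> ab; rewrite -[RHS]/(fine (clip b - clip a)%:E); congr fine; exact: unif_itvoo. Qed.

Lemma pr_law_cdf {d} {S : measurableType d} (m : probability S R) (f : S -> R) u :
  has_law m unif f -> pr m [set w | f w <= u] = clip u.
Proof.
move=> [mf fA]; rewrite -pr_unif_cdf /pr -fA//; congr (fine (m _)).
Qed.

Lemma clip_lip (u v : R) : u <= v -> clip v - clip u <= v - u.
Proof. by move=> uv; rewrite /clip /Num.max /Num.min; do 4 case: ifPn; rewrite -?leNgt; lra. Qed.

End unif_pr.

(** Cut (0,1] into pieces shorter than the mass of [A]; some piece meets [A] in positive mass, and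
    that mass is smaller than the mass of [A]. Needed in order to split one uniform variable into
    two independent ones. *)
Lemma unif_atomless {R : realType} : atomless (unif : probability R R).
Proof.
move=> A mA; rewrite prE// lte_fin => A0.
set a := pr _ A in A0 *.
pose n := Num.bound a^-1.
have n0 : 0 < n%:R :> R by apply: lt_trans (archi_boundP _); rewrite ?invr_gt0 ?invr_ge0 ?(ltW A0).
have na : n%:R^-1 < a by rewrite -[ltRHS]invrK ltf_pV2 ?posrE ?invr_gt0//; apply: archi_boundP; rewrite invr_ge0 ltW.
pose J i := A `&` `]i%:R / n%:R, i.+1%:R / n%:R]%classic.
have mJ i : measurable (J i) by exact: measurableI.
have Jn i : i%:R / n%:R <= i.+1%:R / n%:R :> R by rewrite ler_pM2r ?invr_gt0// ler_nat.
have [[i Ji]|none] := pselect (exists i, 0 < pr unif (J i)).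
  exists (J i); rewrite !prE// !lte_fin; split => //; first by move=> x [].
  apply: le_lt_trans na.
  have : pr unif (J i) <= pr unif `]i%:R / n%:R, i.+1%:R / n%:R]%classic.
    by apply: le_pr => // x [].
  move=> /le_trans; apply; rewrite pr_unif_itvoc// (le_trans (clip_lip (Jn i)))//.
  by rewrite -natr1 mulrDl mul1r addrAC subrr add0r.
exfalso; have J0 i : pr unif (J i) = 0.
  by apply/eqP; rewrite eq_le pr_ge0 andbT leNgt; apply/negP => h; apply: none; exists i.
have Ik k : pr unif (A `&` `]0, k%:R / n%:R]%classic) = 0.
  elim: k => [|k ih].
    by rewrite mul0r set_itv_ge ?setI0 ?pr0// bnd_simp ltxx.
  rewrite (_ : A `&` _ = (A `&` `]0, k%:R / n%:R]%classic) `|` J k); last first.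
    rewrite -setIUr; congr (_ `&` _); apply/seteqP; split => x /=; rewrite !in_itv/=.
      by move=> /andP[-> ->]; case: (leP x (k%:R / n%:R)) => ?; [left|right].
    have k0 : 0 <= k%:R / n%:R :> R by rewrite divr_ge0 ?ler0n ?ltW.
    by have := Jn k; move=> h [/andP[h1 h2]|/andP[h1 h2]]; apply/andP; lra.
  rewrite prU ?J0 ?ih ?addr0//; first exact: measurableI.
  by apply/seteqP; split => // x /= [[_ +] [_ +]]; rewrite !in_itv/= => /andP[_ h1] /andP[h2 _]; have := lt_le_trans h2 h1; rewrite ltxx.
have := Ik n; rewrite divff ?gt_eqF// => A01.
have : a <= pr unif (A `&` `]0, 1]%classic) + pr unif (~` `]0, 1]%classic).
  rewrite /a (@prDI _ _ _ unif A `]0, 1]%classic)// addrC lerD2l.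
  by apply: le_pr; [exact: measurableD|exact: measurableC|move=> x []].
rewrite A01 prC// pr_unif_itvoc// !clip_id/= ?ler01 ?lexx//; lra.
Qed.

Section coupling.
Context {d} {S : measurableType d} {R : realType}.
Variables (m : probability S R) (f g : S -> R).
Hypotheses (hf : has_law m unif f) (hg : has_law m unif g).
Local Notation pr := (pr m).

Definition joint_cdf (u v : R) : R := pr [set w | f w <= u /\ g w <= v].

Let F u := [set w | f w <= u].
Let G v := [set w | g w <= v].

Let mF u : measurable (F u). Proof. exact/measurable_ler/hf.1. Qed.
Let mG v : measurable (G v). Proof. exact/measurable_ler/hg.1. Qed.
Let mFG u v : measurable (F u `&` G v). Proof. exact: measurableI. Qed.

Let prF u : pr (F u) = clip u.
Proof. exact: pr_law_cdf. Qed.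

Let prG u : pr (G u) = clip u.
Proof. exact: pr_law_cdf. Qed.

Lemma joint_cdf_copula : copula joint_cdf.
Proof.
have mfg : measurable_fun setT (fun w => (f w, g w)) by apply: measurable_fun_pair; [exact: hf.1|exact: hg.1].
pose H : {mfun S >-> (R * R)%type} :=
  HB.pack (fun w => (f w, g w)) (@isMeasurableFun.Build _ _ _ _ _ mfg).
exists (distribution m H); split.
- move=> A mA; rewrite -[RHS]/(unif A) -hf.2//; congr (m _); apply/seteqP.
  by split => w //= [].
- move=> A mA; rewrite -[RHS]/(unif A) -hg.2//; congr (m _); apply/seteqP.
  by split => w //= [].
- move=> u v; rewrite -prE; last exact: mFG.
  by congr (m _); apply/seteqP; split => w /=; rewrite !in_itv.
Qed.

Lemma joint_cdf_le1 u v : joint_cdf u v <= clip u.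
Proof. by rewrite -prF; apply: le_pr; [exact: mFG|exact: mF|move=> w []]. Qed.

Lemma joint_cdf_le2 u v : joint_cdf u v <= clip v.
Proof. by rewrite -prG; apply: le_pr; [exact: mFG|exact: mG|move=> w []]. Qed.

Lemma joint_cdf_mono u v u' v' : u <= u' -> v <= v' -> joint_cdf u v <= joint_cdf u' v'.
Proof.
move=> uu vv; apply: le_pr; [exact: mFG|exact: mFG|].
by move=> w [h1 h2]; split; [exact: le_trans uu|exact: le_trans vv].
Qed.

(** Enlarging the quadrant adds at most one vertical and one horizontal strip, whose masses are
    given by the margins. *)
Lemma joint_cdf_lip u v u' v' : u <= u' -> v <= v' ->
  joint_cdf u' v' <= joint_cdf u v + (clip u' - clip u) + (clip v' - clip v).
Proof.
move=> uu vv.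
have FF : F u `<=` F u' by move=> w /le_trans; exact.
have GG : G v `<=` G v' by move=> w /le_trans; exact.
rewrite /joint_cdf -[X in pr X <= _]/(F u' `&` G v') -[pr [set _ | _]]/(pr (F u `&` G v)).
rewrite (@prDI _ _ _ m _ (F u) (mFG _ _) (mF u)).
have -> : F u' `&` G v' `&` F u = F u `&` G v'.
  by apply/seteqP; split => w; [move=> [[]]|move=> [? ?]; split => //; split => //; exact: FF].
rewrite (@prDI _ _ _ m (F u `&` G v') (G v) (mFG _ _) (mG v)).
have -> : F u `&` G v' `&` G v = F u `&` G v.
  by apply/seteqP; split => w; [move=> [[]]|move=> [? ?]; split => //; split => //; exact: GG].
have : pr ((F u' `&` G v') `\` F u) <= clip u' - clip u.
  rewrite -!prF -pr_sub//; apply: le_pr; [apply: measurableD; [exact: mFG|]| |] => //.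
    exact: measurableD.
  by move=> w [[]].
have : pr ((F u `&` G v') `\` G v) <= clip v' - clip v.
  rewrite -!prG -pr_sub//; apply: le_pr; [apply: measurableD; [exact: mFG|]| |] => //.
    exact: measurableD.
  by move=> w [[]].
lra.
Qed.

End coupling.

Section measure_of_mass1.
Context {d} {S : measurableType d} {R : realType}.
Variable M : {measure set S -> \bar R}.
Hypothesis MT : M setT = 1%E.

Let Q : set S -> \bar R := M.
Let Q0 : Q set0 = 0%E. Proof. exact: measure0. Qed.
Let Q_ge0 A : (0 <= Q A)%E. Proof. exact: measure_ge0. Qed.
Let Q_sigma_additive : semi_sigma_additive Q.
Proof. exact: measure_semi_sigma_additive. Qed.

HB.instance Definition _ := isMeasure.Build _ S R Q Q0 Q_ge0 Q_sigma_additive.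
HB.instance Definition _ := @Measure_isProbability.Build _ S R Q MT.

Lemma exists_probability : exists P : probability S R, forall A, P A = M A.
Proof. by exists Q. Qed.

End measure_of_mass1.

Section copulas.
Context {R : realType}.
Implicit Types C : R -> R -> R.

Lemma copula_joint C : copula C -> exists m : probability (R * R)%type R,
  [/\ has_law m unif fst, has_law m unif snd & C = joint_cdf m fst snd].
Proof.
move=> [m [m1 m2 mC]]; exists m; split.
- split; first exact: measurable_fst.
  move=> A mA; rewrite -[RHS](m1 A mA); congr (m _); apply/seteqP.
  by split => -[x y] /=; tauto.
- split; first exact: measurable_snd.
  move=> A mA; rewrite -[RHS](m2 A mA); congr (m _); apply/seteqP.
  by split => -[x y] /=; tauto.
- apply/funext => u; apply/funext => v; apply: EFin_inj; rewrite mC /joint_cdf -prE.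
    by congr (m _); apply/seteqP; split => -[x y] /=; rewrite !in_itv.
  by apply: measurableI; [apply: (@measurable_ler _ _ _ fst u); exact: measurable_fst|apply: (@measurable_ler _ _ _ snd v); exact: measurable_snd].
Qed.

Lemma copula_le1 C u v : copula C -> C u v <= clip u.
Proof. by move=> /copula_joint[m [m1 m2 ->]]; exact: joint_cdf_le1. Qed.

Lemma copula_le2 C u v : copula C -> C u v <= clip v.
Proof. by move=> /copula_joint[m [m1 m2 ->]]; exact: joint_cdf_le2. Qed.

Lemma copula_mono C u v u' v' : copula C -> u <= u' -> v <= v' -> C u v <= C u' v'.
Proof. by move=> /copula_joint[m [m1 m2 ->]]; exact: joint_cdf_mono. Qed.

Lemma copula_lip C u v u' v' : copula C -> u <= u' -> v <= v' ->
  C u' v' <= C u v + (clip u' - clip u) + (clip v' - clip v).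
Proof. by move=> /copula_joint[m [m1 m2 ->]]; exact: joint_cdf_lip. Qed.

Lemma copula_ge0 C u v : copula C -> 0 <= C u v.
Proof. by move=> /copula_joint[m [m1 m2 ->]]; exact: pr_ge0. Qed.

Lemma id_law : has_law unif unif (@idfun R).
Proof. by split => //; exact: measurable_id. Qed.

Definition comonotone (u v : R) : R := clip (Num.min u v).

Lemma comonotone_copula : copula comonotone.
Proof.
have -> : comonotone = joint_cdf unif (@idfun R) (@idfun R).
  apply/funext => u; apply/funext => v; rewrite /comonotone /joint_cdf -pr_unif_cdf; congr (fine (unif _)).
  by apply/seteqP; split => w /=; rewrite in_itv/= le_min; [move=> /andP[]|case=> -> ->].
by apply: joint_cdf_copula; exact: id_law.
Qed.

(** The Frechet-Hoeffding upper bound. By [DM] it places [comonotone] in every nonempty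
    concentration class. *)
Lemma comonotone_ge C u v : copula C -> C u v <= comonotone u v.
Proof.
move=> hC; rewrite /comonotone /Num.min; case: ifP => _; [exact: copula_le1|exact: copula_le2].
Qed.

(* If C(p,p) = p then {U <= p} and {V <= p} agree almost surely. *)
Lemma copula_tail_le C p u v : copula C -> 0 < p < 1 -> C p p = p -> u <= p -> p <= v ->
  C u v = clip u /\ C v u = clip u.
Proof.
move=> hC p01 Cp up pv; have cp : clip p = p by rewrite clip_id//; lra.
have h1 := copula_lip hC up (lexx p); have h2 := copula_lip hC (lexx p) up.
have h3 := copula_mono hC (lexx u) pv; have h4 := copula_mono hC pv (lexx u).
have h5 := copula_le1 u v hC; have h6 := copula_le2 v u hC.
by split; lra.
Qed.

(** Inclusion-exclusion: up to a null set the two lower events lie in one common event of mass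
    [p]. *)
Lemma copula_tail_ge C p u v : copula C -> 0 < p < 1 -> C p p = p -> u <= p -> v <= p ->
  clip u + clip v - p <= C u v.
Proof.
move=> hC p01 Cp up vp; have cp : clip p = p by rewrite clip_id//; lra.
have := copula_lip hC up vp; lra.
Qed.

Lemma nneseries_EFin (x : nat -> R) : cvgn (series x) ->
  (\sum_(0 <= n <oo) (x n)%:E = (limn (series x))%:E)%E.
Proof.
move=> cx; rewrite -EFin_lim//; congr (limn _); apply/funext => n.
by rewrite /= /series/= sumEFin.
Qed.

(** The measure behind the mixed function is the mixture of the measures behind the [C_ n]. *)
Lemma copula_mixture (C_ : nat -> R -> R -> R) (lam : nat -> R) :
  (forall n, copula (C_ n)) -> (forall n, 0 <= lam n) ->
  series lam @ \oo --> (1 : R) ->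
  copula (fun u v => limn (series (fun n => lam n * C_ n u v))).
Proof.
move=> hC lam0 lam1.
have /choice[m mP] := hC.
pose nn n := NngNum (lam0 n).
pose M : {measure set (R * R)%type -> \bar R} := mseries (fun n => mscale (nn n) (m n)) 0.
have ME A : M A = (\sum_(0 <= n <oo) ((lam n)%:E * m n A))%E by [].
have sum1 : (\sum_(0 <= n <oo) (lam n)%:E = 1)%E.
  by rewrite nneseries_EFin ?(cvg_lim _ lam1)//; apply/cvg_ex; exists 1.
have constE c : (\sum_(0 <= n <oo) ((lam n)%:E * c%:E) = c%:E)%E.
  rewrite (eq_eseriesr (g := fun n => (c%:E * (lam n)%:E)%E)).
    by rewrite nneseriesZl ?sum1 ?mule1// => n _; rewrite lee_fin.
  by move=> n _; rewrite muleC.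
have MT : M setT = 1%E.
  rewrite ME -(constE 1); apply: eq_eseriesr => n _; congr (_ * _)%E; exact: probability_setT.
have [Q QM] := exists_probability MT.
exists Q; split.
- move=> A mA; rewrite QM ME -[RHS]/(unif A) (prE (unif : probability R R) mA) -constE.
  apply: eq_eseriesr => n _; congr (_ * _)%E; have [-> // _ _] := mP n.
  exact: (prE (unif : probability R R)).
- move=> A mA; rewrite QM ME -[RHS]/(unif A) (prE (unif : probability R R) mA) -constE.
  apply: eq_eseriesr => n _; congr (_ * _)%E; have [_ -> // _] := mP n.
  exact: (prE (unif : probability R R)).
- move=> u v; rewrite QM ME -nneseries_EFin; last first.
    apply: (@series_le_cvg _ _ lam); [move=> n|exact: lam0|move=> n|by apply/cvg_ex; exists 1].
      by rewrite mulr_ge0// copula_ge0.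
    by rewrite ler_piMr// (le_trans (copula_le1 _ _ (hC n)))// clip_le1.
  by apply: eq_eseriesr => n _; rewrite EFinM; congr (_ * _)%E; have [_ _ ->] := mP n.
Qed.

End copulas.

(** * Random variables in [Linf]: almost sure bounds, laws and distribution functions *)

Section Linf.
Context {d} {T : measurableType d} {R : realType}.
Variable P : probability T R.
Implicit Types X Y : Linf P.
Local Notation pr := (pr P).

Lemma Lfun_bounded (f : T -> R) : bounded_measurable f -> f \in Lfun P +oo%E.
Proof.
move=> [mf [M hM]]; apply/andP; split; first by rewrite inE; exact: mf.
rewrite inE/= /finite_norm unlock; case: ifP => _; last exact: ltry.
apply: (@le_lt_trans _ _ M%:E); last exact: ltry.
by apply/ess_supP; apply: nearW => x /=; rewrite lee_fin.
Qed.

Definition Linf_of (f : T -> R) (bf : bounded_measurable f) : Linf P :=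
  Lfun_Sub (leey 1%E) (Lfun_bounded bf).

Lemma Linf_ofE f (bf : bounded_measurable f) w : Linf_of bf w = f w.
Proof. by []. Qed.

Lemma LinfD X Y w : (X + Y) w = X w + Y w.
Proof. by []. Qed.

Lemma Linf0 w : (0 : Linf P) w = 0.
Proof. by []. Qed.

Lemma Linf_measurable X : measurable_fun setT X.
Proof. exact: measurable_funP. Qed.

Lemma measurable_le X x : measurable [set w | X w <= x].
Proof. exact/measurable_ler/Linf_measurable. Qed.

Lemma measurable_norm_gt X (M : R) : measurable [set w | M < `|X w|].
Proof. by apply: measurable_gtr; apply: measurableT_comp => //; exact: Linf_measurable. Qed.

Lemma Linf_ae_bounded X : exists2 M : R, 0 < M & pr [set w | M < `|X w|] = 0.
Proof.
have : finite_norm P +oo%E X by exact: Lfunction_finite.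
rewrite /finite_norm unlock/= [P setT]probability_setT lte01.
set s := ess_sup _ _ => sy.
have sM : (s <= (`|fine s| + 1)%:E)%E.
  case: s sy => [r _| |]//=; last by rewrite leNye.
  by rewrite lee_fin (le_trans (ler_norm r))// lerDl.
exists (`|fine s| + 1); first by rewrite ltr_wpDl.
have /ess_supP[N [mN N0 hN]] := sM.
rewrite /pr (_ : P _ = 0%E)//; apply: (@subset_measure0 _ _ _ P _ N) => //.
  exact: measurable_norm_gt.
by move=> w /= Mw; apply: hN => /=; rewrite lee_fin leNgt Mw.
Qed.

Lemma eq_in_lawP X Y :
  (forall x, pr [set w | X w <= x] = pr [set w | Y w <= x]) <-> eq_in_law X Y.
Proof.
split=> [XY A mA|XY x].
  apply: eq_measure_cdf => //.
  - by change (P (X @^-1` setT) < +oo)%E; rewrite preimage_setT probability_setT ltry.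
  - move=> x; apply: (eq_trans (prE P (measurable_le X x))).
    by rewrite XY; exact: (esym (prE P (measurable_le Y x))).
have := XY `]-oo, x]%classic (measurable_itv _).
by rewrite /distribution /pushforward /pr => h; exact: (congr1 fine h).
Qed.

Lemma eq_in_law_refl X : eq_in_law X X. Proof. by []. Qed.

Lemma eq_in_law_sym X Y : eq_in_law X Y -> eq_in_law Y X.
Proof. by move=> XY A mA; rewrite XY. Qed.

Lemma eq_in_law_trans X Y Z : eq_in_law X Y -> eq_in_law Y Z -> eq_in_law X Z.
Proof. by move=> XY YZ A mA; rewrite XY ?YZ. Qed.

Lemma eq_in_law_int X Y (h : R -> R) : eq_in_law X Y -> bounded_measurable h ->
  \int[P]_w h (X w) = \int[P]_w h (Y w).
Proof.
move=> XY bh.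
have hX : has_law P (distribution P X) X by split; [exact: Linf_measurable|].
have hY : has_law P (distribution P X) Y.
  by split; [exact: Linf_measurable|move=> A mA; exact/esym/XY].
by rewrite (int_law hX bh) (int_law hY bh).
Qed.

Lemma eq_in_law_pr X Y (A : set R) : eq_in_law X Y -> measurable A ->
  pr [set w | A (X w)] = pr [set w | A (Y w)].
Proof. by move=> XY mA; rewrite /pr; congr fine; exact: XY. Qed.

Lemma dfunE X x : dfun X x = pr [set w | X w <= x].
Proof.
by rewrite /dfun /cdf /pr /distribution /pushforward; congr (fine (P _)); apply/seteqP; split => w /=; rewrite in_itv.
Qed.

End Linf.

(** * The classes D_p *)

Section null_sets.
Context {d} {T : measurableType d} {R : realType}.
Variable P : probability T R.
Local Notation pr := (pr P).

Lemma pr_sub0 A B : measurable A -> measurable B -> A `<=` B -> pr B = 0 -> pr A = 0.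
Proof.
by move=> mA mB AB B0; apply/eqP; rewrite eq_le pr_ge0 andbT -B0 le_pr.
Qed.

Lemma int_pr A : measurable A -> \int[P]_w (\1_A w : R) = pr A.
Proof. exact: int_indic. Qed.

Lemma pr0_measure A : measurable A -> pr A = 0 -> P A = 0%E.
Proof. by move=> mA A0; rewrite prE// A0. Qed.

Lemma pr_bigcup0 (F : nat -> set T) : (forall n, measurable (F n)) ->
  (forall n, pr (F n) = 0) -> pr (\bigcup_n F n) = 0.
Proof.
move=> mF F0; have : P.-negligible (\bigcup_n F n).
  apply: negligible_bigcup => n; apply/negligibleP => //.
  exact: pr0_measure.
move/negligibleP => h; rewrite /pr h//; exact: bigcup_measurable.
Qed.

Lemma pr_le_null A B N : measurable A -> measurable B -> measurable N -> pr N = 0 ->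
  A `<=` B `|` N -> pr A <= pr B.
Proof.
move=> mA mB mN N0 AB; rewrite (prDI P mA mN).
have -> : pr (A `&` N) = 0 by apply: (pr_sub0 _ mN) => //; exact: measurableI.
rewrite addr0; apply: le_pr => //; first exact: measurableD.
by move=> w [/AB[]].
Qed.

Lemma int_ae_eq (f g : T -> R) (N : set T) : bounded_measurable f ->
  bounded_measurable g -> measurable N -> pr N = 0 ->
  (forall w, ~ N w -> f w = g w) -> \int[P]_w f w = \int[P]_w g w.
Proof.
move=> bf bg mN N0 fg; apply/eqP; rewrite -subr_eq0 -intB// -normr_eq0.
have [mfg [M hM]] := bmB bf bg.
rewrite eq_le normr_ge0 andbT; apply: le_trans (le_normr_Rintegral _ _) _ => //.
  exact: (bm_integrable P (bmB bf bg)).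
apply: (@le_trans _ _ (\int[P]_w (M * \1_N w))).
  apply: int_le; [|exact/bmZ/bm_indic|].
    by split; [exact: measurableT_comp|exists M => x; rewrite normr_id].
  move=> w; rewrite indicE; have [wN|] := boolP (w \in N); first by rewrite mulr1.
  by rewrite notin_setE => nN; rewrite fg// subrr normr0 mulr0.
by rewrite intZ; [rewrite int_pr// N0 mulr0|exact: bm_indic].
Qed.

Lemma indic_bool (b : T -> bool) w : \1_[set w | b w] w = (b w)%:R :> R.
Proof. by rewrite indicE; congr ((nat_of_bool _)%:R); apply/idP/idP; rewrite inE. Qed.

(** Elements of [Linf] are bounded only almost surely; truncation at an almost sure bound replaces
    them by everywhere bounded functions without changing any integral. *)
Definition clamp (N x : R) : R := Num.max (- N) (Num.min x N).

Lemma clamp_bm (N : R) : 0 <= N -> bounded_measurable (clamp N).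
Proof.
move=> N0; split.
  by apply: measurable_maxr => //; exact: measurable_minr.
exists N => x; rewrite ler_norml /clamp le_max lexx/= ge_max ge_min lexx orbT andbT.
by rewrite (le_trans _ N0)// oppr_le0.
Qed.

Lemma clamp_norm (N x : R) : 0 <= N -> `|clamp N x| <= N.
Proof.
move=> N0; rewrite ler_norml /clamp le_max lexx/= ge_max ge_min lexx orbT andbT.
by rewrite (le_trans _ N0)// oppr_le0.
Qed.

Lemma clamp_id (N x : R) : `|x| <= N -> clamp N x = x.
Proof. by rewrite ler_norml /clamp => /andP[h1 h2]; rewrite (min_idPl h2) (max_idPr h1). Qed.

Lemma expectation_clamp (X : Linf P) (N : R) : 0 <= N -> pr [set w | N < `|X w|] = 0 ->
  fine ('E_P[X])%E = \int[P]_w clamp N (X w).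
Proof.
move=> N0 XN; have mX := Linf_measurable X.
have bY : bounded_measurable (fun w => clamp N (X w)) by exact: (bm_comp (clamp_bm N0)).
rewrite unlock /Rintegral; congr fine.
apply: ae_eq_integral => //.
- exact/measurable_EFinP.
- by apply/measurable_EFinP; exact: bY.1.
exists [set w | N < `|X w|]; split.
- by apply: measurable_gtr; exact: measurableT_comp.
- by apply: pr0_measure => //; apply: measurable_gtr; exact: measurableT_comp.
- move=> w /= h; rewrite ltNge; apply/negP => h'; apply: h => _.
  by rewrite /= clamp_id.
Qed.

End null_sets.

Section tail_class.
Context {d} {T : measurableType d} {R : realType}.
Variable P : probability T R.
Local Notation pr := (pr P).

(* The class D_p of the header. *)
Definition tail_class (p : R) : set (R -> R -> R) := [set C | copula C /\ C p p = p].

(** With [F c = p] the events {X n <= c} agree almost surely. Over this event every average has the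
    integral of [X 0], which falls short of [p] times the mean by some [kappa > 0]. Centred averages
    that are uniformly bounded and have integral [- kappa] over a fixed event cannot tend to 0 in
    probability. *)
Lemma tail_class_non_diversifiable (p : R) C : 0 < p < 1 -> tail_class p C ->
  non_diversifiable P C.
Proof.
move=> /andP[p0 p1] [hC Cp] X hX hcvg.
have law0 n : eq_in_law (X 0%N) (X n).
  elim: n => [|n ih]; first exact: eq_in_law_refl.
  by apply: eq_in_law_trans ih _; have [] := hX n.
pose F := dfun (X 0%N).
have FE n : dfun (X n) = F.
  by apply/funext => x; rewrite /F !dfunE; exact/esym/((eq_in_lawP _ _).2 (law0 n)).
have [M M0 XM] := Linf_ae_bounded (X 0%N).
(* The extra 1 puts {X <= - N} inside the null event {M < |X|}, so that [F (- N) = 0]. *)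
pose N := M + 1; have N0 : 0 <= N by rewrite /N; lra.
have mabs n : measurable [set w | N < `|X n w|].
  exact: measurable_norm_gt.
have mabsM : measurable [set w | M < `|X 0%N w|].
  exact: measurable_norm_gt.
have XN n : pr [set w | N < `|X n w|] = 0.
  transitivity (pr [set w | N < `|X 0%N w|]); last first.
    by apply: (pr_sub0 _ mabsM) => //= w /=; rewrite /N; lra.
  apply/esym; apply: (@eq_in_law_pr _ _ _ _ _ _ [set x | N < `|x|]); first exact: law0.
  by apply: measurable_gtr; exact: normr_measurable.
have FN : F (- N) = 0.
  rewrite /F dfunE; apply: (pr_sub0 _ mabsM) => //; first exact: measurable_le.
  by move=> w /= h; rewrite -normrN (lt_le_trans _ (ler_norm _))//; move: h; rewrite /N; lra.
have FN1 : F N = 1.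
  have : pr (~` [set w | N < `|X 0%N w|]) = 1 by rewrite prC// XN subr0.
  move=> h; apply/eqP; rewrite eq_le /F dfunE pr_le1; last exact: measurable_le.
  rewrite -{1}h; apply: le_pr; [exact: measurableC|exact: measurable_le|].
  by move=> w /= /negP; rewrite -leNgt; apply: le_trans; exact: ler_norm.
have ivt t : 0 < t < 1 -> exists c, (-N < c < N) /\ F c = t.
  move=> /andP[t0 t1]; have [|||c] := @IVT _ F (- N) N t.
  - lra.
  - by apply: continuous_subspaceT; have [+ _ _] := hX 0%N; exact.
  - by rewrite FN FN1 ge_min le_max (ltW t0) (ltW t1) orbT.
  rewrite in_itv/= => /andP[h1 h2] Fc; exists c; split => //.
  rewrite !lt_neqAle h1 h2 !andbT; apply/andP; split; apply/eqP => h.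
    by move: t0; rewrite -Fc -h FN ltxx.
  by move: t1; rewrite -Fc h FN1 ltxx.
have [c [/andP[Nc cN] Fc]] := ivt p ltac:(lra).
(* A second level, with mass [(1 - p) / 2] above it, makes the gap [kappa] strictly positive. Both
   levels lie strictly inside (-N, N), so truncation at [N] does not affect comparisons with
   them. *)
have [c' [/andP[Nc' cN'] Fc']] := ivt ((1 + p) / 2) ltac:(lra).
have cc : c < c'.
  rewrite ltNge; apply/negP => h; suff : F c' <= F c by rewrite Fc Fc'; lra.
  rewrite /F !dfunE; apply: le_pr; [exact: measurable_le|exact: measurable_le|].
  by move=> w /= /le_trans; exact.
pose A n := [set w | X n w <= c].
have mA n : measurable (A n) by exact: measurable_le.
have prA n : pr (A n) = p by rewrite -[LHS]dfunE FE.
have prAA n : pr (A n `&` A n.+1) = p.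
  have [_ _ [_ /(_ c c)]] := hX n; rewrite !FE Fc Cp => h.
  by rewrite /pr [P _]h.
have AD n : pr (A n `\` A n.+1) = 0.
  by have := prDI P (mA n) (mA n.+1); rewrite prA prAA; lra.
have AD' n : pr (A n.+1 `\` A n) = 0.
  by have := prDI P (mA n.+1) (mA n); rewrite setIC prA prAA; lra.
pose B := \bigcup_n ((A n `\` A n.+1) `|` (A n.+1 `\` A n)).
have mAD n : measurable ((A n `\` A n.+1) `|` (A n.+1 `\` A n)).
  by apply: measurableU; exact: measurableD.
have mB : measurable B by exact: bigcup_measurable.
have B0 : pr B = 0.
  apply: pr_bigcup0 => // n; apply/eqP; rewrite eq_le pr_ge0 andbT -(AD n).
  apply: (pr_le_null _ _ _ (AD' n)) => //; exact: measurableD.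
have AB n w : ~ B w -> A 0%N w <-> A n w.
  move=> nB; elim: n => [//|n ih]; rewrite ih.
  by split=> h; apply: contrapT => nA; apply: nB; exists n => //; [left|right].
pose Y n w := clamp N (X n w).
have bY n : bounded_measurable (Y n).
  by apply: (bm_comp (clamp_bm N0)); exact: Linf_measurable.
have b1A n : bounded_measurable (\1_(A n) : T -> R) by exact: bm_indic.
(* The event can be rewritten in terms of [X n] alone, and then only the law of [X n] matters. *)
have intAY n : \int[P]_w (\1_(A 0%N) w * Y n w) = \int[P]_w (\1_(A 0%N) w * Y 0%N w).
  transitivity (\int[P]_w (\1_(A n) w * Y n w)).
    apply: (int_ae_eq _ _ mB B0); [exact: bmM|exact: bmM|move=> w nB].
    congr (_ * _); rewrite !indicE; congr (_%:R); congr (nat_of_bool _).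
    by apply/idP/idP; rewrite !inE; apply AB.
  pose h x := (x <= c)%R%:R * clamp N x.
  have bh : bounded_measurable h.
    apply: bmM; last exact: clamp_bm.
    rewrite (_ : (fun x => _) = \1_(`]-oo, c]%classic)); first exact: bm_indic.
    by apply/funext => x; rewrite indicE mem_setE in_itv.
  have hE n' : (fun w => \1_(A n') w * Y n' w) = (fun w => h (X n' w)).
    by apply/funext => w; rewrite /h indicE mem_setE.
  by rewrite !hE; apply/esym/(eq_in_law_int (law0 n) bh).
pose e := fine ('E_P[X 0%N])%E.
have eE : e = \int[P]_w Y 0%N w by exact: expectation_clamp.
have intY n : \int[P]_w Y n w = e.
  by rewrite eE; apply/esym/(eq_in_law_int (law0 n) (clamp_bm N0)).
pose kappa := p * e - \int[P]_w (\1_(A 0%N) w * Y 0%N w).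
have kappa0 : 0 < kappa.
  have mc' : measurable [set w | c' < X 0%N w] by apply: measurable_gtr; exact: Linf_measurable.
  have prc' : pr [set w | c' < X 0%N w] = (1 - p) / 2.
    have -> : [set w | c' < X 0%N w] = ~` [set w | X 0%N w <= c'].
      by apply/seteqP; split => w /=; rewrite ltNge => /negP.
    have e1 : pr [set w | X 0%N w <= c'] = (1 + p) / 2 by rewrite -[LHS]dfunE FE.
    by rewrite prC; [rewrite e1; lra|exact: measurable_le].
  have b1 : bounded_measurable (fun w => p * Y 0%N w - \1_(A 0%N) w * Y 0%N w).
    by apply: bmB; [exact: bmZ|exact: bmM].
  have b2 : bounded_measurable (fun w => c * \1_(A 0%N) w : R) by exact: bmZ.
  have b3 : bounded_measurable (fun w => p * (c' - c) * \1_[set w | c' < X 0%N w] w : R).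
    exact/bmZ/bm_indic.
  have bc : bounded_measurable (fun _ : T => p * c) by exact: bm_cst.
  (* The right integrand is [(p - 1_A) * (Y - c)]: both factors are nonpositive on A, and off A it
     is [p * (Y - c)]. Subtracting [c] costs nothing since [p - 1_A] has integral 0. *)
  have : \int[P]_w (p * (c' - c) * \1_[set w | c' < X 0%N w] w) <=
      \int[P]_w ((p * Y 0%N w - \1_(A 0%N) w * Y 0%N w) - (p * c - c * \1_(A 0%N) w)).
    apply: int_le => //; first by apply: bmB => //; exact: bmB.
    move=> w.
    have Yc : (X 0%N w <= c) = (Y 0%N w <= c).
      by rewrite /Y /clamp ge_max ge_min (lt_geF cN) orbF (ltW Nc).
    have Yc' : c' < X 0%N w -> c' < Y 0%N w.
      by move=> h; rewrite /Y /clamp lt_max lt_min h cN' orbT.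
    rewrite (indic_bool (fun w => c' < X 0%N w)) (indic_bool (fun w => X 0%N w <= c)) Yc.
    move: (Y 0%N w) Yc Yc' => y _ h.
    have [yc|yc] := leP y c; have [xc|xc] := ltP c' (X 0%N w) => /=; rewrite ?mulr1 ?mulr0 ?mul0r ?mul1r ?subr0.
    - by have := h xc; lra.
    - by have := mulr_le0_ge0 (_ : p - 1 <= 0) (_ : 0 <= c - y); nra.
    - by have := h xc; nra.
    - nra.
  rewrite intB//; last exact: bmB.
  rewrite intB//; [|exact: bmZ|exact: bmM].
  rewrite (intB P bc b2) int_cst !intZ//; last exact: bm_indic.
  rewrite (int_pr P mc') (int_pr P (mA 0%N)) prc' prA intY.
  have : 0 < p * (c' - c) * ((1 - p) / 2) by rewrite !mulr_gt0//; lra.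
  by rewrite /kappa; lra.
pose S n w := n.+1%:R^-1 * (\sum_(i < n.+1) Y i w) - e.
have bce : bounded_measurable (fun _ : T => e) by exact: bm_cst.
have bS n : bounded_measurable (S n).
  by apply: bmB => //; apply: bmZ; exact: bm_sum.
pose K := N + `|e|.
have n1 n : 0 < n.+1%:R :> R by rewrite ltr0n.
have SK n w : `|S n w| <= K.
  rewrite /S (le_trans (ler_normB _ _))// lerD2r normrM gtr0_norm ?invr_gt0//.
  rewrite mulrC ler_pdivrMr// (le_trans (ler_norm_sum _ _ _))//.
  apply: (@le_trans _ _ (\sum_(i < n.+1) N)); first by apply: ler_sum => i _; exact: clamp_norm.
  by rewrite sumr_const card_ord mulr_natr.
have intAS n : \int[P]_w (\1_(A 0%N) w * S n w) = - kappa.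
  transitivity (\int[P]_w (n.+1%:R^-1 * (\sum_(i < n.+1) (\1_(A 0%N) w * Y i w)) - e * \1_(A 0%N) w)).
    by apply: eq_Rintegral => w _; rewrite /S mulrBr -mulr_sumr mulrCA [e * _]mulrC.
  have bAY i : bounded_measurable (fun w => \1_(A 0%N) w * Y i w) by exact: bmM.
  rewrite intB; [|apply: bmZ; exact: (@bm_sum _ _ _ _ _ (fun (i : 'I_n.+1) w => \1_(A 0%N) w * Y i w))|exact: bmZ].
  rewrite intZ; last exact: (@bm_sum _ _ _ _ _ (fun (i : 'I_n.+1) w => \1_(A 0%N) w * Y i w)).
  rewrite (@int_sum _ _ _ P _ _ (fun (i : 'I_n.+1) w => \1_(A 0%N) w * Y i w))//.
  under eq_bigr do rewrite intAY.
  rewrite sumr_const card_ord intZ// (int_pr P (mA 0%N)) prA -[X in _^-1 * X]mulr_natl mulKf ?gt_eqF//.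
  by rewrite /kappa; lra.
pose NX := \bigcup_n [set w | N < `|X n w|].
have mNX : measurable NX by exact: bigcup_measurable.
have NX0 : pr NX = 0 by exact: pr_bigcup0.
pose Z n w := n.+1%:R^-1 * (\sum_(i < n.+1) X i w) - e.
have mZ n : measurable_fun setT (Z n).
  apply: measurable_funB => //; apply: measurable_funM => //.
  by apply: measurable_sum => i; exact: Linf_measurable.
have mtS n : measurable [set w | kappa / 2 < `|S n w|].
  by apply: measurable_gtr; apply: measurableT_comp => //; exact: (bS n).1.
have mtZ n : measurable [set w | kappa / 2 < `|Z n w|].
  by apply: measurable_gtr; exact: measurableT_comp.
have SZ n : pr [set w | kappa / 2 < `|S n w|] <= pr [set w | kappa / 2 < `|Z n w|].
  apply: (pr_le_null _ _ mNX NX0) => // w /= h.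
  have [nN|nN] := pselect (NX w); [by right|left].
  rewrite /Z (eq_bigr (fun i : 'I_n.+1 => Y i w)) // => i _.
  rewrite /Y clamp_id// leNgt; apply/negP => h'; apply: nN; exists i => //.
(* On the event itself the average is at most [K] in absolute value and elsewhere at most
   [kappa / 2], whereas its integral over A has absolute value [kappa]. *)
have low n : kappa / 2 <= K * pr [set w | kappa / 2 < `|Z n w|].
  have K0 : 0 <= K by rewrite addr_ge0.
  apply: le_trans (ler_wpM2l K0 (SZ n)).
  have : `|\int[P]_w (\1_(A 0%N) w * S n w)| <= kappa / 2 + K * pr [set w | kappa / 2 < `|S n w|].
    have b4 : bounded_measurable (fun w => K * \1_[set w | kappa / 2 < `|S n w|] w : R).
      exact/bmZ/bm_indic.
    have b5 : bounded_measurable (fun _ : T => kappa / 2) by exact: bm_cst.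
    have <- : \int[P]_w (kappa / 2 + K * \1_[set w | kappa / 2 < `|S n w|] w) =
        kappa / 2 + K * pr [set w | kappa / 2 < `|S n w|].
      by rewrite intD// int_cst intZ ?int_pr//; exact: bm_indic.
    apply: le_trans (le_normr_Rintegral _ _) _ => //; first exact: (bm_integrable P (bmM (b1A 0%N) (bS n))).
    apply: int_le; [|exact: bmD|].
      split; first by apply: measurableT_comp => //; exact: (bmM (b1A 0%N) (bS n)).1.
      by have [_ [M' hM']] := bmM (b1A 0%N) (bS n); exists M' => w; rewrite normr_id.
    move=> w; rewrite normrM (indic_bool (fun w => kappa / 2 < `|S n w|)).
    have h01 : `|\1_(A 0%N) w : R| <= 1 by rewrite indicE; case: (_ \in _); rewrite ?normr1 ?normr0.
    have [h|h] := ltP (kappa / 2) `|S n w| => /=.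
      by rewrite mulr1 ler_wpDl ?divr_ge0 ?(ltW kappa0)// -[leRHS]mul1r ler_pM.
    by rewrite mulr0 addr0 (le_trans _ h)// ler_piMl.
  by rewrite intAS normrN gtr0_norm//; lra.
have : P [set w | kappa / 2 < `|Z n w|] @[n --> \oo] --> (0 : \bar R)%E.
  have := hcvg (kappa / 2) ltac:(lra); apply: cvg_trans; apply: near_eq_cvg; near=> n.
  by congr (P _); apply/seteqP; split => w /=; rewrite subr0.
move=> /fine_cvg/= cv.
have : K * pr [set w | kappa / 2 < `|Z n w|] @[n --> \oo] --> K * 0.
  by apply: cvgMr; exact: cv.
rewrite mulr0 => /cvgrPdist_lt/(_ (kappa / 2) ltac:(lra))[m _ /(_ m (leqnn m))] /=.
rewrite sub0r normrN; have := low m; have := ler_norm (K * pr [set w | kappa / 2 < `|Z m w|]); lra.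
Unshelve. all: by end_near.
Qed.

End tail_class.

(** * Refresh kernels *)

Lemma measurable_select {d d'} {S : measurableType d} {S' : measurableType d'}
    (K : S -> nat) (f : nat -> S -> S') :
  (forall k, measurable [set z | K z = k]) -> (forall k, measurable_fun setT (f k)) ->
  measurable_fun setT (fun z => f (K z) z).
Proof.
move=> mK mf _ B mB; rewrite setTI.
rewrite (_ : _ @^-1` _ = \bigcup_k ([set z | K z = k] `&` f k @^-1` B)).
  apply: bigcup_measurable => k _; apply: measurableI => //.
  by rewrite -[X in measurable X]setTI; exact: mf.
by apply/seteqP; split => z /=; [exists (K z)|move=> [k _ [<-]]].
Qed.

Section refresh.
Context {R : realType}.
Local Notation lam := (unif : probability R R).
Local Notation lam2 := (lam \x lam)%E.
Variables (l r : nat -> R) (K : R -> nat) (s : R -> R * R).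
Hypothesis mK : forall k, measurable [set x | K x = k].
Hypothesis hs : has_law lam lam2 s.

(* One step of the chain: [z.1] is the state and [z.2] a fresh uniform variable. *)
Definition refresh (k : nat) (z : R * R) : R :=
  if (l k < z.1 < r k) && (l k < z.2 < r k) then z.2 else z.1.

Lemma measurable_between k : measurable [set x | l k < x < r k].
Proof.
by rewrite (_ : [set x | _] = `]l k, r k[%classic).
Qed.

Lemma refresh_measurable k : measurable_fun setT (refresh k).
Proof.
apply: measurable_fun_ifT => //.
apply: measurable_and; (apply: measurable_and; apply: measurable_fun_ltr => //).
Qed.

(** Only on the square [J * J] does the state change. There the preimage of [A] is [J * (J & A)],
    which has the same product measure as [(J & A) * J], the part that the unchanged state would
    contribute. *)
Lemma refresh_law k : has_law lam2 lam (refresh k).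
Proof.
split; first exact: refresh_measurable.
move=> A mA; pose J := [set x | l k < x < r k]; have mJ : measurable J by exact: measurable_between.
have mr : measurable (refresh k @^-1` A).
  by rewrite -[X in measurable X]setTI; exact: refresh_measurable.
have mJJ : measurable (J `*` J) by exact: measurableX.
have mAT : measurable (A `*` [set: R]) by exact: measurableX.
have prX (B1 B2 : set R) : measurable B1 -> measurable B2 ->
    pr lam2 (B1 `*` B2) = pr lam B1 * pr lam B2.
  move=> m1 m2; apply: EFin_inj; rewrite -prE; last exact: measurableX.
  by rewrite EFinM -!prE//; exact: product_measure1E.
have prAT : pr lam2 (A `*` setT) = pr lam A by rewrite prX// prT mulr1.
transitivity ((pr lam A)%:E); last exact/esym/prE.
apply: eq_trans (prE lam2 mr) _; congr EFin.
rewrite -prAT (prDI lam2 mr mJJ) (prDI lam2 mAT mJJ).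
have -> : refresh k @^-1` A `\` J `*` J = (A `*` setT) `\` J `*` J.
  apply/seteqP; split => -[x y] [h1 h2]; split => //; move: h1; rewrite /refresh /=;
    have -> : (l k < x < r k) && (l k < y < r k) = false by apply/negP => /andP[? ?]; apply: h2.
  - by [].
  - by move=> [].
have -> : refresh k @^-1` A `&` J `*` J = J `*` (J `&` A).
  apply/seteqP; split => -[x y] /=.
    by rewrite /refresh /= => -[+ [jx jy]]; rewrite jx jy.
  by rewrite /refresh /= => -[jx [jy Ay]]; rewrite jx jy.
have -> : A `*` setT `&` J `*` J = (J `&` A) `*` J.
  by apply/seteqP; split => -[x y] /=; tauto.
by rewrite !prX//; [rewrite mulrC|exact: measurableI|exact: measurableI].
Qed.

Definition split1 (w : R) := (s w).1.
Definition split2 (w : R) := (s w).2.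

Lemma measurable_split1 : measurable_fun setT split1.
Proof. exact: (measurableT_comp measurable_fst hs.1). Qed.

Lemma measurable_split2 : measurable_fun setT split2.
Proof. exact: (measurableT_comp measurable_snd hs.1). Qed.

Lemma int_split (F : R * R -> R) : bounded_measurable F ->
  \int[lam]_w F (split1 w, split2 w) = \int[lam]_u \int[lam]_v F (u, v).
Proof.
move=> bF; rewrite -int_prod// -(int_law hs bF); apply: eq_Rintegral => w _.
by rewrite /split1 /split2 -surjective_pairing.
Qed.

(* [s] splits the uniform variable [z.2] into two independent ones: the first
   selects the interval, the second is the value to redraw. *)
Definition random_refresh (z : R * R) : R := refresh (K (split1 z.2)) (z.1, split2 z.2).

Lemma random_refresh_measurable : measurable_fun setT random_refresh.
Proof.
apply: (@measurable_select _ _ _ _ (fun z : R * R => K (split1 z.2)) (fun k z => refresh k (z.1, split2 z.2))) => k.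
  rewrite -[X in measurable X]setTI.
  exact: (measurableT_comp measurable_split1 measurable_snd measurableT (mK k)).
apply: (measurableT_comp (refresh_measurable k)).
apply: measurable_fun_pair; first exact: measurable_fst.
exact: (measurableT_comp measurable_split2 measurable_snd).
Qed.

(** The index variable and the redrawn value are separate coordinates here, so that Fubini can
    integrate the index last. *)
Let select (z : (R * R) * R) : R := refresh (K z.1.2) (z.1.1, z.2).

Let select_measurable : measurable_fun setT select.
Proof.
apply: (@measurable_select _ _ _ _ (fun z : R * R * R => K z.1.2) (fun k z => refresh k (z.1.1, z.2))) => k.
  rewrite -[X in measurable X]setTI.
  exact: (measurableT_comp measurable_snd measurable_fst measurableT (mK k)).
apply: (measurableT_comp (refresh_measurable k)).
apply: measurable_fun_pair; last exact: measurable_snd.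
exact: (measurableT_comp measurable_fst measurable_fst).
Qed.

Lemma int_random_refresh (G : nat -> R * R -> R) (x : R) :
  bounded_measurable (fun z : R * R => G (K z.1) (x, z.2)) ->
  \int[lam]_w G (K (split1 w)) (x, split2 w) = \int[lam]_u \int[lam]_y G (K u) (x, y).
Proof. by move=> bG; exact: (@int_split (fun z => G (K z.1) (x, z.2))). Qed.

(** For each fixed index this is [refresh_law]; the index is independent of the state and of the
    redrawn value. *)
Lemma random_refresh_law : has_law lam2 lam random_refresh.
Proof.
split; first exact: random_refresh_measurable.
move=> A mA.
have b1 : bounded_measurable (\1_A : R -> R) by exact: bm_indic.
have bA : bounded_measurable (fun z => \1_A (random_refresh z) : R).
  by apply: (bm_comp b1); exact: random_refresh_measurable.
have bsel : bounded_measurable (fun z => \1_A (select z) : R) by exact: (bm_comp b1).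
have mpre : measurable (random_refresh @^-1` A).
  by rewrite -[X in measurable X]setTI; exact: random_refresh_measurable.
transitivity ((pr lam A)%:E); last exact/esym/prE.
apply: eq_trans (prE lam2 mpre) _; congr EFin.
rewrite -(int_pr lam2 mpre) -(int_pr lam mA).
transitivity (\int[lam2]_z (\1_A (random_refresh z) : R)).
  by apply: eq_Rintegral => z _; rewrite !indicE.
rewrite int_prod//.
transitivity (\int[lam]_x \int[lam]_u \int[lam]_y (\1_A (select ((x, u), y)) : R)).
  apply: eq_Rintegral => x _.
  apply: (int_random_refresh (G := fun k z => \1_A (refresh k z))).
  apply: (bm_comp bsel (f := fun z : R * R => ((x, z.1), z.2))).
  apply: measurable_fun_pair; last exact: measurable_snd.
  by apply: measurable_fun_pair => //; exact: measurable_fst.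
rewrite (@int_fubini _ _ _ _ _ lam lam (fun xu => \int[lam]_y (\1_A (select (xu, y)) : R))); last exact: (bm_fubini_F lam2 lam bsel).
transitivity (\int[lam]_(u in [set: R]) (\int[lam]_x (\1_A x : R))); last by rewrite int_cst.
apply: eq_Rintegral => u _; rewrite -(int_law (refresh_law (K u)) b1) int_prod//.
by apply: (bm_comp b1); exact: refresh_measurable.
Qed.

(* [z.2] carries all the future randomness, so iterating [shift] from two
   independent uniform variables produces the whole chain. *)
Definition shift (z : R * R) : R * R := (random_refresh (z.1, split1 z.2), split2 z.2).

Lemma shift_measurable : measurable_fun setT shift.
Proof.
apply: measurable_fun_pair.
  apply: (measurableT_comp random_refresh_measurable).
  apply: measurable_fun_pair; first exact: measurable_fst.
  exact: (measurableT_comp measurable_split1 measurable_snd).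
exact: (measurableT_comp measurable_split2 measurable_snd).
Qed.

(** The transition operator: the conditional expectation of [g] at the next state. *)
Definition refresh_op (g : R -> R) (x : R) : R := \int[lam]_w g (random_refresh (x, w)).

Lemma refresh_op_bm g : bounded_measurable g -> bounded_measurable (refresh_op g).
Proof.
move=> bg; exact: (bm_fubini_F lam lam (bm_comp bg random_refresh_measurable)).
Qed.

Lemma int_refresh_op g : bounded_measurable g ->
  \int[lam]_x refresh_op g x = \int[lam]_x g x.
Proof.
move=> bg; rewrite -(int_law random_refresh_law bg) int_prod//.
by apply: (bm_comp bg); exact: random_refresh_measurable.
Qed.

Lemma int_shift (F : R * R -> R) x : bounded_measurable F ->
  \int[lam]_w F (shift (x, w)) = refresh_op (fun y => \int[lam]_w F (y, w)) x.
Proof.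
move=> bF; rewrite /refresh_op /shift/=.
apply: (@int_split (fun z => F (random_refresh (x, z.1), z.2))).
apply: (bm_comp bF (f := fun z : R * R => (random_refresh (x, z.1), z.2))).
apply: measurable_fun_pair; last exact: measurable_snd.
apply: (measurableT_comp random_refresh_measurable).
by apply: measurable_fun_pair => //; exact: measurable_fst.
Qed.

Lemma shift_law : has_law lam2 lam2 shift.
Proof.
have mS : measurable_fun setT (fun z => (shift z).1) by exact: (measurableT_comp measurable_fst shift_measurable).
have mS2 : measurable_fun setT (fun z => (shift z).2) by exact: (measurableT_comp measurable_snd shift_measurable).
suff int_eq (F : R * R -> R) : bounded_measurable F ->
    \int[lam2]_z F (shift z) = \int[lam2]_z F z.
  split; first exact: shift_measurable.
  move=> A mA; have mpre : measurable (shift @^-1` A).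
    by rewrite -[X in measurable X]setTI; exact: shift_measurable.
  apply: eq_trans (prE lam2 mpre) _; apply: eq_trans (esym (prE lam2 mA)); congr EFin.
  rewrite -(int_pr lam2 mpre) -(int_pr lam2 mA) -[RHS]int_eq; last exact: bm_indic.
  by apply: eq_Rintegral => z _; rewrite !indicE.
move=> bF; have bFs : bounded_measurable (F \o shift) by exact: (bm_comp bF shift_measurable).
rewrite (@int_prod _ _ _ _ _ lam lam (F \o shift))// int_prod// -[RHS](int_refresh_op (bm_fubini_F lam lam bF)).
by apply: eq_Rintegral => x _; rewrite /= int_shift.
Qed.

(** The Markov property in integrated form. With [F] a function of the first component it expresses
    the covariance at lag [m] through the iterated operator. *)
Lemma int_iter_shift (h : R -> R) (F : R * R -> R) m :
  bounded_measurable h -> bounded_measurable F ->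
  \int[lam2]_z (h z.1 * F (iter m shift z)) =
  \int[lam]_x (h x * iter m refresh_op (fun y => \int[lam]_w F (y, w)) x).
Proof.
move=> bh; elim: m F => [|m ih] F bF.
  rewrite (@int_prod _ _ _ _ _ lam lam (fun z => h z.1 * F z)).
    by apply: eq_Rintegral => x _; rewrite /= intZ//; exact: bm_section.
  by apply: bmM => //; apply: (bm_comp bh); exact: measurable_fst.
rewrite iterSr; have -> : refresh_op (fun y => \int[lam]_w F (y, w)) =
    (fun x => \int[lam]_w (F \o shift) (x, w)).
  by apply/funext => x; rewrite /= int_shift.
by rewrite -ih//; exact: (bm_comp bF shift_measurable).
Qed.

End refresh.

(** * Ergodicity of the refresh chain *)

Lemma sandwich_cvg0 {R : realType} (u v : nat -> R) :
  (forall n, 0 <= u n <= v n) -> v @ \oo --> (0 : R) -> u @ \oo --> (0 : R).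
Proof.
move=> uv v0; apply: (squeeze_cvgr _ (cvg_cst 0) v0); exact: nearW.
Qed.

(* Chains of overlapping intervals, by real induction. *)
Lemma interval_chain {R : realType} (Q : R -> R -> Prop) :
  (forall s s' t t' : R, s <= s' -> t' <= t -> Q s t -> Q s' t') ->
  (forall s t s' t' : R, 0 < s' -> t < 1 -> s <= s' -> s' < t -> t <= t' ->
     Q s t -> Q s' t' -> Q s t') ->
  (forall x : R, 0 < x < 1 -> exists u v : R, u < x < v /\ Q u v) ->
  forall s t : R, 0 < s -> s < t -> t < 1 -> Q s t.
Proof.
move=> Qmono Qglue Qloc s t s0 st t1.
pose E := [set x : R | s < x <= t /\ Q s x].
have [u [v [/andP[us sv] Quv]]] := Qloc s ltac:(lra).
have Emin : E (Num.min v t).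
  split; first by rewrite lt_min sv st ge_min lexx orbT.
  by apply: Qmono Quv; [exact: ltW|rewrite ge_min lexx].
have hE : has_sup E by split; [exists (Num.min v t)|exists t => x [/andP[]]].
have sS : s < sup E.
  by apply: lt_le_trans (sup_upper_bound hE Emin); rewrite lt_min sv st.
have St : sup E <= t by apply: ge_sup; [exists (Num.min v t)|move=> x [/andP[]]].
have [u' [v' [/andP[uS Sv] Quv']]] := Qloc (sup E) ltac:(lra).
(* The maximum with [s] keeps the left end of the second interval positive, as [Qglue] requires. *)
have mS : Num.max u' s < sup E by rewrite gt_max uS sS.
have [x [/andP[sx xt] Qsx] ux] := sup_gt hE.1 mS.
have xS : x <= sup E by apply: (sup_upper_bound hE); split; rewrite ?sx.
have Qsv : Q s v'.
  apply: (Qglue s x (Num.max u' s) v') => //.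
  - by rewrite lt_max s0 orbT.
  - exact: le_lt_trans t1.
  - by rewrite le_max lexx orbT.
  - exact: ltW (le_lt_trans xS Sv).
  - by apply: Qmono Quv'; rewrite ?le_max ?lexx.
have [tv|vt] := leP t v'; first exact: Qmono Qsv.
have : v' <= sup E.
  by apply: (sup_upper_bound hE); split; rewrite // (lt_trans sS Sv) (ltW vt).
by rewrite leNgt Sv.
Qed.

Section ergodic.
Context {R : realType}.
Local Notation lam := (unif : probability R R).
Local Notation lam2 := (lam \x lam)%E.
Variables (l r : nat -> R) (K : R -> nat) (s : R -> R * R).
Hypothesis mK : forall k, measurable [set x | K x = k].
Hypothesis hs : has_law lam lam2 s.
Hypothesis K_pos : forall k, 0 < pr lam [set x | K x = k].
Hypothesis lr01 : forall k, 0 <= l k /\ r k <= 1.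
Hypothesis cover : forall x, 0 < x < 1 -> exists k, l k < x < r k.

Local Notation Kop := (refresh_op l r K s).
Local Notation rr := (random_refresh l r K s).
Let J (u v : R) : R -> R := \1_(`]u, v[%classic).

Let bJ (u v : R) : bounded_measurable (J u v).
Proof. exact: bm_indic. Qed.

Let J01 u v x : J u v x = 0 \/ J u v x = 1.
Proof. by rewrite /J indicE; case: (_ \in _); [right|left]. Qed.

Let J_ge0 u v x : 0 <= J u v x. Proof. by case: (J01 u v x) => ->. Qed.

Let JE u v x : J u v x = (u < x < v)%R%:R.
Proof. by rewrite /J indicE mem_setE in_itv. Qed.

Let int_J u v : u < v -> \int[lam]_x J u v x = clip v - clip u.
Proof. by move=> uv; rewrite /J int_pr// pr_unif_itvoo. Qed.

Let int_ge0 (f : R -> R) : (forall x, 0 <= f x) -> 0 <= \int[lam]_x f x.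
Proof. by move=> f0; apply: Rintegral_ge0. Qed.

Let brr (g : R -> R) : bounded_measurable g ->
  bounded_measurable (fun z : R * R => g (rr z)).
Proof. by move=> bg; apply: (bm_comp bg); exact: random_refresh_measurable. Qed.

Let bK (g : R -> R) : bounded_measurable g -> bounded_measurable (Kop g).
Proof. exact: refresh_op_bm. Qed.

Let bfst (g : R -> R) : bounded_measurable g -> bounded_measurable (fun z : R * R => g z.1 : R).
Proof. by move=> bg; apply: (bm_comp bg); exact: measurable_fst. Qed.

Let bsnd (g : R -> R) : bounded_measurable g -> bounded_measurable (fun z : R * R => g z.2 : R).
Proof. by move=> bg; apply: (bm_comp bg); exact: measurable_snd. Qed.

(** The law of total variance; stationarity replaces the mean square of [g] after the step by that
    before it. *)
Lemma refresh_variance (g : R -> R) : bounded_measurable g ->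
  \int[lam]_x \int[lam]_w ((g (rr (x, w)) - Kop g x) ^+ 2) =
  \int[lam]_x (g x ^+ 2) - \int[lam]_x (Kop g x ^+ 2).
Proof.
move=> bg; have bg2 := bmX 2 bg.
rewrite -(int_law (@random_refresh_law R l r K s mK hs) bg2) int_prod; last exact: (brr bg2).
rewrite -intB; [|exact: (bm_fubini_F lam lam (brr bg2))|exact/bmX/bK].
apply: eq_Rintegral => x _.
have b1 : bounded_measurable (fun w => g (rr (x, w))) by exact: (bm_section x (brr bg)).
have b2 : bounded_measurable (fun w => g (rr (x, w)) ^+ 2) by exact: bmX.
have b3 : bounded_measurable (fun w => 2 * Kop g x * g (rr (x, w))) by exact: bmZ.
have b4 : bounded_measurable (fun _ : R => Kop g x ^+ 2) by exact: bm_cst.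
have -> : (fun w => (g (rr (x, w)) - Kop g x) ^+ 2) =
    (fun w => g (rr (x, w)) ^+ 2 - 2 * Kop g x * g (rr (x, w)) + Kop g x ^+ 2).
  by apply/funext => w; ring.
rewrite intD//; last exact: bmB.
rewrite intB// intZ// int_cst -/(Kop g x).
by ring.
Qed.

Let b2 (g : R -> R) k : bounded_measurable g -> bounded_measurable
  (fun z : R * R => J (l k) (r k) z.2 * (g z.2 - Kop g z.1) ^+ 2).
Proof.
move=> bg; apply: bmM; first exact: bsnd.
by apply: bmX; apply: bmB; [exact: bsnd|apply: bfst; exact: bK].
Qed.

(* With probability [pr (K = k)] the k-th interval is selected, and a state in it is
   then replaced by an independent draw whenever the draw falls in it too. *)
Lemma refresh_variance_ge (g : R -> R) k : bounded_measurable g ->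
  pr lam [set x | K x = k] *
    \int[lam]_x (J (l k) (r k) x * \int[lam]_y (J (l k) (r k) y * (g y - Kop g x) ^+ 2)) <=
  \int[lam]_x \int[lam]_w ((g (rr (x, w)) - Kop g x) ^+ 2).
Proof.
move=> bg; set q := pr _ _.
have bin : bounded_measurable (fun x => \int[lam]_y (J (l k) (r k) y * (g y - Kop g x) ^+ 2)).
  exact: (bm_fubini_F lam lam (b2 k bg)).
rewrite -intZ; last exact: bmM.
have bD : bounded_measurable (fun z : R * R => (g (rr z) - Kop g z.1) ^+ 2).
  by apply: bmX; apply: bmB; [exact: brr|apply: bfst; exact: bK].
apply: int_le; [exact/bmZ/bmM|exact: (bm_fubini_F lam lam bD)|move=> x].
set c := Kop g x.
have mrk : measurable_fun setT (refresh l r k) by exact: refresh_measurable.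
have msel : measurable_fun setT (fun z : R * R => refresh l r (K z.1) (x, z.2)).
  apply: (@measurable_select _ _ _ _ (fun z : R * R => K z.1) (fun k z => refresh l r k (x, z.2))) => j.
    rewrite -[X in measurable X]setTI.
    have h : measurable_fun setT (fun z : R * R => z.1) by exact: measurable_fst.
    exact: (h measurableT _ (mK j)).
  apply: (measurableT_comp (@refresh_measurable _ _ _ j)).
  by apply: measurable_fun_pair => //; exact: measurable_snd.
have bS : bounded_measurable (fun z : R * R => (g (refresh l r (K z.1) (x, z.2)) - c) ^+ 2).
  by apply: bmX; apply: bmB; [exact: (bm_comp bg)|exact: bm_cst].
rewrite [leRHS](int_random_refresh hs (G := fun j z => (g (refresh l r j z) - c) ^+ 2))//.
have bI : bounded_measurable (\1_[set u | K u = k] : R -> R) by exact: bm_indic.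
have bJg : bounded_measurable (fun y => J (l k) (r k) y * (g y - c) ^+ 2).
  by apply: bmM => //; apply: bmX; apply: bmB => //; exact: bm_cst.
set I := \int[lam]_y (J (l k) (r k) y * (g y - c) ^+ 2).
have -> : q * (J (l k) (r k) x * I) =
    \int[lam]_u (J (l k) (r k) x * I * \1_[set u | K u = k] u).
  by rewrite intZ// (int_pr lam (mK k)) mulrC.
apply: int_le; [exact: bmZ|exact: (bm_fubini_F lam lam bS)|move=> u].
have -> : J (l k) (r k) x * I * \1_[set u | K u = k] u =
    \int[lam]_y (J (l k) (r k) x * \1_[set u | K u = k] u * (J (l k) (r k) y * (g y - c) ^+ 2)).
  by rewrite intZ// mulrAC.
apply: int_le; [exact: bmZ|exact: (bm_section u bS)|move=> y].
have [Ku|nKu] := eqVneq (K u) k; last first.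
  by rewrite indicE memNset ?mulr0 ?mul0r ?sqr_ge0//= => h; move: nKu; rewrite h eqxx.
rewrite indicE mem_set// Ku mulr1 /refresh !JE /=.
by case: (l k < x < r k); case: (l k < y < r k); rewrite ?mulr0 ?mul0r ?mulr1 ?mul1r ?sqr_ge0.
Qed.

Variables (f : R -> R) (B : R).
Hypothesis bf : bounded_measurable f.
Hypothesis fB : forall x, `|f x| <= B.
Hypothesis f0 : \int[lam]_x f x = 0.

Local Notation g m := (iter m Kop f).

Lemma iter_refresh_bm m : bounded_measurable (g m).
Proof. by elim: m => [//|m ih]; exact: bK. Qed.

Lemma iter_refresh_bound m x : `|g m x| <= B.
Proof.
elim: m x => [//|m ih] x /=; apply: int_norm_le; last by move=> w; exact: ih.
exact: (bm_section x (brr (iter_refresh_bm m))).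
Qed.

Lemma int_iter_refresh m : \int[lam]_x g m x = 0.
Proof.
by elim: m => [//|m ih]; rewrite /= int_refresh_op//; exact: iter_refresh_bm.
Qed.

Let sq m := \int[lam]_x (g m x ^+ 2).

Let sq_ge0 m : 0 <= sq m. Proof. by apply: int_ge0 => x; exact: sqr_ge0. Qed.

Let sq_dec m : sq m.+1 <= sq m.
Proof.
rewrite -subr_ge0 /sq /= -refresh_variance; last exact: iter_refresh_bm.
by apply: int_ge0 => x; apply: int_ge0 => w; exact: sqr_ge0.
Qed.

Let sq_diff : sq m - sq m.+1 @[m --> \oo] --> 0.
Proof.
have cs : cvgn sq.
  apply: nonincreasing_is_cvgn; first by apply/nonincreasing_seqP.
  by exists 0 => _ [n _ <-].
have -> : 0 = limn sq - limn sq by rewrite subrr.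
apply: cvgB; first exact: cs.
by rewrite cvg_shiftS.
Qed.

(** The constant may vary with [m] and is compared with the mean only at the end. Its bound by [B]
    controls what lies outside the interval there. *)
Let near_const (u v : R) := exists c : nat -> R, (forall m, `|c m| <= B) /\
  \int[lam]_x (J u v x * (g m x - c m) ^+ 2) @[m --> \oo] --> 0.

Let bJg u v m c : bounded_measurable (fun x => J u v x * (g m x - c) ^+ 2).
Proof.
apply: bmM => //; apply: bmX; apply: bmB; [exact: iter_refresh_bm|exact: bm_cst].
Qed.

Let near_const_mono (u u' v v' : R) : u <= u' -> v' <= v -> near_const u v -> near_const u' v'.
Proof.
move=> uu vv [c [cB h]]; exists c; split => //; apply: sandwich_cvg0 h => m.
rewrite int_ge0 => /= [|x]; last by rewrite mulr_ge0 ?sqr_ge0.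
apply: int_le => // x; rewrite ler_wpM2r ?sqr_ge0// !JE.
have [/andP[h1 h2]|_] := boolP (u' < x < v'); last exact: ler0n.
by rewrite (le_lt_trans uu h1) (lt_le_trans h2 vv).
Qed.

(** On the overlap both constants approximate the same function, so their difference is small there,
    hence everywhere. The conditions [0 < u'] and [v < 1] make the mass of the overlap equal to its
    length [L]. *)
Let near_const_glue (u v u' v' : R) : 0 < u' -> v < 1 -> u <= u' -> u' < v -> v <= v' ->
  near_const u v -> near_const u' v' -> near_const u v'.
Proof.
move=> u0 v1 uu uv vv [c [cB h]] [c' [_ h']]; exists c; split => //.
set A := (fun m => _) in h; set A' := (fun m => _) in h'.
pose L := v - u'; have L0 : 0 < L by rewrite subr_gt0.
have cc m : (c m - c' m) ^+ 2 <= (2 * A m + 2 * A' m) / L.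
  rewrite ler_pdivlMr//.
  have -> : L = \int[lam]_x J u' v x.
    by rewrite int_J// !clip_id//; lra.
  rewrite mulrC -intZ// mulrC -intZ// -intZ// -intD; [|exact: bmZ|exact: bmZ].
  apply: int_le; [exact: bmZ|by apply: bmD; exact: bmZ|move=> x].
  rewrite !JE; have [/andP[h1 h2]|_] := boolP (u' < x < v); last first.
    by rewrite mulr0 addr_ge0// mulr_ge0// mulr_ge0 ?sqr_ge0// ler0n.
  rewrite (le_lt_trans uu h1) h2 h1 (lt_le_trans h2 vv) !mul1r mulr1.
  by rewrite -subr_ge0; have := sqr_ge0 (g m x - c m + (g m x - c' m)); nra.
(* Left of [v] the term [A] suffices; from [v] on [c'] is the known constant, and [2 * A'] and
   [2 * (c - c') ^+ 2] pay for the exchange. *)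
apply: (@sandwich_cvg0 _ _ (fun m => A m + 2 * A' m + 2 * ((2 * A m + 2 * A' m) / L))).
  move=> m; rewrite int_ge0 => /= [|x]; last by rewrite mulr_ge0 ?sqr_ge0.
  apply: (@le_trans _ _ (A m + 2 * A' m + 2 * (c m - c' m) ^+ 2)); last by rewrite lerD2l ler_pM2l.
  have b5 : bounded_measurable (fun _ : R => 2 * (c m - c' m) ^+ 2) by exact: bm_cst.
  rewrite -intZ// -intD//; last exact: bmZ.
  rewrite -[2 * (c m - c' m) ^+ 2](int_cst lam) -intD//; last by apply: bmD => //; exact: bmZ.
  apply: int_le => //; first by apply: bmD => //; apply: bmD => //; exact: bmZ.
  move=> x; rewrite !JE.
  have p1 := sqr_ge0 (g m x - c m); have p2 := sqr_ge0 (g m x - c' m).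
  have p3 := sqr_ge0 (c m - c' m).
  have [/andP[h1 h2]|_] := boolP (u < x < v'); last first.
    by rewrite mul0r; case: (u < x < v); case: (u' < x < v'); rewrite /= ?mul0r ?mul1r; lra.
  have [xv|vx] := ltP x v; first by rewrite h1 /=; case: (u' < x < v'); rewrite /= ?mul0r ?mul1r; lra.
  rewrite andbF h2 (lt_le_trans uv vx) mul0r !mul1r add0r.
  by have := sqr_ge0 (g m x - c' m - (c' m - c m)); nra.
have -> : 0 = 0 + 2 * 0 + 2 * ((2 * 0 + 2 * 0) / L) :> R by rewrite !(mulr0, addr0, mul0r).
apply: cvgD; first by apply: cvgD => //; exact: cvgMr.
by apply: cvgMr; apply: cvgMl; apply: cvgD; exact: cvgMr.
Qed.

(** By [refresh_variance_ge] the mean square distance on the interval between [g m] and the number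
    [g m.+1 z], integrated over [z] in the interval, is at most the decrease of the mean square
    divided by [q]. A good [z] supplies the constant, which is bounded by [B] as a value of an
    iterate. *)
Let near_const_local (x : R) : 0 < x < 1 -> exists u v : R, u < x < v /\ near_const u v.
Proof.
move=> /cover[k kx]; exists (l k), (r k); split => //.
have [lk rk] := lr01 k; pose L := r k - l k.
have L0 : 0 < L by rewrite /L; lra.
pose q := pr lam [set x | K x = k]; have q0 : 0 < q by exact: K_pos.
pose inner m z := \int[lam]_y (J (l k) (r k) y * (g m y - g m.+1 z) ^+ 2).
have intJ : \int[lam]_x J (l k) (r k) x = L.
  by rewrite int_J ?clip_id//; rewrite /L in L0; lra.
have binner m : bounded_measurable (inner m).
  exact: (bm_fubini_F lam lam (b2 k (iter_refresh_bm m))).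
(* The vanishing summand makes the bound strictly exceed the average, so that some [z] must satisfy
   it. *)
pose e m := (sq m - sq m.+1) / q + m.+1%:R^-1.
have exz m : exists z, inner m z * L <= e m.
  apply: contrapT => none.
  have big z : e m < inner m z * L by rewrite ltNge; apply/negP => h; apply: none; exists z.
  have : e m <= (sq m - sq m.+1) / q.
    rewrite ler_pdivlMr// mulrC /sq /= -refresh_variance; last exact: iter_refresh_bm.
    apply: le_trans (refresh_variance_ge k (iter_refresh_bm m)); rewrite -/q ler_pM2l//.
    rewrite -[leLHS]mulr1 -(@divff _ L) ?gt_eqF// mulrA mulrAC -{2}intJ -intZ//.
    apply: int_le; [exact: bmZ|exact: (bmM (bJ _ _) (binner m))|move=> z].
    by rewrite mulrC ler_wpM2l// ler_pdivrMr//; exact: ltW (big z).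
  by rewrite /e gerDl leNgt invr_gt0 ltr0n.
have /choice[z hz] := exz.
exists (fun m => g m.+1 (z m)); split; first by move=> m; exact: iter_refresh_bound.
apply: (@sandwich_cvg0 _ _ (fun m => e m / L)).
  move=> m; rewrite ler_pdivlMr// hz andbT.
  by apply: int_ge0 => y; rewrite mulr_ge0 ?sqr_ge0.
have -> : 0 = (0 / q + 0) / L :> R by rewrite !mul0r addr0 mul0r.
apply: cvgMl; apply: cvgD; first exact: cvgMl.
exact: cvg_harmonic.
Qed.

(* The mean squares of the iterates decrease, so their differences tend to 0; by
   the variance bound the iterates become constant on each interval, hence on
   compact subsets of (0,1), and the constant is their mean 0. *)
Lemma iter_refresh_sq_cvg0 : \int[lam]_x (g m x ^+ 2) @[m --> \oo] --> 0.
Proof.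
apply/cvgrPdist_lt => eps eps0.
have B0 : 0 <= B by apply: le_trans (fB 0).
(* The bound 1/4 gives [del < 1 - del]. The other bound limits the contribution of the two end
   pieces, of total length [2 * del] with integrand at most [4 * B ^+ 2], to [eps / 2]; the [+ 1]
   avoids dividing by 0. *)
pose del := Num.min (4^-1) (eps / (16 * (B ^+ 2 + 1))).
have del0 : 0 < del by rewrite lt_min invr_gt0 ltr0n/= divr_gt0// mulr_gt0// ltr_pwDr ?sqr_ge0.
have del1 : del <= 4^-1 by rewrite ge_min lexx.
have del2 : del * (8 * B ^+ 2) <= eps / 2.
  apply: (@le_trans _ _ (eps / (16 * (B ^+ 2 + 1)) * (8 * B ^+ 2))).
    by rewrite ler_wpM2r ?mulr_ge0 ?sqr_ge0// ge_min lexx orbT.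
  rewrite mulrAC ler_pdivrMr ?mulr_gt0 ?ltr_pwDr ?sqr_ge0//.
  by have := sqr_ge0 B; nra.
have [c [cB hc]] : near_const del (1 - del).
  by apply: (interval_chain near_const_mono near_const_glue near_const_local) => //; lra.
move/cvgrPdist_lt : hc => /(_ (eps / 2) (divr_gt0 eps0 (ltr0Sn _ 1))); apply: filterS => m.
rewrite sub0r normrN ger0_norm; last by apply: int_ge0 => x; rewrite mulr_ge0 ?sqr_ge0.
rewrite sub0r normrN ger0_norm; last by apply: int_ge0 => x; exact: sqr_ge0.
move=> hm; have bg := iter_refresh_bm m.
have bgc : bounded_measurable (fun x => (g m x - c m) ^+ 2).
  by apply: bmX; apply: bmB => //; exact: bm_cst.
have bcc : bounded_measurable (fun _ : R => c m ^+ 2) by exact: bm_cst.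
(* The mean of the iterate is 0, and the mean square deviation is smallest at the mean. *)
apply: (@le_lt_trans _ _ (\int[lam]_x ((g m x - c m) ^+ 2))).
  have -> : (fun x => (g m x - c m) ^+ 2) = (fun x => g m x ^+ 2 - 2 * c m * g m x + c m ^+ 2).
    by apply/funext => x; ring.
  rewrite intD//; last by apply: bmB; [exact: bmX|exact: bmZ].
  rewrite intB; [|exact: bmX|exact: bmZ].
  by rewrite intZ// int_iter_refresh int_cst mulr0 subr0 lerDl sqr_ge0.
apply: (@le_lt_trans _ _ (\int[lam]_x (J del (1 - del) x * (g m x - c m) ^+ 2) +
    4 * B ^+ 2 * (1 - \int[lam]_x J del (1 - del) x))).
  have b1 : bounded_measurable (fun _ : R => 1 : R) by exact: bm_cst.
  have -> : 4 * B ^+ 2 * (1 - \int[lam]_x J del (1 - del) x) =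
      \int[lam]_x (4 * B ^+ 2 * (1 - J del (1 - del) x)).
    by rewrite intZ ?intB ?int_cst//; exact: bmB.
  rewrite -intD//; last by apply: bmZ; exact: bmB.
  apply: int_le => //; first by apply: bmD => //; apply: bmZ; exact: bmB.
  move=> x; case: (J01 del (1 - del) x) => ->.
    rewrite mul0r add0r subr0 mulr1 -[4 * _]/(4 * B ^+ 2) -[leLHS]real_normK ?num_real//.
    rewrite (_ : 4 * B ^+ 2 = (B + B) ^+ 2); last by ring.
    by rewrite ler_sqr ?nnegrE ?addr_ge0// (le_trans (ler_normB _ _))// lerD ?iter_refresh_bound.
  by rewrite mul1r subrr mulr0 addr0.
rewrite int_J ?clip_id//; lra.
Qed.

End ergodic.

(** * Concentration classes lie in some D_p *)

Section product_laws.
Context {R : realType}.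
Local Notation lam := (unif : probability R R).
Local Notation lam2 := (lam \x lam)%E.

Lemma fst_law : has_law lam2 lam fst.
Proof.
split; first exact: measurable_fst.
move=> A mA; rewrite (_ : fst @^-1` A = A `*` setT); last by apply/seteqP; split => -[x y] /=; tauto.
apply: eq_trans (product_measure1E lam lam mA measurableT) _; rewrite -[RHS]mule1; congr (_ * _)%E; exact: probability_setT.
Qed.

Lemma snd_law : has_law lam2 lam snd.
Proof.
split; first exact: measurable_snd.
move=> A mA; rewrite (_ : snd @^-1` A = setT `*` A); last by apply/seteqP; split => -[x y] /=; tauto.
apply: eq_trans (product_measure1E lam lam measurableT mA) _.
by rewrite -[RHS]mul1e; congr (_ * _)%E; exact: (@probability_setT _ _ _ lam).
Qed.

Lemma map_snd_law (f : R -> R) : has_law lam lam f ->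
  has_law lam2 lam2 (fun z : R * R => (z.1, f z.2)).
Proof.
move=> hf; have h2 : has_law lam2 lam (fun z => f z.2) by exact: (has_law_comp snd_law hf).
apply: has_law_cdf2.
- exact: measurable_fst.
- exact: h2.1.
- move=> x y; have mf := measurable_ler y hf.1.
  rewrite (_ : [set w | _] = `]-oo, x]%classic `*` [set w | f w <= y]); last first.
    by apply/seteqP; split => -[u v] /=; rewrite in_itv.
  apply: eq_trans (product_measure1E lam lam _ mf) _ => //; congr (_ * _)%E; rewrite -hf.2//.
- move=> x; rewrite -fst_law.2//; congr (lam2 _).
- move=> x; rewrite -h2.2//; congr (lam2 _).
Qed.

(** Positive weights from the partition of (0,1] at the reciprocals [1 / (k + 2)]. Index 0 takes all
    the rest of the line, in particular (1/2, 1]. *)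
Lemma exists_index : exists K : R -> nat, forall k,
  measurable [set x | K x = k] /\ 0 < pr lam [set x | K x = k].
Proof.
pose K (x : R) := (Num.truncn x^-1).-1.
have KE k : [set x | K x = k.+1] = `]k.+3%:R^-1, k.+2%:R^-1]%classic.
  apply/seteqP; split => x /=; rewrite in_itv/= /K.
    move=> Kx; have tx : Num.truncn x^-1 = k.+2 by lia.
    have : (k.+1 < Num.truncn x^-1)%N by rewrite tx.
    have : (Num.truncn x^-1 <= k.+2)%N by rewrite tx.
    rewrite truncn_le_nat truncn_gt_nat => h1 h2.
    have x0 : 0 < x by rewrite -invr_gt0; apply: lt_le_trans h2; rewrite ltr0n.
    by rewrite -[x]invrK ltf_pV2 ?posrE ?invr_gt0 ?ltr0n// h1 lef_pV2 ?posrE ?invr_gt0 ?ltr0n.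
  move=> /andP[h1 h2]; have x0 : 0 < x by apply: lt_trans h1; rewrite invr_gt0 ltr0n.
  have : (k.+1 < Num.truncn x^-1)%N.
    by rewrite truncn_gt_nat -[leLHS]invrK lef_pV2 ?posrE ?invr_gt0 ?ltr0n.
  have : (Num.truncn x^-1 <= k.+2)%N.
    by rewrite truncn_le_nat -[ltRHS]invrK ltf_pV2 ?posrE ?invr_gt0 ?ltr0n.
  lia.
have K0 : [set x | K x = 0%N] = ~` \bigcup_k [set x | K x = k.+1].
  apply/seteqP; split => x /= => [Kx [k _ /=]|nK]; first by rewrite Kx.
  by case Kx : (K x) => [//|k]; exfalso; apply: nK; exists k.
have mS k : measurable [set x | K x = k.+1] by rewrite KE.
have m0 : measurable [set x | K x = 0%N].
  by rewrite K0; apply: measurableC; exact: bigcup_measurable.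
exists K => -[|k].
  split => //; apply: (@lt_le_trans _ _ (pr lam `]2^-1, 1]%classic)).
    by rewrite pr_unif_itvoc ?clip_id; lra.
  apply: le_pr => // x; rewrite K0 => /=; rewrite in_itv/= => /andP[h1 _] [k _].
  rewrite KE/= in_itv/= => /andP[_ h2]; have := lt_le_trans h1 h2.
  by rewrite ltf_pV2 ?posrE ?ltr0n// ltr_nat.
split => //; rewrite KE.
have h : k.+3%:R^-1 < k.+2%:R^-1 :> R by rewrite ltf_pV2 ?posrE ?ltr0n// ltr_nat.
have i01 n : 0 <= (n.+2%:R : R)^-1 <= 1.
  by rewrite invr_ge0 ler0n/= invf_le1 ?ltr0n// ler1n.
by rewrite pr_unif_itvoc ?ltW// !clip_id// subr_gt0.
Qed.

Lemma pr_series {d} {S : measurableType d} (m : probability S R) (K : S -> nat) (A : set S) :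
  measurable A -> (forall k, measurable [set z | K z = k]) ->
  series (fun k => pr m (A `&` [set z | K z = k])) @ \oo --> pr m A.
Proof.
move=> mA mK; pose F k := A `&` [set z | K z = k].
have mF k : measurable (F k) by exact: measurableI.
have tF : trivIset setT F.
  by apply/trivIsetP => i j _ _ ij; apply/seteqP; split => // z [[_ /= Kz] [_ /= Kz']]; move: ij; rewrite -Kz -Kz' eqxx.
have UF : \bigcup_k F k = A.
  by apply/seteqP; split => [z [k _ []]//|z Az]; exists (K z).
have := @measure_semi_sigma_additive _ _ _ m F mF tF; rewrite UF => /(_ mA) h.
have : (fun n => (series (fun k => pr m (F k)) n)%:E) @ \oo --> (pr m A)%:E.
  rewrite -(prE m mA); apply: cvg_trans h; apply: near_eq_cvg; apply: nearW => n.
  by rewrite /series/= -sumEFin; apply: eq_bigr => k _; exact: prE.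
by move/fine_cvg.
Qed.

End product_laws.

Section domination.
Context {R : realType}.
Local Notation lam := (unif : probability R R).
Local Notation lam2 := (lam \x lam)%E.

(** When [u] or [v] lies outside the open interval (l, r), the refresh copula is at least the
    comonotone one, which bounds every copula. Only the square around (p, p) needs the deficit of
    [C]. *)
Lemma refresh_dominates C (p l r : R) : copula C -> 0 <= l -> r <= 1 ->
  l < p < r -> p - l <= (p - C p p) / 3 -> r - p <= (p - C p p) / 3 ->
  forall u v, C u v <= joint_cdf lam2 fst (refresh (fun=> l) (fun=> r) 0%N) u v.
Proof.
move=> hC l0 r1 /andP[lp pr] pl rp u v.
set phi := refresh _ _ _; set C' := joint_cdf _ _ _.
have hphi : has_law lam2 lam phi by exact: refresh_law.
have mle (f : R * R -> R) x : measurable_fun setT f -> measurable [set w | f w <= x] by move=> /measurable_ler; exact.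
have mJ : measurable [set w : R * R | w.1 <= u /\ phi w <= v].
  by apply: measurableI; [apply: mle; exact: measurable_fst|apply: mle; exact: hphi.1].
have low x : [set w : R * R | w.1 <= x] `<=` [set w | w.1 <= u /\ phi w <= v] -> clip x <= C' u v.
  move=> h; rewrite -(pr_law_cdf x fst_law); apply: le_pr => //.
  by apply: mle; exact: measurable_fst.
have phiE w : phi w = w.1 \/ (l < w.1 < r) && (l < w.2 < r) /\ phi w = w.2.
  by rewrite /phi /refresh; case: ifP => h; [right|left].
have min_low : [set w : R * R | w.1 <= Num.min u v] `<=` [set w | w.1 <= u /\ phi w <= v] ->
    C u v <= C' u v.
  move=> h; apply: le_trans (low _ h); rewrite -[clip _]/(comonotone u v); exact: comonotone_ge.
have [ul|lu] := leP u l.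
  apply: min_low => w /=; rewrite le_min => /andP[h1 h2]; split => //.
  by case: (phiE w) => [->//|[/andP[/andP[h3 _] _] _]]; lra.
have [vl|lv] := leP v l.
  apply: min_low => w /=; rewrite le_min => /andP[h1 h2]; split => //.
  by case: (phiE w) => [->//|[/andP[/andP[h3 _] _] _]]; lra.
have [rv|vr] := leP r v.
  apply: min_low => w /=; rewrite le_min => /andP[h1 h2]; split => //.
  by case: (phiE w) => [->//|[/andP[_ /andP[_ h3]] ->]]; lra.
have [ru|ur] := leP r u.
  apply: le_trans (copula_le2 u v hC) _; rewrite -(pr_law_cdf v hphi); apply: le_pr => //.
    by apply: mle; exact: hphi.1.
  move=> w /= h; split => //.
  by case: (phiE w) h => [->|[/andP[/andP[_ h3] _] _]]; lra.
(* On the square, [l] separates the two sides: a state at most [l] never moves. From [C p p] to (u,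
   v) the copula grows by at most two thirds of [p - C p p], so it ends at least one third below
   [p], hence at most at [l]. *)
apply: (@le_trans _ _ (clip l)); last first.
  apply: low => w /= wl; split; first lra.
  by case: (phiE w) => [->|[/andP[/andP[h3 _] _] _]]; lra.
have cl : clip l = l by rewrite clip_id//; lra.
have cp : clip p = p by rewrite clip_id//; lra.
rewrite cl.
have hu : u <= Num.max u p by rewrite le_max lexx.
have hv : v <= Num.max v p by rewrite le_max lexx.
apply: le_trans (copula_mono hC hu hv) _.
have pu : p <= Num.max u p by rewrite le_max lexx orbT.
have pv : p <= Num.max v p by rewrite le_max lexx orbT.
apply: le_trans (copula_lip hC pu pv) _.
have mu : Num.max u p <= r by rewrite ge_max ltW//= ltW.
have mv : Num.max v p <= r by rewrite ge_max ltW//= ltW.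
rewrite !clip_id//; lra.
Qed.

Lemma refresh_trivial (u v : R) :
  joint_cdf lam2 fst (refresh (fun=> 0) (fun=> 0) 0%N) u v = comonotone u v.
Proof.
rewrite /comonotone -(pr_law_cdf (Num.min u v) fst_law) /joint_cdf; congr (pr _ _).
apply/seteqP; split => w /=; rewrite /refresh le_min;
  have -> : (0 < w.1 < 0) = false by apply/negP => /andP[]; lra.
  by move=> /= [-> ->].
by move=> /= /andP[].
Qed.

End domination.

(** * A weak law of large numbers from vanishing covariances *)

Section averages.
Context {d} {S : measurableType d} {R : realType}.
Variable (m : probability S R).

(** Passing from [n] to [n.+1] terms raises the second moment of the sum by at most [2 * A n.+1],
    twice a partial sum of the [|c j|]. After division by the squared number of terms it is at most
    twice a Cesaro mean of [|c j|]; Chebyshev concludes. *)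
Lemma uncorrelated_averages (Y : nat -> S -> R) (c : nat -> R) :
  (forall n, bounded_measurable (Y n)) ->
  (forall i j, \int[m]_w (Y i w * Y (j + i)%N w) = c j) -> c @ \oo --> (0 : R) ->
  forall e : R, 0 < e ->
  m [set w | e < `|n.+1%:R^-1 * \sum_(i < n.+1) Y i w|] @[n --> \oo] --> (0 : \bar R)%E.
Proof.
move=> bY hc c0 e e0.
pose A n : R := series (fun j => `|c j|) n.
have AS n : A n.+1 = A n + `|c n| by rewrite /A seriesSr.
pose V n : R := \int[m]_w ((\sum_(i < n) Y i w) ^+ 2).
have bS n : bounded_measurable (fun w => \sum_(i < n) Y i w).
  exact: (@bm_sum _ _ _ _ _ (fun (i : 'I_n) => Y i)).
have VS n : V n.+1 <= V n + 2 * A n.+1.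
  have bYY (i : 'I_n) : bounded_measurable (fun w => Y i w * Y n w) by exact: bmM.
  have bC : bounded_measurable (fun w => 2 * (\sum_(i < n) Y i w * Y n w)).
    by apply: bmZ; exact: (@bm_sum _ _ _ _ _ (fun (i : 'I_n) w => Y i w * Y n w)).
  have bY2 : bounded_measurable (fun w => Y n w * Y n w) by exact: bmM.
  have -> : V n.+1 = V n + 2 * (\sum_(i < n) c (n - i)%N) + c 0%N.
    rewrite /V; under eq_Rintegral => w _.
      rewrite big_ord_recr /= (_ : (_ + _) ^+ 2 = (\sum_(i < n) Y i w) ^+ 2 + 2 * (\sum_(i < n) Y i w * Y n w) + Y n w * Y n w); last by rewrite -mulr_suml; ring.
      over.
    rewrite intD//; last by apply: bmD => //; exact: bmX.
    rewrite intD//; last exact: bmX.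
    rewrite intZ; last exact: (@bm_sum _ _ _ _ _ (fun (i : 'I_n) w => Y i w * Y n w)).
    rewrite (@int_sum _ _ _ m _ _ (fun (i : 'I_n) w => Y i w * Y n w))// (hc n 0%N).
    congr (_ + 2 * _ + _); apply: eq_bigr => i _.
    by rewrite -(hc i) subnK// ltnW.
  rewrite -addrA lerD2l.
  have -> : \sum_(i < n) c (n - i)%N = \sum_(i < n) c i.+1.
    by rewrite (reindex_inj rev_ord_inj); apply: eq_bigr => i _ /=; congr c; have := ltn_ord i; lia.
  have h1 : \sum_(i < n) c i.+1 <= \sum_(i < n) `|c i.+1| by apply: ler_sum => i _; exact: ler_norm.
  have -> : A n.+1 = `|c 0%N| + \sum_(i < n) `|c i.+1|.
    by rewrite /A /series/= big_mkord big_ord_recl.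
  by have := ler_norm (c 0%N); have := normr_ge0 (c 0%N); lra.
have A0 n : 0 <= A n by apply: sumr_ge0.
have Vn n : V n <= 2 * n%:R * A n.
  elim: n => [|n ih].
    by rewrite /V; under eq_Rintegral do rewrite big_ord0 expr0n; rewrite int_cst mulr0 mul0r.
  apply: le_trans (VS n) _; apply: (@le_trans _ _ (2 * n%:R * A n + 2 * A n.+1)); first by rewrite lerD2r.
  rewrite -[n.+1%:R]natr1 mulrDr mulrDl mulr1 lerD2r ler_wpM2l ?mulr_ge0//.
  by rewrite AS lerDl.
have n1 n : 0 < n.+1%:R :> R by rewrite ltr0n.
have : (e ^+ 2)^-1 * (2 * (n.+1%:R^-1 * A n.+1)) @[n --> \oo] --> (e ^+ 2)^-1 * (2 * 0).
  apply: cvgMr; apply: cvgMr; apply: (@cesaro R (fun j => `|c j|)).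
  by rewrite -(@normr0 _ R); exact: cvg_norm.
rewrite !mulr0 => lim.
have : ((e ^+ 2)^-1 * (2 * (n.+1%:R^-1 * A n.+1)))%:E @[n --> \oo] --> (0%:E : \bar R).
  by apply: cvg_EFin => //; exact: nearW.
move=> limE; apply: (squeeze_cvge _ (cvg_cst 0%E) limE); apply: nearW => n.
rewrite measure_ge0/=; have bA : bounded_measurable (fun w => n.+1%:R^-1 * \sum_(i < n.+1) Y i w) by exact: bmZ.
apply: le_trans (markov_bm m e0 bA) _.
rewrite lee_fin ler_pM2l ?invr_gt0 ?exprn_gt0//.
under eq_Rintegral do rewrite exprMn.
rewrite intZ; last exact: bmX.
rewrite -/(V n.+1); apply: (@le_trans _ _ (n.+1%:R^-1 ^+ 2 * (2 * n.+1%:R * A n.+1))).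
  by rewrite ler_pM2l ?exprn_gt0 ?invr_gt0.
by rewrite le_eqVlt; apply/orP; left; apply/eqP; have := n1 n; move: (n.+1%:R) => N N0; field; exact: lt0r_neq0.
Qed.

End averages.

Lemma copula_clip {R : realType} (C : R -> R -> R) u v : copula C ->
  C u v = C (clip u) (clip v).
Proof.
move=> hC.
have cc (x : R) : clip (clip x) = clip x by rewrite clip_id// clip_ge0 clip_le1.
have clips (x : R) : clip (Num.min x (clip x)) = clip x /\ clip (Num.max x (clip x)) = clip x.
  by rewrite /Num.min /Num.max; case: ifP.
have mn (x : R) : Num.min x (clip x) <= x by rewrite ge_min lexx.
have mnc (x : R) : Num.min x (clip x) <= clip x by rewrite ge_min lexx orbT.
have mx (x : R) : x <= Num.max x (clip x) by rewrite le_max lexx.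
have mxc (x : R) : clip x <= Num.max x (clip x) by rewrite le_max lexx orbT.
have := copula_lip hC (le_trans (mn u) (mx u)) (le_trans (mn v) (mx v)).
rewrite !(clips _).1 !(clips _).2 !subrr !addr0.
have := copula_mono hC (mn u) (mn v); have := copula_mono hC (mnc u) (mnc v).
have := copula_mono hC (mx u) (mx v); have := copula_mono hC (mxc u) (mxc v).
by move=> h1 h2 h3 h4 h5; apply/eqP; rewrite eq_le; apply/andP; split; lra.
Qed.

Lemma clip_continuous {R : realType} : continuous (@clip R).
Proof.
move=> x; apply/cvgrPdist_lt => e e0; near=> y.
have : `|x - y| < e by near: y; have /cvgrPdist_lt := @cvg_id _ (nbhs x); apply.
apply: le_lt_trans; have [xy|yx] := leP x y.
  by rewrite !ler0_norm ?subr_le0 ?clip_le// !opprB clip_lip.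
by rewrite !ger0_norm ?subr_ge0 ?clip_le ?clip_lip// ltW.
Unshelve. all: by end_near.
Qed.

Section chain.
Context {d} {T : measurableType d} {R : realType}.
Variable P : probability T R.
Hypothesis hP : atomless P.
Local Notation lam := (unif : probability R R).
Local Notation lam2 := (lam \x lam)%E.
Variables (l r : nat -> R) (K : R -> nat) (s : R -> R * R).
Hypothesis mK : forall k, measurable [set x | K x = k].
Hypothesis hs : has_law lam lam2 s.
Hypothesis s01 : forall x, 0 <= (s x).2 <= 1.
Hypothesis K_pos : forall k, 0 < pr lam [set x | K x = k].
Hypothesis lr01 : forall k, 0 <= l k /\ r k <= 1.
Hypothesis cover : forall x, 0 < x < 1 -> exists k, l k < x < r k.

Local Notation rr := (random_refresh l r K s).
Local Notation tau := (shift l r K s).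

Definition mixed_copula (u v : R) : R := joint_cdf lam2 fst rr u v.

(** Decomposition by the selected index, which [split1] makes independent of the state and of the
    redrawn value. It puts the copula of the randomised chain into the form of [Cx]. *)
Lemma mixed_copulaE u v : mixed_copula u v =
  limn (series (fun k => pr lam [set x | K x = k] * joint_cdf lam2 fst (refresh l r k) u v)).
Proof.
pose E := [set z : R * R | z.1 <= u /\ rr z <= v].
pose G k := [set z : R * R | z.1 <= u /\ refresh l r k z <= v].
have mle (f : R * R -> R) x : measurable_fun setT f -> measurable [set w | f w <= x] by move=> /measurable_ler; exact.
have mE : measurable E.
  by apply: measurableI; apply: mle; [exact: measurable_fst|exact: random_refresh_measurable].
have mG k : measurable (G k).
  by apply: measurableI; apply: mle; [exact: measurable_fst|exact: refresh_measurable].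
have mKa k : measurable [set z : R * R | K (split1 s z.2) = k].
  rewrite -[X in measurable X]setTI.
  have ma2 : measurable_fun setT (fun z : R * R => split1 s z.2).
    by apply: (measurableT_comp (@measurable_split1 _ s hs)); exact: measurable_snd.
  exact: (ma2 measurableT _ (mK k)).
have h := @pr_series _ _ _ lam2 (fun z : R * R => K (split1 s z.2)) _ mE mKa.
rewrite /mixed_copula -[LHS](cvg_lim _ h)//; congr (limn (series _)); apply/funext => k.
have mEk : measurable (E `&` [set z : R * R | K (split1 s z.2) = k]) by exact: measurableI.
rewrite -(int_pr lam2 mEk) int_prod; last exact: bm_indic.
have bG : bounded_measurable (\1_(G k) : R * R -> R) by exact: bm_indic.
have bK : bounded_measurable (\1_[set x | K x = k] : R -> R) by exact: bm_indic.
rewrite -[joint_cdf _ _ _ _ _]/(pr lam2 (G k)) -(int_pr lam2 (mG k)) int_prod//.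
rewrite -intZ; last exact: (bm_fubini_F lam lam bG).
apply: eq_Rintegral => x _.
transitivity (\int[lam]_w (\1_[set x | K x = k] (split1 s w) * \1_(G k) (x, split2 s w))).
  apply: eq_Rintegral => w _; rewrite !indicE -natrM mulnb; congr (_%:R); congr nat_of_bool.
  apply/idP/idP; rewrite in_setE => /=.
    by move=> [[h1 h2] h3]; apply/andP; rewrite !in_setE; split => //; split => //=; move: h2; rewrite /random_refresh /= h3.
  by move=> /andP[]; rewrite !in_setE /G/= /E /random_refresh /= => h3 [h1 h2]; rewrite h3.
rewrite (int_split hs (F := fun z : R * R => \1_[set x | K x = k] z.1 * \1_(G k) (x, z.2))); last first.
  apply: bmM; first by apply: (bm_comp bK); exact: measurable_fst.
  apply: (bm_comp bG (f := fun z : R * R => (x, z.2))).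
  by apply: measurable_fun_pair => //; exact: measurable_snd.
rewrite /= -(int_pr lam (mK k)) mulrC -intZ//; apply: eq_Rintegral => y _.
rewrite [RHS]mulrC; exact: (intZ lam _ (bm_section x bG)).
Qed.

Lemma index_series : series (fun k => pr lam [set x | K x = k]) @ \oo --> (1 : R).
Proof.
have := @pr_series _ _ _ lam _ _ measurableT mK; rewrite prT.
by under eq_fun do rewrite setTI.
Qed.

Let ha : has_law lam lam (split1 s).
Proof. exact: (has_law_comp hs fst_law). Qed.

(* [Z n] iterates [shift]; the covariances of its first components are
   [int f (refresh_op^m f)], which tend to 0. *)
Lemma exists_chain : exists X : nat -> Linf P, sequentially_coupled mixed_copula X /\
  cvg_in_probability P
        (fun n w => n.+1%:R^-1 * (\sum_(i < n.+1) X i w) - fine ('E_P[X 0%N])%E)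
        (cst 0).
Proof.
have [U [V [hUV U01 V01]]] := exists_independent_uniforms hP.
pose Z n w := iter n tau (U w, V w).
have htau := @shift_law _ l r K s mK hs.
have hZ n : has_law P lam2 (Z n).
  elim: n => [//|n ih].
  exact: (has_law_comp ih htau).
(* The bound must hold at every outcome to make the states everywhere bounded; this is what [s01]
   and [U01] supply. *)
have Z01 n w : 0 <= (Z n w).1 <= 1.
  elim: n => [/=|n ih]; first exact: U01.
  rewrite /Z iterS -/(Z n w) /shift/= /random_refresh /refresh /=; case: ifP => // _; exact: s01.
have hX n : has_law P lam (fun w => (Z n w).1) by exact: (has_law_comp (hZ n) fst_law).
have bX n : bounded_measurable (fun w => (Z n w).1).
  split; first exact: (hX n).1.
  by exists 1 => w; have /andP[h1 h2] := Z01 n w; rewrite ger0_norm.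
pose X n := Linf_of P (bX n).
have XE n w : X n w = (Z n w).1 by [].
have dX n : dfun (X n) = clip.
  by apply/funext => x; rewrite dfunE; exact: (pr_law_cdf x (hX n)).
exists X; split.
  move=> n; split.
  - by rewrite /Linf_continuous dX; exact: clip_continuous.
  - by apply/eq_in_lawP => x; rewrite -!dfunE !dX.
  split; first exact: (joint_cdf_copula fst_law (@random_refresh_law _ l r K s mK hs)).
  move=> x y; rewrite !dX /= -copula_clip; last exact: (joint_cdf_copula fst_law (@random_refresh_law _ l r K s mK hs)).
  pose E x y := [set z : R * R | z.1 <= x /\ random_refresh l r K s z <= y].
  have mE : measurable (E x y).
    apply: measurableI; first by apply: (@measurable_ler _ _ _ (fun z : R * R => z.1)); exact: measurable_fst.
    by apply: (@measurable_ler _ _ _ (random_refresh l r K s)); exact: random_refresh_measurable.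
  (* The next state reads only [split1] of the second component, which is again uniform and
     independent of the current state. *)
  have hZa := has_law_comp (hZ n) (map_snd_law ha).
  by rewrite -[RHS](prE lam2 mE) -hZa.2.
(* On [0,1], where the chain lives, [clamp 1] is the identity; it makes [f] bounded on the whole
   line. *)
pose mu := \int[lam]_x clamp 1 x.
pose f (x : R) := clamp 1 x - mu.
have b1 : bounded_measurable (clamp (1 : R)) by exact: clamp_bm.
have bmu : bounded_measurable (fun _ : R => mu) by exact: bm_cst.
have bf : bounded_measurable f by exact: bmB.
have f0 : \int[lam]_x f x = 0 by rewrite intB// int_cst subrr.
have fB x : `|f x| <= 2.
  rewrite (le_trans (ler_normB _ _))// (_ : 2 = 1 + 1 :> R)// lerD//; first exact: clamp_norm.
  by apply: int_norm_le => // y; exact: clamp_norm.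
have bg m : bounded_measurable (iter m (refresh_op l r K s) f) by exact: iter_refresh_bm.
pose c m := \int[lam]_x (f x * iter m (refresh_op l r K s) f x).
have c0 : c @ \oo --> (0 : R).
  apply/cvgrPdist_lt => e e0; have e2 : 0 < e ^+ 2 / 4 by rewrite divr_gt0 ?exprn_gt0.
  have := iter_refresh_sq_cvg0 mK hs K_pos lr01 cover bf fB f0.
  move=> /cvgrPdist_lt/(_ _ e2); apply: filterS => m.
  rewrite !sub0r !normrN => hm; have := le_lt_trans (ler_norm _) hm => {}hm.
  rewrite -(@ltr_pXn2r _ 2)// ?nnegrE ?(ltW e0)// real_normK ?num_real//.
  (* In place of Cauchy-Schwarz: the squared integral is at most the integral of the square, and
     [f ^+ 2 <= 4]. *)
  apply: le_lt_trans (int_sq_ge _ (bmM bf (bg m))) _.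
  apply: (@le_lt_trans _ _ (4 * \int[lam]_x (iter m (refresh_op l r K s) f x ^+ 2))); last first.
    by rewrite mulrC -ltr_pdivlMr.
  rewrite -intZ; last exact: bmX.
  apply: int_le; [exact/bmX/bmM|exact/bmZ/bmX|move=> x].
  rewrite exprMn ler_wpM2r ?sqr_ge0// -real_normK ?num_real//.
  by rewrite (_ : 4 = 2 ^+ 2 :> R) ?ler_sqr ?nnegrE//; ring.
have bfst : bounded_measurable (fun z : R * R => f z.1) by apply: (bm_comp bf); exact: measurable_fst.
have cE i j : \int[P]_w (f (X i w) * f (X (j + i)%N w)) = c j.
  have bF : bounded_measurable (fun z : R * R => f z.1 * f (iter j tau z).1).
    apply: bmM => //; apply: (bm_comp bfst).
    have : has_law lam2 lam2 (fun z => iter j tau z).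
      by elim: j => [|j ih]; [split; [exact: measurable_id|]|exact: (has_law_comp ih htau)].
    by case.
  transitivity (\int[P]_w (f (Z i w).1 * f (iter j tau (Z i w)).1)).
    by apply: eq_Rintegral => w _; rewrite !XE /Z iterD.
  rewrite (int_law (hZ i) bF) (@int_iter_shift _ l r K s mK hs f (fun z => f z.1) j bf bfst).
  apply: eq_Rintegral => x _; congr (_ * iter j _ _ x).
  by apply/funext => y; exact: (int_cst lam (f y)).
have muE : fine ('E_P[X 0%N])%E = mu.
  rewrite (@expectation_clamp _ _ _ _ _ 1)//; last first.
    rewrite (_ : [set w | _] = set0) ?pr0//; apply/seteqP; split => // w /=.
    by have /andP[h1 h2] := U01 w; rewrite ger0_norm// ltNge h2.
  exact: (int_law (hX 0%N) b1).
have bfX n : bounded_measurable (fun w => f (X n w)) by apply: (bm_comp bf); exact: (hX n).1.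
move=> e e0; have := uncorrelated_averages bfX cE c0 e0.
apply: cvg_trans; apply: near_eq_cvg; apply: nearW => n; congr (P _).
have avg w : n.+1%:R^-1 * (\sum_(i < n.+1) f (X i w)) = n.+1%:R^-1 * (\sum_(i < n.+1) X i w) - mu.
  rewrite /f sumrB sumr_const card_ord mulrBr -[mu *+ _]mulr_natl mulKf ?pnatr_eq0//.
  congr (_ * _ - _); apply: eq_bigr => i _.
  by rewrite clamp_id// ger0_norm; have /andP[] := Z01 i w.
by apply/seteqP; split => w /=; rewrite subr0 muE avg.
Qed.

End chain.

Lemma concentration_class_tail {d} {T : measurableType d} {R : realType}
    (P : probability T R) (D : set (R -> R -> R)) : atomless P ->
  concentration_class P D -> exists p : R, 0 < p < 1 /\ D `<=` tail_class p.
Proof.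
move=> hP [Dcop ND DM Cx]; apply: contrapT => none.
have lack p : 0 < p < 1 -> exists C, D C /\ C p p < p.
  move=> p01; apply: contrapT => h; apply: none; exists p; split => // C DC; split; first exact: Dcop.
  apply/eqP; rewrite eq_le; have := copula_le1 p p (Dcop _ DC).
  have /andP[p0 p1] := p01; rewrite clip_id ?(ltW p0) ?(ltW p1)// => -> /=.
  by rewrite leNgt; apply/negP => h'; apply: h; exists C.
have DM0 : D (@comonotone R).
  have [C [DC _]] := lack (2^-1) ltac:(lra).
  apply: (DM _ _ DC); first exact: comonotone_copula.
  by move=> u v; apply: comonotone_ge; exact: Dcop.
pose lam := (unif : probability R R).
pose CJ (x y : R) := joint_cdf (lam \x lam)%E fst (refresh (fun=> x) (fun=> y) 0%N).
(* Which intervals are used is decided by membership of their refresh copula in [D]. All other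
   indices receive the interval with both ends 0, whose copula is [comonotone], so every index
   contributes a member of [D]. *)
pose good (q : rat * rat) := `[< [/\ 0 <= ratr q.1 :> R, ratr q.2 <= 1 :> R & D (CJ (ratr q.1) (ratr q.2))] >].
pose ends k : R * R := if unpickle k is Some q then
  if good q then (ratr q.1, ratr q.2) else (0, 0) else (0, 0).
pose l k := (ends k).1; pose r k := (ends k).2.
have endsP k : [/\ 0 <= l k, r k <= 1 & D (CJ (l k) (r k))].
  have D00 : D (CJ 0 0).
    by rewrite (_ : CJ 0 0 = comonotone)//; apply/funext => u; apply/funext => v; exact: refresh_trivial.
  rewrite /l /r /ends; case: unpickle => [q|//].
  by case: ifP => [/asboolP[]|].
have cover x : 0 < x < 1 -> exists k, l k < x < r k.
  move=> /andP[x0 x1]; have [C [DC Cx0]] := lack x ltac:(lra).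
  pose e := (x - C x x) / 3; have e0 : 0 < e by rewrite /e; lra.
  have [q1 /=] := @rat_in_itvoo R (Num.max 0 (x - e)) x ltac:(by rewrite gt_max x0/=; lra).
  rewrite in_itv/= gt_max => /andP[/andP[q10 q1e] q1x].
  have [q2 /=] := @rat_in_itvoo R x (Num.min 1 (x + e)) ltac:(by rewrite lt_min x1/=; lra).
  rewrite in_itv/= lt_min => /andP[xq2 /andP[q21 q2e]].
  exists (pickle (q1, q2)); rewrite /l /r /ends pickleK.
  rewrite (_ : good _ = true) /= ?q1x//; apply/asboolP; split => /=; [exact: ltW|exact: ltW|].
  apply: (DM _ _ DC); first exact: (joint_cdf_copula fst_law (refresh_law _ _ _)).
  apply: (refresh_dominates (p := x) (Dcop _ DC)); [exact: ltW|exact: ltW|by rewrite q1x| |];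
    rewrite -/e; lra.
have [K hK] := @exists_index R.
have mK k : measurable [set x | K x = k] by have [] := hK k.
have K_pos k : 0 < pr lam [set x | K x = k] by have [] := hK k.
(* Applied to the unit interval itself, this is the map that splits one uniform variable into
   two. *)
have [U [V [hUV U01 V01]]] := exists_independent_uniforms (@unif_atomless R).
have [X [hX cX]] := exists_chain hP (s := fun x => (U x, V x)) mK hUV V01 K_pos
  (fun k => let: And3 h1 h2 _ := endsP k in conj h1 h2) cover.
apply: (ND _ _ X hX cX).
rewrite (_ : mixed_copula _ _ _ _ =
  (fun u v => limn (series (fun k => pr lam [set x | K x = k] * CJ (l k) (r k) u v)))).
  by apply: Cx => [k|k|]; [have [] := endsP k|exact: ltW|exact: index_series].
apply/funext => u; apply/funext => v; exact: mixed_copulaE.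
Qed.

(** * Maximal classes *)

Lemma tail_class_concentration {d} {T : measurableType d} {R : realType}
    (P : probability T R) (p : R) : 0 < p < 1 -> concentration_class P (tail_class p).
Proof.
move=> p01; have /andP[p0 p1] := p01; split.
- by move=> C [].
- by move=> C; exact: tail_class_non_diversifiable.
- move=> C C' [_ Cp] hC' CC'; split => //; apply/eqP; rewrite eq_le.
  have := copula_le1 p p hC'; rewrite clip_id ?(ltW p0) ?(ltW p1)// => -> /=.
  by rewrite -[leLHS]Cp.
- move=> C_ w hC w0 w1; split; first by apply: copula_mixture => // n; have [] := hC n.
  apply: cvg_lim => //.
  rewrite (_ : series _ = (fun n => series w n * p)); last first.
    apply/funext => n; rewrite /series/= mulr_suml; apply: eq_bigr => i _.
    by have [_ ->] := hC i.
  by rewrite -[X in _ --> X]mul1r; exact: cvgMl.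
Qed.

Lemma clip_le0 {R : realType} (u : R) : u <= 0 -> clip u = 0.
Proof.
move=> u0; apply/eqP; rewrite eq_le clip_ge0 andbT.
by have := clip_le u0; rewrite (@clip_id _ 0) ?lexx ?ler01.
Qed.

Lemma clip_ge1 {R : realType} (u : R) : 1 <= u -> clip u = 1.
Proof.
move=> u1; apply/eqP; rewrite eq_le clip_le1 /=.
by have := clip_le u1; rewrite (@clip_id _ 1) ?lexx ?ler01.
Qed.

Section reflection.
Context {R : realType}.
Local Notation lam := (unif : probability R R).
Variable p : R.
Hypothesis p01 : 0 < p < 1.

(** The point [p] goes to 0, so (0,1) is preserved only up to a null set; exceptional sets involving
    the reflected variable come from here. *)
Definition reflect_at (u : R) : R := if u <= p then p - u else 1 + p - u.

Let prle u : pr lam [set w | w <= u] = clip u.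
Proof. exact: (pr_law_cdf u id_law). Qed.

Let mle (u : R) : measurable [set w : R | w <= u].
Proof. exact: (measurable_ler u (@id_law R).1). Qed.

Let mge (u : R) : measurable [set w : R | u <= w].
Proof. exact: (measurable_ger u (@id_law R).1). Qed.

Let prge u : pr lam [set w | u <= w] = 1 - clip u.
Proof.
have -> : [set w | u <= w] = [set u] `|` ~` [set w | w <= u].
  apply/seteqP; split => w /=.
    by rewrite le_eqVlt => /orP[/eqP ->|uw]; [left|right; apply/negP; rewrite -ltNge].
  by case=> [->//|/negP]; rewrite -ltNge => /ltW.
rewrite -prle -(prC lam (mle u)); apply/eqP; rewrite eq_le; apply/andP; split; last first.
  apply: le_pr; [exact: measurableC|by apply: measurableU => //; exact: measurableC|by move=> w; right].
apply: (@pr_le_null _ _ _ _ _ _ [set u]) => //.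
- by apply: measurableU => //; exact: measurableC.
- exact: measurableC.
- by rewrite /pr -[X in fine X]/(unif _) unif_set1.
- by move=> w [|]; [right|left].
Qed.

Let prge_le u v : pr lam [set w | u <= w <= v] = if u <= v then clip v - clip u else 0.
Proof.
have -> : [set w | u <= w <= v] = [set w | w <= v] `&` [set w | u <= w].
  by apply/seteqP; split => w /=; [move=> /andP[]|move=> [-> ->]].
case: leP => uv; last first.
  by rewrite (_ : _ `&` _ = set0) ?pr0//; apply/seteqP; split => // w [/=]; lra.
have sub (x y z : R) : x = y + z -> z = x - y by move=> ->; rewrite addrC addKr.
rewrite setIC (sub _ _ _ (prDI lam (mge u) (mle v))).
rewrite prge (_ : [set w | u <= w] `\` [set w | w <= v] = ~` [set w | w <= v]).
  by rewrite (prC lam (mle v)) prle; lra.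
apply/seteqP; split => w /= => [[]//|/negP]; rewrite -ltNge => h.
by split; [lra|apply/negP; rewrite -ltNge].
Qed.

Lemma reflect_at_measurable : measurable_fun setT reflect_at.
Proof.
apply: measurable_fun_ifT.
- exact: measurable_fun_ler.
- exact: measurable_funB.
- exact: measurable_funB.
Qed.

Let refl_low u v : pr lam ([set w | w <= u /\ reflect_at w <= v] `&` [set w | w <= p]) =
  pr lam [set w | p - v <= w <= Num.min u p].
Proof.
congr (pr _ _); apply/seteqP; split => w /=; rewrite /reflect_at le_min.
  by move=> [[h1 h2] h3]; move: h2; rewrite h3 h1 => ?; lra.
by move=> /and3P[h1 h2 h3]; rewrite h3; split => //; split => //; lra.
Qed.

Let mrefl u v : measurable [set w | w <= u /\ reflect_at w <= v].
Proof.
exact: (measurableI _ _ (mle u) (measurable_ler v reflect_at_measurable)).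
Qed.

Lemma reflect_at_law : has_law lam lam reflect_at.
Proof.
apply: has_law_cdf; first exact: reflect_at_measurable.
move=> x; rewrite -[RHS]/(unif _) unif_cdf.
have mx := measurable_ler x reflect_at_measurable.
apply: eq_trans (prE lam mx) _; congr EFin.
rewrite (prDI lam mx (mle p)).
have -> : [set w | reflect_at w <= x] `&` [set w | w <= p] = [set w | p - x <= w <= p].
  apply/seteqP; split => w /=; rewrite /reflect_at.
    by move=> [+ h3]; rewrite h3; lra.
  by move=> /andP[h1 h3]; rewrite h3; lra.
have /andP[p0 p1] := p01.
have cp : clip p = p by rewrite clip_id//; lra.
rewrite prge_le.
have [x1|x1] := leP 1 x.
  have -> : [set w | reflect_at w <= x] `\` [set w | w <= p] = ~` [set w | w <= p].
    apply/seteqP; split => w /= => [[]//|nw]; split => //.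
    by rewrite /reflect_at; case: ifP => [/nw//|_]; move/negP : nw; rewrite -ltNge; lra.
  rewrite (prC lam (mle p)) prle (clip_ge1 x1) cp (_ : (p - x <= p) = true); last lra.
  by rewrite clip_le0; lra.
have -> : [set w | reflect_at w <= x] `\` [set w | w <= p] = [set w | 1 + p - x <= w].
  apply/seteqP; split => w /=; rewrite /reflect_at.
    by move=> [+ /negP/negbTE h]; rewrite h; lra.
  move=> h; have -> : (w <= p) = false by apply/negbTE; rewrite -ltNge; lra.
  by split => //; lra.
rewrite prge cp.
have [x0|x0] := leP 0 x; last first.
  rewrite (clip_le0 (ltW x0)) (_ : (p - x <= p) = false) ?clip_ge1; [lra|lra|].
  by apply/negbTE; rewrite -ltNge; lra.
rewrite (_ : (p - x <= p) = true) ?(@clip_id _ x); [|lra|lra].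
have [xp|px] := leP x p; first by rewrite (@clip_ge1 _ (1 + p - x)) ?(@clip_id _ (p - x)); lra.
by rewrite (@clip_le0 _ (p - x)) ?(@clip_id _ (1 + p - x)); lra.
Qed.

Definition reflection_copula (u v : R) : R := joint_cdf lam idfun reflect_at u v.

Lemma reflection_copula_tail : tail_class p reflection_copula.
Proof.
split; first exact: (joint_cdf_copula id_law reflect_at_law).
rewrite /reflection_copula /joint_cdf (_ : [set w | _] = [set w | 0 <= w <= p]).
  rewrite prge_le; have /andP[p0 p1] := p01.
  by rewrite (ltW p0) !clip_id ?subr0// ?lexx ?ler01// !ltW.
by apply/seteqP; split => w /=; rewrite /reflect_at; [move=> [h]; rewrite h|move=> /andP[h0 h]; rewrite h]; lra.
Qed.

(** The diagonal value is the maximum of [p] and [2 * q - 1] for [q > p], and the maximum of 0 and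
    [2 * q - p] for [q < p]. *)
Lemma reflection_copula_lt (q : R) : 0 < q < 1 -> q != p -> reflection_copula q q < q.
Proof.
move=> q01 qp; have /andP[q0 q1] := q01; rewrite /reflection_copula /joint_cdf (prDI lam (mrefl q q) (mle p)) refl_low prge_le.
have /andP[p0 p1] := p01.
have cp : clip p = p by rewrite clip_id//; lra.
have cq : clip q = q by rewrite clip_id//; lra.
have [pq|pq] := leP p q.
  have {}pq : p < q by rewrite lt_neqAle eq_sym qp.
  rewrite (_ : _ `\` _ = [set w | 1 + p - q <= w <= q]).
    have c1 : clip (1 + p - q) = 1 + p - q by rewrite clip_id//; lra.
    rewrite prge_le cp cq c1 clip_le0; last lra.
    by have [?|?] := leP (1 + p - q) q; have [?|?] := leP (p - q) p; lra.
  apply/seteqP; split => w /=; rewrite /reflect_at.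
    by move=> [[+ +] /negP/negbTE h]; rewrite h; lra.
  move=> /andP[h1 h2]; have -> : (w <= p) = false by apply/negbTE; rewrite -ltNge; lra.
  by split => //; split => //; lra.
rewrite (_ : _ `\` _ = set0); last first.
  by apply/seteqP; split => // w /= [[h _] h']; apply: h'; lra.
have c1 : clip (p - q) = p - q by rewrite clip_id//; lra.
by rewrite pr0 cq c1; have [?|?] := leP (p - q) q; lra.
Qed.

End reflection.

Section maximal.
Context {d} {T : measurableType d} {R : realType}.
Variable P : probability T R.
Hypothesis hP : atomless P.

Lemma tail_class_maximal (p : R) : 0 < p < 1 -> maximal_concentration_class P (tail_class p).
Proof.
move=> p01; split; first exact: tail_class_concentration.
move=> [D [cD + sub]]; apply; apply/seteqP; split => //.
have [q [q01 Dq]] := concentration_class_tail hP cD.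
have [_ Cq] := Dq _ (sub _ (reflection_copula_tail p01)).
have [<-//|qp] := eqVneq q p.
by have := reflection_copula_lt p01 q01 qp; rewrite Cq ltxx.
Qed.

Lemma maximal_concentration_classE D : maximal_concentration_class P D ->
  exists p : R, 0 < p < 1 /\ D = tail_class p.
Proof.
move=> [cD mD]; have [p [p01 Dp]] := concentration_class_tail hP cD.
exists p; split => //; apply: contrapT => nD; apply: mD; exists (tail_class p).
by split; [exact: tail_class_concentration|move=> h; apply: nD; rewrite h|].
Qed.

End maximal.

(** * Quantiles *)

Lemma measurable_fun_le_sets {d} {S : measurableType d} {R : realType} (f : S -> R) :
  (forall x, measurable [set w | f w <= x]) -> measurable_fun setT f.
Proof.
move=> h mD; apply: (measurability _ (RGenOInfty.measurableE R)) => //.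
move=> _ [_ [a ->] <-]; rewrite setTI (_ : _ @^-1` _ = ~` [set w | f w <= a]); first exact: measurableC.
by apply/seteqP; split => w /=; rewrite in_itv/= andbT ltNge => /negP.
Qed.

Lemma int_cvg {d} {S : measurableType d} {R : realType} (m : probability S R)
    (f_ : nat -> S -> R) (f : S -> R) (M : R) :
  (forall n, measurable_fun setT (f_ n)) -> measurable_fun setT f ->
  (forall n x, `|f_ n x| <= M) -> (forall x, f_ n x @[n --> \oo] --> f x) ->
  \int[m]_x f_ n x @[n --> \oo] --> \int[m]_x f x.
Proof.
move=> mf_ mf fM ff.
have bf_ n : bounded_measurable (f_ n) by split => //; exists M.
have bf : bounded_measurable f.
  split => //; exists M => x.
  have h : `|f_ n x| @[n --> \oo] --> `|f x| by exact: (cvg_norm (ff x)).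
  rewrite -(cvg_lim (@norm_hausdorff _ _) h).
  by apply: limr_le; [apply/cvg_ex; exists (`|f x|) | apply: nearW => n; exact: fM].
have [] := @dominated_convergence _ _ _ m setT measurableT (fun n x => (f_ n x)%:E) (EFin \o f) (EFin \o cst M).
- by move=> n; exact/measurable_EFinP.
- exact/measurable_EFinP.
- by apply: aeW => x _; apply: cvg_EFin; [exact: nearW|exact: ff].
- exact: (bm_integrable m (bm_cst M)).
- by apply: aeW => x n _; rewrite /= lee_fin.
move=> _ _; rewrite -[X in _ --> X](EFin_int m bf) => h.
have : (fun n => (\int[m]_x f_ n x)%:E) @ \oo --> (\int[m]_x f x)%:E.
  by apply: cvg_trans h; apply: near_eq_cvg; apply: nearW => n; rewrite /= EFin_int.
by move/fine_cvg.
Qed.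

Section uniform_integral.
Context {R : realType}.
Local Notation lam := (unif : probability R R).

Let id_uniform : has_law lam (uniform_prob (@ltr01 R)) (fun x : R => x).
Proof. by split => //; exact: measurable_id. Qed.

Lemma Rintegral_lebesgue (p : R) (g : R -> R) : 0 <= p -> bounded_measurable g ->
  \int[lebesgue_measure]_(x in `]p, 1[) g x = \int[lam]_x (\1_(`]p, 1[%classic) x * g x).
Proof.
move=> p0 [mg _].
pose h (x : R) : \bar R := (\1_(`]p, 1[%classic) x * g x)%:E.
have mh : measurable_fun setT h.
  by apply/measurable_EFinP; apply: measurable_funM.
have ge0 (f : R -> \bar R) : measurable_fun setT f -> (forall x, 0 <= f x)%E ->
    (\int[lam]_x f x = \int[lebesgue_measure]_(x in `[0%R, 1%R]) f x)%E.
  move=> mf f0; rewrite (ge0_int_law id_uniform mf f0) integral_uniform//.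
  by rewrite subr0 invr1 mul1e.
rewrite /Rintegral; congr fine; rewrite [RHS]integralE [X in (X - _)%E]ge0 ?[X in (_ - X)%E]ge0.
- rewrite -integralE.
  have p1E : [set` `]p, 1[] = [set` `[0, 1]] `&` [set` `]p, 1[] :> set R.
    apply/seteqP; split => x /=; rewrite !in_itv/=; last by case.
    by move=> /andP[px x1]; rewrite px x1 (ltW x1) (le_trans p0)// ltW.
  rewrite [in LHS]p1E integral_mkcondr; apply: eq_integral => x _.
  by rewrite patchE indicE; case: ifP => _; rewrite ?mul1r ?mul0r.
- exact: measurable_funeneg.
- by move=> x; exact: funeneg_ge0.
- exact: measurable_funepos.
- by move=> x; exact: funepos_ge0.
Qed.

End uniform_integral.

Section inner.
Context {R : realType}.
Local Notation lam := (unif : probability R R).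

(* [VaR s] has junk values outside 0 < s < 1, which [inner] avoids. *)
Definition inner (s : R) : R := if 0 < s < 1 then s else 2^-1.

Lemma inner01 s : 0 < inner s < 1.
Proof. by rewrite /inner; case: ifP => //; lra. Qed.

Lemma inner_id s : 0 < s < 1 -> inner s = s.
Proof. by rewrite /inner => ->. Qed.

Lemma inner_measurable : measurable_fun setT inner.
Proof.
apply: measurable_fun_ifT => //.
by apply: measurable_and; exact: measurable_fun_ltr.
Qed.

Lemma pr_not01 : pr lam (~` `]0, 1[%classic) = 0.
Proof. by rewrite prC// /pr -[X in fine X]/(unif _) unif_itv01 subrr. Qed.

Lemma inner_law : has_law lam lam inner.
Proof.
apply: has_law_cdf; first exact: inner_measurable.
move=> x; have mx := measurable_ler x inner_measurable.
apply: eq_trans (prE lam mx) _; rewrite (prE lam (measurable_itv _)); congr EFin.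
have mN : measurable (~` `]0, 1[%classic : set R) by exact: measurableC.
have mi : measurable (`]-oo, x]%classic : set R) by exact: measurable_itv.
have le01 (A B : set R) : measurable A -> measurable B ->
    (forall w, 0 < w < 1 -> A w -> B w) -> pr lam A <= pr lam B.
  move=> mA mB AB; apply: (pr_le_null mA mB mN pr_not01) => w Aw.
  have [w01|nw] := boolP (0 < w < 1); first by left; exact: AB.
  by right => /=; rewrite in_itv/=; apply/negP.
by apply/eqP; rewrite eq_le !le01// => w w01 /=; rewrite in_itv/= inner_id.
Qed.

End inner.

Section quantile.
Context {d} {T : measurableType d} {R : realType}.
Variable P : probability T R.
Implicit Types X Y : Linf P.
Local Notation pr := (pr P).
Local Notation lam := (unif : probability R R).

Lemma dfun_le X x y : x <= y -> dfun X x <= dfun X y.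
Proof.
move=> xy; rewrite !dfunE; apply: le_pr; [exact: measurable_le|exact: measurable_le|].
by move=> w /= /le_trans; exact.
Qed.

Lemma dfun_ge0 X x : 0 <= dfun X x. Proof. by rewrite dfunE pr_ge0. Qed.

Lemma dfun_le1 X x : dfun X x <= 1.
Proof. by rewrite dfunE; apply: pr_le1; exact: measurable_le. Qed.

Lemma dfun_right X x s : (forall n, s <= dfun X (x + n.+1%:R^-1)) -> s <= dfun X x.
Proof.
move=> h; pose G n := ~` [set w | X w <= x + n.+1%:R^-1].
have mG n : measurable (G n) by apply: measurableC; exact: measurable_le.
have := @pr_bigcup_ub _ _ _ P G (1 - s) mG.
have -> : \bigcup_n G n = ~` [set w | X w <= x].
  apply/seteqP; split => w /= => [[n _ /= nX] Xx|/negP].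
    by apply: nX => /=; apply: (le_trans Xx); rewrite lerDl invr_ge0.
  rewrite -ltNge => xX.
  have [n nX] := ltr_add_invr xX.
  by exists n => //=; apply/negP; rewrite -ltNge.
rewrite prC; last exact: measurable_le.
rewrite -dfunE => H; suff : 1 - dfun X x <= 1 - s by lra.
apply: H.
- move=> n m nm; apply/subsetPset => w; rewrite /G /= => nX Xm; apply: nX; apply: (le_trans Xm).
  by rewrite lerD2l lef_pV2 ?posrE ?ltr0n// ler_nat.
- by move=> n; rewrite prC; [rewrite -dfunE; have := h n; lra|exact: measurable_le].
Qed.

Lemma dfun_bound X (M : R) : pr [set w | M < `|X w|] = 0 -> dfun X M = 1.
Proof.
move=> hM; apply/eqP; rewrite eq_le dfun_le1 /=.
have mM : measurable [set w | M < `|X w|].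
  exact: measurable_norm_gt.
have := prC P mM; rewrite hM subr0 => <-; rewrite dfunE; apply: le_pr; [exact: measurableC|exact: measurable_le|].
by move=> w /= /negP; rewrite -leNgt; apply: le_trans; exact: ler_norm.
Qed.

Lemma dfun_boundN X (M x : R) : pr [set w | M < `|X w|] = 0 -> x < - M -> dfun X x = 0.
Proof.
move=> hM xM; have mM : measurable [set w | M < `|X w|].
  exact: measurable_norm_gt.
rewrite dfunE; apply: (pr_sub0 _ mM) => //; first exact: measurable_le.
by move=> w /= h; rewrite -normrN (lt_le_trans _ (ler_norm _))//; lra.
Qed.

(** Right continuity of the distribution function makes the infimum attained. Questions about
    quantiles are turned through this equivalence into questions about probabilities. *)
Lemma VaR_le X (s x : R) : 0 < s < 1 -> (VaR s X <= x) = (s <= dfun X x).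
Proof.
move=> /andP[s0 s1]; have [M M0 hM] := Linf_ae_bounded X.
rewrite /VaR; set S := [set _ | _].
have SE : S = [set y | s <= dfun X y].
  by apply/seteqP; split => y; rewrite /S /= (prE P (measurable_le X y)) lee_fin dfunE.
have Slow y : S y -> - M <= y.
  rewrite SE /= => sy; rewrite leNgt; apply/negP => yM.
  by move: sy; rewrite (dfun_boundN hM yM) leNgt s0.
have lS : has_lbound S by exists (- M) => y; exact: Slow.
have SM : S M by rewrite SE /= (dfun_bound hM) ltW.
apply/idP/idP => [Sx|sx]; last by apply: ge_inf => //; rewrite SE.
apply: dfun_right => n.
have xn : inf S < x + n.+1%:R^-1 by rewrite (le_lt_trans Sx)// ltrDl invr_gt0.
have [y Sy yx] := inf_lt (ex_intro _ M SM) xn.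
have : S y by []; rewrite SE /= => sy; apply: le_trans sy _; apply: dfun_le; exact: ltW.
Qed.

Definition quantile X (s : R) : R := VaR (inner s) X.

Lemma quantile_le X s x : (quantile X s <= x) = (inner s <= dfun X x).
Proof. by rewrite VaR_le// inner01. Qed.

Lemma quantile_mono X s t : 0 < s -> s <= t -> t < 1 -> quantile X s <= quantile X t.
Proof.
move=> s0 st t1; rewrite quantile_le !inner_id ?s0 ?t1 ?(le_lt_trans st) ?(lt_le_trans s0)//.
by apply: (le_trans st); rewrite -[leLHS](@inner_id _ t) ?t1 ?(lt_le_trans s0)// -quantile_le.
Qed.

Lemma quantile_norm X (M s : R) : pr [set w | M < `|X w|] = 0 -> `|quantile X s| <= M.
Proof.
move=> hM; have /andP[s0 s1] := inner01 s.
rewrite ler_norml quantile_le (dfun_bound hM) (ltW s1) andbT leNgt; apply/negP => qM.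
have := lexx (quantile X s); rewrite quantile_le (dfun_boundN hM qM).
by rewrite leNgt s0.
Qed.

Lemma quantile_bm X : bounded_measurable (quantile X).
Proof.
split; last by have [M _ hM] := Linf_ae_bounded X; exists M => s; exact: quantile_norm.
apply: measurable_fun_le_sets => x.
under eq_set do rewrite quantile_le.
exact: (measurable_ler _ inner_measurable).
Qed.

Lemma quantile_law X : has_law lam (distribution P X) (quantile X).
Proof.
apply: has_law_cdf; first exact: (quantile_bm X).1.
move=> x; under eq_set do rewrite quantile_le.
transitivity ((dfun X x)%:E); last by rewrite dfunE -prE//; exact: measurable_le.
have mx := measurable_ler (dfun X x) (@inner_measurable R).
apply: eq_trans (prE lam mx) _; congr EFin.
by rewrite (pr_law_cdf _ inner_law) clip_id// dfun_ge0 dfun_le1.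
Qed.

Lemma eq_in_law_quantile X Y : eq_in_law X Y -> quantile X = quantile Y.
Proof.
move=> /eq_in_lawP XY; apply/funext => s; rewrite /quantile /VaR; congr (inf _).
apply/seteqP; split => x /=; rewrite (prE P (measurable_le X x)) (prE P (measurable_le Y x)) XY//.
Qed.

Lemma ES_quantile X (p : R) : 0 < p < 1 ->
  ES p X = (1 - p)^-1 * \int[lam]_s (\1_(`]p, 1[%classic) s * quantile X s).
Proof.
move=> /andP[p0 p1]; rewrite /ES -(Rintegral_lebesgue (ltW p0) (quantile_bm X)); congr (_ * _).
apply: eq_Rintegral => s; rewrite inE/= in_itv/= => /andP[ps s1].
by rewrite /quantile inner_id// s1 (lt_trans p0).
Qed.

End quantile.

(** * Expected shortfall *)

Section general.
Context {d} {S : measurableType d} {R : realType}.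
Implicit Types (m : probability S R) (f g : S -> R).

Lemma bm_max f g : bounded_measurable f -> bounded_measurable g ->
  bounded_measurable (fun x => Num.max (f x) (g x)).
Proof.
move=> [mf [M hM]] [mg [N hN]]; split.
  apply: measurable_fun_le_sets => x.
  under eq_set do rewrite ge_max.
  rewrite (_ : [set w | _] = [set w | f w <= x] `&` [set w | g w <= x]); last first.
    by apply/seteqP; split => w /=; [move=> /andP[]|move=> [-> ->]].
  by apply: measurableI; exact: measurable_ler.
exists (M + N) => x; have := hM x; have := hN x; have := normr_ge0 (f x); have := normr_ge0 (g x).
by have [_|_] := leP (f x) (g x); lra.
Qed.

Lemma bm_min f g : bounded_measurable f -> bounded_measurable g ->
  bounded_measurable (fun x => Num.min (f x) (g x)).
Proof.
move=> bf bg; have := bmN (bm_max (bmN bf) (bmN bg)).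
by congr bounded_measurable; apply/funext => x; rewrite -oppr_min opprK.
Qed.

Lemma int_ae_le m f g (N : set S) : bounded_measurable f -> bounded_measurable g ->
  measurable N -> pr m N = 0 -> (forall w, ~ N w -> f w <= g w) ->
  \int[m]_w f w <= \int[m]_w g w.
Proof.
move=> bf bg mN N0 fg; rewrite (@int_ae_eq _ _ _ m f (fun w => Num.min (f w) (g w)) N)//.
- by apply: int_le => //; [exact: bm_min|move=> w; rewrite ge_min lexx orbT].
- exact: bm_min.
- by move=> w /fg /min_idPl ->.
Qed.

Lemma lt_set_bigcup (f : S -> R) (c : R) :
  [set w | f w < c] = \bigcup_n [set w | f w <= c - n.+1%:R^-1].
Proof.
apply/seteqP; split => w /=; last first.
  by move=> [n _ /=] /le_lt_trans; apply; rewrite ltrBlDr ltrDl invr_gt0.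
by move=> /ltr_add_invr[n fc]; exists n => //=; rewrite lerBrDr ltW.
Qed.

End general.

(** The hypotheses say that [z - c] and [w - c'] never have strictly opposite signs. *)
Lemma pos_part_add {R : realType} (z w c c' : R) :
  (z < c -> w <= c') -> (w < c' -> z <= c) ->
  Num.max (z - c) 0 + Num.max (w - c') 0 <= Num.max (z + w - (c + c')) 0.
Proof.
move=> h1 h2; have [zc|zc] := ltP z c; have [wc|wc] := ltP w c'.
- by rewrite !max_r; lra.
- by have := h1 zc => ?; rewrite !max_r; lra.
- by have := h2 wc => ?; rewrite !max_r; lra.
- by rewrite !max_l; lra.
Qed.

Section ES.
Context {d} {T : measurableType d} {R : realType}.
Variable P : probability T R.
Implicit Types X Y Z W V : Linf P.
Local Notation pr := (pr P).
Local Notation lam := (unif : probability R R).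
Variable p : R.
Hypothesis p01 : 0 < p < 1.

Let p0 : 0 < p. Proof. by have /andP[] := p01. Qed.
Let p1 : p < 1. Proof. by have /andP[] := p01. Qed.

Let J : R -> R := \1_(`]p, 1[%classic).

Let JE s : J s = (p < s < 1)%R%:R.
Proof. by rewrite /J indicE mem_setE in_itv. Qed.

Let bJ : bounded_measurable J. Proof. exact: bm_indic. Qed.

Let int_J : \int[lam]_s J s = 1 - p.
Proof. by rewrite /J int_pr// pr_unif_itvoo// !clip_id// ?ler01 ?lexx// !ltW. Qed.

Definition tail_integral X := \int[lam]_s (J s * quantile X s).

(** The expectation of the positive part of [X - c], written with the quantile function because that
    is bounded everywhere. *)
Definition excess X (c : R) := \int[lam]_s Num.max (quantile X s - c) 0.

Lemma ES_tail X : ES p X = (1 - p)^-1 * tail_integral X.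
Proof. exact: ES_quantile. Qed.

Lemma bm_excess {d'} {S : measurableType d'} (f : S -> R) c : bounded_measurable f ->
  bounded_measurable (fun s => Num.max (f s - c) 0).
Proof. by move=> bf; apply: bm_max; [apply: bmB => //; exact: bm_cst|exact: bm_cst]. Qed.

Lemma tail_integral_le X c : tail_integral X <= c * (1 - p) + excess X c.
Proof.
have bq := quantile_bm X; have be := bm_excess c bq.
rewrite -int_J -intZ// -intD//; last exact: bmZ.
apply: int_le; [exact: bmM|by apply: bmD => //; exact: bmZ|move=> s].
rewrite JE; case: (p < s < 1); rewrite ?mul1r ?mul0r ?mulr1 ?mulr0 ?add0r ?le_max ?lexx ?orbT//.
by rewrite -lerBlDl le_max lexx.
Qed.

(* With [tail_integral_le] this is the Rockafellar-Uryasev formula. *)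
Lemma tail_integral_eq X c : pr [set w | X w < c] <= p -> p <= dfun X c ->
  tail_integral X = c * (1 - p) + excess X c.
Proof.
move=> Xc pc; have bq := quantile_bm X; have be := bm_excess c bq.
rewrite -int_J -intZ// -intD//; last exact: bmZ.
apply: (int_ae_eq _ _ _ (@pr_not01 R)); [exact: bmM|by apply: bmD => //; exact: bmZ|exact: measurableC|].
move=> s /contrapT/=; rewrite in_itv/= => s01; have /andP[s0 s1] := s01.
rewrite JE s1 andbT; have [ps|sp] := ltP p s.
  have cq : c <= quantile X s.
    rewrite leNgt; apply/negP => qc; have := lexx (quantile X s).
    rewrite quantile_le inner_id// leNgt => /negP; apply; apply: le_lt_trans ps.
    apply: le_trans Xc; rewrite dfunE; apply: le_pr; [exact: measurable_le| |].
      by apply: measurable_ltr; exact: Linf_measurable.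
    by move=> w /= /le_lt_trans; exact.
  by rewrite mul1r mulr1 max_l ?subr_ge0// addrC subrK.
have qc : quantile X s <= c by rewrite quantile_le inner_id// (le_trans sp).
by rewrite mul0r mulr0 max_r ?subr_le0// addr0.
Qed.

Lemma pr_lt_le X c b : (forall x, x < c -> dfun X x <= b) -> pr [set w | X w < c] <= b.
Proof.
move=> h; rewrite lt_set_bigcup; apply: pr_bigcup_ub.
- by move=> n; exact: measurable_le.
- move=> n m nm; apply/subsetPset => w /= /le_trans; apply.
  by rewrite lerB// lef_pV2 ?posrE ?ltr0n// ler_nat.
- by move=> n; rewrite -dfunE; apply: h; rewrite ltrBlDr ltrDl invr_gt0.
Qed.

Lemma quantile_lt X x : x < quantile X p -> dfun X x < p.
Proof. by rewrite ltNge quantile_le inner_id// -ltNge. Qed.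

Lemma le_dfun_quantile X : p <= dfun X (quantile X p).
Proof. by rewrite -[leLHS](@inner_id _ p)// -quantile_le. Qed.

Lemma tail_integral_quantile X :
  tail_integral X = quantile X p * (1 - p) + excess X (quantile X p).
Proof.
apply: tail_integral_eq; last exact: le_dfun_quantile.
by apply: pr_lt_le => x /quantile_lt/ltW.
Qed.

Lemma excess_clamp X c (N : R) : 0 <= N -> pr [set w | N < `|X w|] = 0 ->
  excess X c = \int[P]_w Num.max (clamp N (X w) - c) 0.
Proof.
move=> N0 hN; have bh := bm_excess c (clamp_bm N0).
have hX : has_law P (distribution P X) X by split; [exact: Linf_measurable|].
rewrite (int_law hX bh) -(int_law (quantile_law X) bh); apply: eq_Rintegral => s _.
by rewrite clamp_id//; exact: quantile_norm.
Qed.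

Let mnorm X (N : R) : measurable [set w | N < `|X w|].
Proof. exact: measurable_norm_gt. Qed.

Let common_bound X Y : exists N : R, [/\ 0 <= N, pr [set w | N < `|X w|] = 0,
  pr [set w | N < `|Y w|] = 0 & pr [set w | N < `|(X + Y) w|] = 0].
Proof.
have [M M0 hM] := Linf_ae_bounded X; have [M' M'0 hM'] := Linf_ae_bounded Y.
exists (M + M'); split.
- by rewrite addr_ge0// ltW.
- by apply: (pr_sub0 _ (measurable_norm_gt X M)) => // w /=; lra.
- by apply: (pr_sub0 _ (measurable_norm_gt Y M')) => // w /=; lra.
- have mU : measurable ([set w | M < `|X w|] `|` [set w | M' < `|Y w|]) by exact: measurableU.
  apply: (pr_sub0 _ mU) => //.
    move=> w /= h; have := ler_normD (X w) (Y w).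
    by have [?|?] := ltP M `|X w|; [left|right; lra].
  apply/eqP; rewrite eq_le pr_ge0 andbT -hM.
  by apply: (pr_le_null _ _ (measurable_norm_gt Y M')).
Qed.

Let bm_clamp X (N : R) : 0 <= N -> bounded_measurable (fun w => clamp N (X w)).
Proof. by move=> N0; apply: (bm_comp (clamp_bm N0)); exact: Linf_measurable. Qed.

Lemma excessD_le X Y c c' : excess (X + Y) (c + c') <= excess X c + excess Y c'.
Proof.
have [N [N0 hX hY hXY]] := common_bound X Y.
rewrite !(excess_clamp _ N0)// -intD; [|exact/bm_excess/bm_clamp|exact/bm_excess/bm_clamp].
pose E := [set w | N < `|X w|] `|` [set w | N < `|Y w|] `|` [set w | N < `|(X + Y) w|].
have mE : measurable E by do 2?apply: measurableU.
apply: (int_ae_le _ _ mE).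
- exact/bm_excess/bm_clamp.
- by apply: bmD; exact/bm_excess/bm_clamp.
- apply/eqP; rewrite eq_le pr_ge0 andbT -hX.
  have mYZ : measurable ([set w | N < `|Y w|] `|` [set w | N < `|(X + Y) w|]) by exact: measurableU.
  apply: (pr_le_null _ _ mYZ) => //; last by move=> w; rewrite /E /=; tauto.
  apply/eqP; rewrite eq_le pr_ge0 andbT -hY.
  by apply: (pr_le_null _ _ (measurable_norm_gt (X + Y) N)).
- move=> w nE; rewrite !clamp_id; [|by rewrite leNgt; apply/negP => ?; apply: nE; rewrite /E/=; tauto..].
  rewrite LinfD; have := le_max (X w - c) (X w - c) 0; have := le_max 0 (X w - c) 0.
  have := le_max (Y w - c') (Y w - c') 0; have := le_max 0 (Y w - c') 0.
  rewrite !lexx ?orbT /= => h1 h2 h3 h4; rewrite ge_max; apply/andP; split; lra.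
Qed.

(** The sum of the optimal levels of [X] and [Y] is one admissible level for [X + Y], and positive
    parts are subadditive. *)
Lemma tail_integralD_le X Y : tail_integral (X + Y) <= tail_integral X + tail_integral Y.
Proof.
rewrite (tail_integral_quantile X) (tail_integral_quantile Y).
apply: le_trans (tail_integral_le _ (quantile X p + quantile Y p)) _.
by rewrite mulrDl addrACA lerD2l; exact: excessD_le.
Qed.

(** Two facts give the reverse of subadditivity: [c + c'] is a [p]-quantile of [Z + W] ([low] and
    [high]), and almost surely [Z - c] and [W - c'] do not have opposite signs, so that their
    positive parts add up. *)
Lemma tail_integralD_ge Z W C : tail_class p C -> copula_of Z W C ->
  tail_integral Z + tail_integral W <= tail_integral (Z + W).
Proof.
move=> [hC Cp] [_ ZW]; set c := quantile Z p; set c' := quantile W p.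
have prZW x y : pr [set w | Z w <= x /\ W w <= y] = C (dfun Z x) (dfun W y).
  by rewrite /pr ZW.
have clipF X x : clip (dfun X x) = dfun X x by rewrite clip_id// dfun_ge0 dfun_le1.
have mI x y : measurable [set w | Z w <= x /\ W w <= y].
  exact: (measurableI _ _ (measurable_le Z x) (measurable_le W y)).
have pZ : p <= dfun Z c by exact: le_dfun_quantile.
have pW : p <= dfun W c' by exact: le_dfun_quantile.
pose E1 := [set w | Z w < c] `&` ~` [set w | W w <= c'].
pose E2 := [set w | W w < c'] `&` ~` [set w | Z w <= c].
have mlt X x : measurable [set w | X w < x] by apply: measurable_ltr; exact: Linf_measurable.
have mE1 : measurable E1 by apply: measurableI => //; exact/measurableC/measurable_le.
have mE2 : measurable E2 by apply: measurableI => //; exact/measurableC/measurable_le.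
(* [c] is approached from below because [copula_tail_le] needs a level where [dfun Z] is at most
   [p]; an atom at [c] may lift it above [p]. *)
have E10 : pr E1 = 0.
  rewrite /E1 lt_set_bigcup setI_bigcupl; apply: pr_bigcup0 => n.
    by apply: measurableI; [exact: measurable_le|exact/measurableC/measurable_le].
  rewrite -setDE; have := prDI P (measurable_le Z (c - n.+1%:R^-1)) (measurable_le W c').
  rewrite prZW -dfunE; have zc : dfun Z (c - n.+1%:R^-1) <= p.
    by apply/ltW/quantile_lt; rewrite ltrBlDr ltrDl invr_gt0.
  by rewrite (copula_tail_le hC p01 Cp zc pW).1 clipF; lra.
have E20 : pr E2 = 0.
  rewrite /E2 lt_set_bigcup setI_bigcupl; apply: pr_bigcup0 => n.
    by apply: measurableI; [exact: measurable_le|exact/measurableC/measurable_le].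
  rewrite -setDE; have := prDI P (measurable_le W (c' - n.+1%:R^-1)) (measurable_le Z c).
  rewrite setIC prZW -dfunE; have wc : dfun W (c' - n.+1%:R^-1) <= p.
    by apply/ltW/quantile_lt; rewrite ltrBlDr ltrDl invr_gt0.
  by rewrite (copula_tail_le hC p01 Cp wc pZ).2 clipF; lra.
(* A sum below [c + c'] has a term below its own level. The union of the two lower events has mass
   at most [p] by [copula_tail_ge], first strictly below the levels and then in the limit. *)
have low : pr [set w | (Z + W) w < c + c'] <= p.
  pose A n := [set w | Z w <= c - n.+1%:R^-1]; pose B n := [set w | W w <= c' - n.+1%:R^-1].
  have mA n : measurable (A n) by exact: measurable_le.
  have mB n : measurable (B n) by exact: measurable_le.
  have U : pr (\bigcup_n (A n `|` B n)) <= p.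
    apply: pr_bigcup_ub.
    - by move=> n; exact: measurableU.
    - move=> n m nm; have nm' : m.+1%:R^-1 <= n.+1%:R^-1 :> R by rewrite lef_pV2 ?posrE ?ltr0n// ler_nat.
      by apply/subsetPset => w [] h; [left|right]; apply: (le_trans h); rewrite lerB.
    - move=> n; rewrite -(setDUK (@subsetUl _ (A n) (B n))) setDUl setDv set0U.
      rewrite prU//; [|exact: measurableD|by rewrite setDE setICA setICr setI0].
      have := prDI P (mB n) (mA n); rewrite setIC prZW.
      have wc : dfun W (c' - n.+1%:R^-1) <= p by apply/ltW/quantile_lt; rewrite ltrBlDr ltrDl invr_gt0.
      have zc : dfun Z (c - n.+1%:R^-1) <= p by apply/ltW/quantile_lt; rewrite ltrBlDr ltrDl invr_gt0.
      have := copula_tail_ge hC p01 Cp zc wc; rewrite !clipF /A /B -!dfunE; lra.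
  apply: le_trans U; apply: le_pr => //; first by apply: bigcup_measurable => n _; exact: measurableU.
  rewrite bigcupU -!lt_set_bigcup => w /= h.
  have {}h : Z w + W w < c + c' by exact: h.
  by have [?|?] := ltP (Z w) c; [left|right; lra].
have high : p <= dfun (Z + W) (c + c').
  rewrite -{1}Cp; apply: le_trans (copula_mono hC pZ pW) _; rewrite -prZW dfunE.
  by apply: le_pr; [exact: mI|exact: measurable_le|move=> w /= [h1 h2]; exact: lerD].
rewrite (tail_integral_eq low high) (tail_integral_quantile Z) (tail_integral_quantile W) -/c -/c'.
rewrite mulrDl addrACA lerD2l.
have [N [N0 hX hY hXY]] := common_bound Z W.
rewrite !(excess_clamp _ N0)// -intD; [|exact/bm_excess/bm_clamp|exact/bm_excess/bm_clamp].
(* Five null events, padded with empty sets to a sequence. *)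
pose E := \bigcup_n nth set0 [:: [set w | N < `|Z w|]; [set w | N < `|W w|]; [set w | N < `|(Z + W) w|]; E1; E2] n.
have mE n : measurable (nth set0 [:: [set w | N < `|Z w|]; [set w | N < `|W w|]; [set w | N < `|(Z + W) w|]; E1; E2] n).
  by case: n => [|[|[|[|[|n]]]]] //=; first [exact: measurable_norm_gt|exact: (measurable_norm_gt (Z + W) N)|rewrite nth_nil].
have E0 : pr E = 0.
  by apply: pr_bigcup0 => // n; case: n => [|[|[|[|[|n]]]]] //=; rewrite nth_nil pr0.
apply: (int_ae_le _ _ _ E0).
- by apply: bmD; exact/bm_excess/bm_clamp.
- exact/bm_excess/bm_clamp.
- exact: bigcup_measurable.
- move=> w nE; rewrite !clamp_id; [|rewrite leNgt; apply/negP => h; apply: nE..].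
  + have n1 : ~ E1 w by move=> h; apply: nE; exists 3%N.
    have n2 : ~ E2 w by move=> h; apply: nE; exists 4%N.
    apply: pos_part_add => h; rewrite leNgt; apply/negP => h'; [apply: n1|apply: n2];
      by split => //=; apply/negP; rewrite -ltNge.
  + by exists 2%N.
  + by exists 1%N.
  + by exists 0%N.
Qed.

Lemma ES_averse : averse (tail_class p) (ES (P := P) p).
Proof.
move=> X Y Z W XZ YW [C CD ZW]; rewrite !ES_tail ler_pM2l ?invr_gt0 ?subr_gt0//.
apply: le_trans (tail_integralD_le X Y) _.
rewrite /tail_integral (eq_in_law_quantile XZ) (eq_in_law_quantile YW).
exact: (tail_integralD_ge CD ZW).
Qed.

Lemma le_quantile X Y s : (forall w, X w <= Y w) -> quantile X s <= quantile Y s.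
Proof.
move=> XY; rewrite quantile_le; have := lexx (quantile Y s); rewrite quantile_le => /le_trans; apply.
rewrite !dfunE; apply: le_pr; [exact: measurable_le|exact: measurable_le|].
by move=> w /=; apply: le_trans.
Qed.

Lemma quantile_shift X (c s : R) : quantile (X + Linf_cst P c) s = quantile X s + c.
Proof.
have E x : (quantile (X + Linf_cst P c) s <= x) = (quantile X s + c <= x).
  rewrite quantile_le -lerBrDr quantile_le; congr (_ <= _); rewrite !dfunE; congr (pr _).
  by apply/seteqP; split => w /= h; [rewrite lerBrDr; exact: h|move: h; rewrite lerBrDr].
by apply/eqP; rewrite eq_le E lexx -E lexx.
Qed.

Lemma ES_monetary : monetary_risk_measure (ES (P := P) p).
Proof.
split=> [X Y XY|X c]; rewrite !ES_tail.
  rewrite ler_pM2l ?invr_gt0 ?subr_gt0//; apply: int_le; [exact/bmM/quantile_bm|exact/bmM/quantile_bm|].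
  by move=> s; rewrite ler_wpM2l ?JE ?ler0n//; exact: le_quantile.
have bq := quantile_bm X.
suff -> : tail_integral (X + Linf_cst P c) = tail_integral X + c * (1 - p).
  by rewrite mulrDr mulrCA mulVf ?mulr1// gt_eqF// subr_gt0.
rewrite -int_J -intZ// -intD; [|exact: bmM|exact: bmZ].
by apply: eq_Rintegral => s _; rewrite quantile_shift; ring.
Qed.

Lemma ES0 : ES p (0 : Linf P) = 0.
Proof.
have q0 s : quantile (0 : Linf P) s = 0.
  apply/eqP; rewrite -normr_le0; apply: quantile_norm.
  rewrite (_ : [set w | _] = set0) ?pr0//; apply/seteqP; split => // w /=.
  by rewrite normr0 ltxx.
rewrite ES_tail /tail_integral; under eq_Rintegral do rewrite q0 mulr0.
by rewrite int_cst mulr0.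
Qed.

Lemma quantile_lsc (X_ : nat -> Linf P) X (s x : R) : 0 < s < 1 ->
  (forall w, X_ n w @[n --> \oo] --> X w) -> x < quantile X s ->
  \forall n \near \oo, x < quantile (X_ n) s.
Proof.
move=> s01 hX; rewrite ltNge quantile_le inner_id// -ltNge => Fx.
(* The union with {X <= x} makes the indicators converge everywhere, even where [X w = x] and
   [X_ n w] may lie on either side. *)
pose A n := [set w | X_ n w <= x] `|` [set w | X w <= x].
have mA n : measurable (A n) by apply: measurableU; exact: measurable_le.
have : \int[P]_w (\1_(A n) w : R) @[n --> \oo] --> \int[P]_w (\1_[set w | X w <= x] w : R).
  apply: (int_cvg _ (M := 1)).
  - by move=> n; exact: (bm_indic (mA n)).1.
  - exact: (bm_indic (measurable_le X x)).1.
  - by move=> n w; rewrite indicE; case: (_ \in _); rewrite ?normr1 ?normr0.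
  move=> w; have [Xx|xX] := leP (X w) x.
    apply: cvg_near_cst; apply: nearW => n.
    by rewrite !indicE !mem_set//; right.
  apply: cvg_near_cst; near=> n.
  have xn : x < X_ n w by near: n; exact: (cvgr_gt _ (hX w) _ xX).
  rewrite !indicE !memNset//=; first by apply/negP; rewrite -ltNge.
  by move=> [/=|/=]; apply/negP; rewrite -ltNge.
rewrite (int_pr P (measurable_le X x)) -dfunE => h.
have : \forall n \near \oo, \int[P]_w (\1_(A n) w : R) < s by apply: (cvgr_lt _ h).
apply: filterS => n.
rewrite (int_pr P (mA n)) => An; rewrite ltNge quantile_le inner_id// -ltNge.
apply: le_lt_trans An; rewrite dfunE; apply: le_pr => //; first exact: measurable_le.
by move=> w; left.
Unshelve. all: by end_near.
Qed.

Lemma ES_lsc : pointwise_lsc (ES (P := P) p).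
Proof.
move=> X_ X hX.
(* The [X_ n] need not be uniformly bounded. Truncating their quantiles above by [quantile X] and
   below by a level under its values on (p, 1) makes bounded convergence applicable. *)
pose c := quantile X p - 1.
pose g n s := Num.max c (Num.min (quantile (X_ n) s) (quantile X s)).
have bc : bounded_measurable (fun _ : R => c) by exact: bm_cst.
have bq Y : bounded_measurable (quantile Y) by exact: quantile_bm.
have bg n : bounded_measurable (g n) by apply: bm_max => //; apply: bm_min.
have [M M0 hM] := Linf_ae_bounded X.
have gM n s : `|g n s| <= `|c| + M.
  have := quantile_norm s hM; rewrite /g; move: (quantile X s) (quantile (X_ n) s) => y z.
  rewrite !ler_norml => /andP[y1 y2]; have := ler_norm c; have := ler_norm (- c); rewrite normrN => h1 h2.
  by have [h3|h3] := leP z y; [have [h4|h4] := leP c z|have [h4|h4] := leP c y]; lra.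
have lim : \int[lam]_s (J s * g n s) @[n --> \oo] --> tail_integral X.
  apply: (int_cvg _ (M := `|c| + M)).
  - by move=> n; exact: (bmM bJ (bg n)).1.
  - exact: (bmM bJ (bq X)).1.
  - move=> n s; rewrite normrM JE; case: (p < s < 1); rewrite ?normr1 ?mul1r// normr0 mul0r.
    by rewrite addr_ge0// ltW.
  move=> s; rewrite JE; have [/andP[ps s1]|_] := boolP (p < s < 1); last first.
    by under eq_fun do rewrite mul0r; rewrite mul0r; exact: cvg_cst.
  under eq_fun do rewrite mul1r; rewrite mul1r.
  have cq : c < quantile X s.
    by rewrite /c; have := quantile_mono X p0 (ltW ps) s1; lra.
  apply/cvgrPdist_lt => e e0; near=> n.
  have qn : quantile X s - e < quantile (X_ n) s.
    near: n; apply: (quantile_lsc _ hX); first by rewrite s1 (lt_trans p0 ps).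
    by rewrite ltrBlDr ltrDl.
  rewrite /g ltr_norml; move: qn cq; move: (quantile X s) (quantile (X_ n) s) => y z h1 h2.
  by have [h3|h3] := leP z y; [have [h4|h4] := leP c z|have [h4|h4] := leP c y]; apply/andP; split; lra.
(* The lower truncation is eventually harmless: once the [p]-quantile of [X_ n] exceeds [c], so do
   its quantiles on (p, 1). *)
have ge : \forall n \near \oo, \int[lam]_s (J s * g n s) <= tail_integral (X_ n).
  have := @quantile_lsc X_ X p c p01 hX; rewrite /c ltrBlDr ltrDl => /(_ ltr01).
  apply: filterS => n cn; apply: int_le; [exact: bmM|exact: bmM|move=> s].
  rewrite JE; have [/andP[ps s1]|_] := boolP (p < s < 1); last by rewrite !mul0r.
  have := quantile_mono (X_ n) p0 (ltW ps) s1.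
  by rewrite !mul1r /g ge_max ge_min lexx /= andbT /c => h; lra.
rewrite limn_einf_lim; apply/lee_addgt0Pr => e e0.
have e1 : 0 < e * (1 - p) by rewrite mulr_gt0 ?subr_gt0.
have near_ge : \forall n \near \oo, ES p X - e <= ES p (X_ n).
  have : \forall n \near \oo, tail_integral X - e * (1 - p) < \int[lam]_s (J s * g n s).
    by apply: (cvgr_gt _ lim); rewrite ltrBlDr ltrDl.
  move: ge; apply: filterS2 => n h1 h2; rewrite !ES_tail -[X in _ - X](mulKf (_ : 1 - p != 0)) ?gt_eqF ?subr_gt0//.
  by rewrite -mulrBr ler_pM2l ?invr_gt0 ?subr_gt0// mulrC; lra.
rewrite -leeBlDr// -EFinB; apply: lime_ge; first exact: is_cvg_einfs.
case: near_ge => N _ hN; exists N => // n /= Nn; apply: le_ereal_inf_tmp => _ [m /= nm <-].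
by rewrite lee_fin; apply: hN; exact: leq_trans nm.
Unshelve. all: by end_near.
Qed.

End ES.

(** * Averse risk measures *)

Lemma exp2_small {R : realType} (x y : R) : 0 < y -> exists N, forall n, (N <= n)%N ->
  x / 2 ^+ n < y.
Proof.
move=> y0; have [N hN] := @ltr_add_invr R 0 (y / (`|x| + 1)) ltac:(by rewrite divr_gt0// ltr_wpDl).
exists N => n Nn; rewrite ltr_pdivrMr ?exprn_gt0//.
have x1 : 0 < `|x| + 1 by rewrite ltr_wpDl.
have N2 : N.+1%:R <= (2 : R) ^+ n.
  by rewrite -natrX ler_nat; apply: leq_ltn_trans Nn (ltn_expl n _).
move: hN; rewrite add0r ltr_pdivlMr// -ltr_pdivlMl ?invr_gt0 ?ltr0n// invrK mulrC => h.
by have := ler_norm x; have := ler_wpM2l (ltW y0) N2; lra.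
Qed.

Lemma pr_ae_eq {d} {T : measurableType d} {R : realType} (P : probability T R) (A B N : set T) :
  measurable A -> measurable B -> measurable N -> pr P N = 0 ->
  (forall w, ~ N w -> (A w <-> B w)) -> pr P A = pr P B.
Proof.
move=> mA mB mN N0 AB; apply/eqP; rewrite eq_le.
by apply/andP; split; apply: (pr_le_null _ _ mN N0) => // w h;
  (have [?|nN] := pselect (N w); [by right|left; apply/(AB w nN)]).
Qed.

Lemma eq_in_law_pointwise {d} {T : measurableType d} {R : realType} {P : probability T R}
  (X Y : Linf P) : (forall w, X w = Y w) -> eq_in_law X Y.
Proof. by move=> XY A mA; rewrite /distribution /pushforward; congr (P _); apply/seteqP; split => w /=; rewrite XY. Qed.

Section averse.
Context {d} {T : measurableType d} {R : realType}.
Variable P : probability T R.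
Implicit Types X Y Z W : Linf P.
Implicit Type phi : Linf P -> R.
Local Notation pr := (pr P).
Local Notation lam := (unif : probability R R).
Variable p : R.
Hypothesis p01 : 0 < p < 1.

Let p0 : 0 < p. Proof. by have /andP[] := p01. Qed.
Let p1 : p < 1. Proof. by have /andP[] := p01. Qed.

Lemma comonotone_tail : tail_class p (@comonotone R).
Proof.
by split; [exact: comonotone_copula|rewrite /comonotone minxx clip_id// !ltW].
Qed.

Lemma copula_of_self X : copula_of X X comonotone.
Proof.
split=> [|x y]; first exact: comonotone_copula.
rewrite /comonotone clip_id; last by rewrite le_min !dfun_ge0 ge_min dfun_le1.
wlog xy : x y / x <= y.
  move=> h; have [|/ltW] := leP x y; first exact: h.
  by move=> /h; rewrite minC => <-; congr (P _); apply/seteqP; split => w /=; tauto.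
rewrite min_l ?dfun_le// dfunE -prE; last exact: measurable_le.
by congr (P _); apply/seteqP; split => w /= => [[]//|h]; split => //; exact: le_trans xy.
Qed.

(** A pair with a constant member admits every copula; the comonotone one is chosen because it lies
    in all tail classes. This gives law invariance. *)
Lemma copula_of_0 X : copula_of X 0 comonotone.
Proof.
split=> [|x y]; first exact: comonotone_copula.
have [y0|y0] := leP 0 y.
  have -> : dfun (0 : Linf P) y = 1.
    by rewrite dfunE -[RHS](prT P); congr (pr _); apply/seteqP; split.
  rewrite /comonotone min_l ?dfun_le1// clip_id ?dfun_ge0 ?dfun_le1//.
  rewrite dfunE -prE; last exact: measurable_le.
  by congr (P _); apply/seteqP; split => w /= => [[]|].
have F0 (A : set T) : (forall w, A w -> 0 <= y) -> A = set0.
  by move=> h; apply/seteqP; split => // w /h; rewrite leNgt y0.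
have -> : dfun (0 : Linf P) y = 0 by rewrite dfunE [X in pr X]F0 ?pr0.
rewrite /comonotone min_r ?dfun_ge0// clip_id ?lexx ?ler01// [X in P X]F0 ?measure0//.
by move=> w [].
Qed.

(** Aversion for the pairs (X, 0) and (Y, 0), in both directions. *)
Lemma averse_law phi X Y : averse (tail_class p) phi -> eq_in_law X Y -> phi X = phi Y.
Proof.
have le V W : averse (tail_class p) phi -> eq_in_law V W -> phi V <= phi W.
  move=> aphi VW; rewrite -(addr0 V) -(addr0 W); apply: aphi => //.
  by exists comonotone; [exact: comonotone_tail|exact: copula_of_0].
by move=> aphi XY; apply/eqP; rewrite eq_le !le//; exact: eq_in_law_sym.
Qed.

(** Both (Z, Z) and (Z, W) have a copula in the class and the same margins, so either sum bounds the
    other. *)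
Lemma averse_double phi Z W C : averse (tail_class p) phi -> eq_in_law Z W ->
  tail_class p C -> copula_of Z W C -> phi (Z + Z) = phi (Z + W).
Proof.
move=> aphi ZW tC cC; apply/eqP; rewrite eq_le; apply/andP; split.
  by apply: aphi => //; exists C.
apply: aphi; [by []|exact: eq_in_law_sym|].
by exists comonotone; [exact: comonotone_tail|exact: copula_of_self].
Qed.

Variable U : T -> R.
Hypothesis hU : has_law P lam U.
Hypothesis U01 : forall w, 0 < U w < 1.

Let U' (w : T) : R := reflect_at p (U w).

Let hU' : has_law P lam U'.
Proof. exact: (has_law_comp hU (reflect_at_law p01)). Qed.

Definition on_uniform X : Linf P := Linf_of P (bm_comp (quantile_bm X) hU.1).

Definition on_reflected X : Linf P := Linf_of P (bm_comp (quantile_bm X) hU'.1).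

Lemma on_uniform_law X : eq_in_law X (on_uniform X).
Proof.
move=> A mA; have h := has_law_comp hU (quantile_law X).
by rewrite -(h.2 _ mA).
Qed.

Lemma on_reflected_law X : eq_in_law X (on_reflected X).
Proof.
move=> A mA; have h := has_law_comp hU' (quantile_law X).
by rewrite -(h.2 _ mA).
Qed.

Lemma eq_in_law_dfun X Y : eq_in_law X Y -> dfun X = dfun Y.
Proof. by move=> /eq_in_lawP XY; apply/funext => x; rewrite !dfunE. Qed.

(** For arguments in (0,1) a quantile is at most [x] exactly when its argument is at most
    [dfun X x]. The reflected argument leaves (0,1) only on a null event. *)
Lemma on_uniform_copula X : copula_of (on_uniform X) (on_reflected X) (reflection_copula p).
Proof.
split=> [|x y]; first by have [] := reflection_copula_tail p01.
rewrite -(eq_in_law_dfun (on_uniform_law X)) -(eq_in_law_dfun (on_reflected_law X)).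
have mU u : measurable [set w | U w <= u] by exact: measurable_ler hU.1.
have mU' u : measurable [set w | U' w <= u] by exact: measurable_ler hU'.1.
have mx u : measurable [set w | inner (U w) <= u].
  by apply: measurable_ler; exact: (measurableT_comp inner_measurable hU.1).
have my u : measurable [set w | inner (U' w) <= u].
  by apply: measurable_ler; exact: (measurableT_comp inner_measurable hU'.1).
have mN : measurable (U' @^-1` (~` `]0, 1[%classic)).
  by rewrite -[X in measurable X]setTI; apply: hU'.1 => //; exact: measurableC.
have N0 : pr (U' @^-1` (~` `]0, 1[%classic)) = 0.
  by rewrite /pr hU'.2; [exact: pr_not01|exact: measurableC].
transitivity ((pr [set w | U w <= dfun X x /\ U' w <= dfun X y])%:E); last first.
  have mI : measurable [set u : R | u <= dfun X x /\ reflect_at p u <= dfun X y].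
    by apply: measurableI; apply: measurable_ler => //; exact: reflect_at_measurable.
  rewrite /reflection_copula /joint_cdf -prE; last by exact: (measurableI _ _ (mU _) (mU' _)).
  by rewrite -(prE lam mI) -hU.2.
have mxy : measurable [set w | on_uniform X w <= x /\ on_reflected X w <= y].
  exact: (measurableI _ _ (measurable_le _ x) (measurable_le _ y)).
rewrite (prE P mxy); congr EFin.
have E w : ~ (U' @^-1` (~` `]0, 1[%classic)) w ->
    (on_uniform X w <= x /\ on_reflected X w <= y) <-> (U w <= dfun X x /\ U' w <= dfun X y).
  move=> /contrapT /=; rewrite in_itv/= => u01.
  by rewrite !quantile_le !inner_id.
have mUU : measurable [set w | U w <= dfun X x /\ U' w <= dfun X y].
  exact: (measurableI _ _ (mU _) (mU' _)).
exact: (pr_ae_eq mxy mUU mN N0).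
Qed.

Lemma averse_reflect phi X : averse (tail_class p) phi ->
  phi (X + X) = phi (on_uniform X + on_reflected X).
Proof.
move=> aphi; rewrite -(averse_double aphi _ (reflection_copula_tail p01) (on_uniform_copula X)); last first.
  exact: eq_in_law_trans (eq_in_law_sym (on_uniform_law X)) (on_reflected_law X).
apply: (averse_law aphi); apply/eq_in_lawP => x.
have XX Y : pr [set w | (Y + Y) w <= x] = dfun Y (x / 2).
  rewrite dfunE; congr (pr _); apply/seteqP; split => w /= h.
    have {}h : Y w + Y w <= x by exact: h.
    by lra.
  suff : Y w + Y w <= x by [].
  by lra.
by rewrite !XX (eq_in_law_dfun (on_uniform_law X)).
Qed.

Section two_point.

Lemma bm_two_point (K t : R) : bounded_measurable (fun w => - K * \1_[set w | U w <= t] w).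
Proof. by apply: bmZ; apply: bm_indic; exact: measurable_ler hU.1. Qed.

Definition two_point (K t : R) : Linf P := Linf_of P (bm_two_point K t).

Lemma two_pointE K t w : two_point K t w = if U w <= t then - K else 0.
Proof.
rewrite /two_point Linf_ofE (indic_bool (fun w => U w <= t)).
by case: ifP => _; rewrite ?mulr1 ?mulr0.
Qed.

Lemma dfun_two_point K t x : 0 <= K -> 0 <= t <= 1 ->
  dfun (two_point K t) x = if 0 <= x then 1 else if - K <= x then t else 0.
Proof.
move=> K0 t01; rewrite dfunE; under eq_set do rewrite two_pointE.
case: ifP => x0.
  rewrite -[RHS](prT P); congr (pr _); apply/seteqP; split => w //= _.
  by case: ifP => // _; lra.
case: ifP => Kx.
  rewrite -[RHS](clip_id t01) -(pr_law_cdf t hU); congr (pr _); apply/seteqP; split => w /=.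
    by case: ifP => // _; rewrite x0.
  by move=> ->.
rewrite -[RHS](pr0 P); congr (pr _); apply/seteqP; split => w //=.
by case: ifP => _; rewrite ?Kx ?x0.
Qed.

Lemma quantile_two_point K t s : 0 <= K -> 0 <= t <= 1 -> 0 < s < 1 ->
  quantile (two_point K t) s = if s <= t then - K else 0.
Proof.
move=> K0 t01 s01; have /andP[s0 s1] := s01.
suff E x : (quantile (two_point K t) s <= x) = ((if s <= t then - K else 0) <= x).
  by apply/eqP; rewrite eq_le E lexx -E lexx.
rewrite quantile_le inner_id// dfun_two_point//.
have [st|ts] := leP s t; have [x0|x0] := leP 0 x.
- by rewrite (ltW s1); apply/esym; lra.
- by have [Kx|Kx] := leP (- K) x => //; apply/negbTE; rewrite -ltNge.
- by rewrite (ltW s1).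
- by case: ifP => _; apply/negbTE; rewrite -ltNge.
Qed.

(** For [t <= p] the events that [U] and its reflection are at most [t / 2] are almost disjoint.
    Hence a loss of [-2K] on mass [t / 2], being [Z + Z], is worth as much as [-K] on mass [t]. *)
Lemma averse_two_point phi (K t : R) : averse (tail_class p) phi -> 0 <= K -> 0 < t -> t <= p ->
  phi (two_point (2 * K) (t / 2)) = phi (two_point K t).
Proof.
move=> aphi K0 t0 tp; have pp1 := p1; have t01 : 0 <= t <= 1 by lra.
have t2 : 0 <= t / 2 <= 1 by lra.
set Z := two_point K (t / 2).
have -> : phi (two_point (2 * K) (t / 2)) = phi (Z + Z).
  apply: (averse_law aphi); apply: eq_in_law_pointwise => w.
  by rewrite -[RHS]/(Z w + Z w) !two_pointE; case: ifP => _; ring.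
rewrite averse_reflect//; apply: (averse_law aphi); apply/eq_in_lawP => x.
rewrite -[RHS]dfunE dfun_two_point//.
pose D := [set w | U w <= t / 2]; pose D' := [set w | U' w <= t / 2].
have mD : measurable D by exact: measurable_ler hU.1.
have mD' : measurable D' by exact: measurable_ler hU'.1.
have prD : pr D = t / 2 by rewrite (pr_law_cdf _ hU) clip_id.
have prD' : pr D' = t / 2 by rewrite (pr_law_cdf _ hU') clip_id.
have m1 : measurable (U @^-1` [set p / 2]).
  by rewrite -[X in measurable X]setTI; exact: hU.1.
have m2 : measurable (U' @^-1` (~` `]0, 1[%classic)).
  by rewrite -[X in measurable X]setTI; apply: hU'.1 => //; exact: measurableC.
(* The two events can meet only where [U = p / 2], the fixed point of the reflection, and only for
   [t = p]. *)
pose N := (U @^-1` [set p / 2]) `|` (U' @^-1` (~` `]0, 1[%classic)).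
have mN : measurable N by exact: measurableU.
have N1 : pr (U @^-1` [set p / 2]) = 0.
  by rewrite /pr hU.2// -[X in fine X]/(unif _) unif_set1.
have N0 : pr N = 0.
  apply/eqP; rewrite eq_le pr_ge0 andbT -N1; apply: (pr_le_null _ _ m2) => //.
  by rewrite /pr hU'.2; [exact: pr_not01|exact: measurableC].
have DD' w : D w -> D' w -> N w.
  rewrite /D /D' /= /U' /reflect_at => h1; have -> : U w <= p by lra.
  by move=> h2; left => /=; lra.
have prE : pr (D `|` D') = t.
  have := prDI P mD' mD; rewrite prD'.
  have -> : pr (D' `&` D) = 0.
    by apply: (pr_sub0 _ mN _ N0); [exact: measurableI|move=> w [? ?]; exact: DD'].
  rewrite addr0.
  have -> : D `|` D' = D `|` (D' `\` D).
    by apply/seteqP; split => w /=; have := pselect (D w); tauto.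
  rewrite prU//; [rewrite prD => <-; lra|exact: measurableD|].
  by rewrite setDE setICA setICr setI0.
have mH : measurable [set w | (on_uniform Z + on_reflected Z) w <= x] by exact: measurable_le.
have HE w : ~ N w -> (on_uniform Z + on_reflected Z) w = if `[< (D `|` D') w >] then - K else 0.
  move=> nN; have u'01 : 0 < U' w < 1.
    by apply: contrapT => h; apply: nN; right => /=; rewrite in_itv.
  rewrite -[LHS]/(quantile Z (U w) + quantile Z (U' w)) !quantile_two_point//.
  have := DD' w; rewrite /D /D' /=.
  have [h1|h1] := leP (U w) (t / 2); have [h2|h2] := leP (U' w) (t / 2) => h.
  - by exfalso; apply: nN; exact: h.
  - by rewrite asboolT ?addr0//; left.
  - by rewrite asboolT ?add0r//; right.
  - by rewrite asboolF ?addr0// => -[|].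
have HS w : ~ N w -> [set w | (on_uniform Z + on_reflected Z) w <= x] w =
    ((if `[< (D `|` D') w >] then - K else 0) <= x) :> Prop.
  by move=> nN; rewrite -HE.
have [x0|x0] := leP 0 x.
  rewrite -[RHS](prT P); apply: (pr_ae_eq _ _ mN N0) => // w nN; rewrite HS//; split => // _.
  by case: ifP => // _; lra.
have [Kx|Kx] := leP (- K) x.
  rewrite -[RHS]prE; apply: (pr_ae_eq _ _ mN N0) => //; first exact: measurableU.
  move=> w nN; rewrite HS//; case: asboolP => h; split => //; by rewrite leNgt x0.
rewrite -[RHS](pr0 P); apply: (pr_ae_eq _ _ mN N0) => // w nN; rewrite HS//; split => //.
by case: ifP => _; lra.
Qed.

Lemma averse_lsc_two_point phi (K : R) : monetary_risk_measure phi -> pointwise_lsc phi ->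
  phi 0 = 0 -> averse (tail_class p) phi -> 0 <= K -> phi (two_point K p) = 0.
Proof.
move=> [mono _] lsc phi0 aphi K0.
pose X_ n := two_point (2 ^+ n * K) (p / 2 ^+ n).
have XE n : phi (X_ n) = phi (two_point K p).
  elim: n => [|n <-]; first by rewrite /X_ expr0 mul1r divr1.
  rewrite /X_ -(@averse_two_point phi (2 ^+ n * K) (p / 2 ^+ n))//.
  - by rewrite exprS mulrA invfM mulrCA mulrC [2^-1 * _]mulrC.
  - by rewrite mulr_ge0// exprn_ge0.
  - by rewrite divr_gt0// exprn_gt0.
  - by rewrite ler_pdivrMr ?exprn_gt0// ler_peMr ?(ltW p0)// exprn_ege1// ler1n.
apply/eqP; rewrite eq_le; apply/andP; split.
  by rewrite -phi0; apply: mono => w; rewrite two_pointE Linf0; case: ifP => // _; lra.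
(* Lower semicontinuity asks for convergence at every outcome, hence [0 < U w] for all [w]. *)
have X0 w : X_ n w @[n --> \oo] --> (0 : Linf P) w.
  have /andP[u0 _] := U01 w; have [N hN] := exp2_small p u0.
  apply: cvg_near_cst; exists N => // n Nn; suff : X_ n w = 0 by [].
  by rewrite two_pointE leNgt hN.
have := lsc _ _ X0; under [X in limn_einf X]eq_fun do rewrite XE.
by rewrite (cvg_limn_einf_sup (cvg_cst _)).1 lee_fin phi0.
Qed.

End two_point.

(** Separate base levels for the quantiles up to [p] and beyond [p]; only the upper one will enter
    the bounds on the risk. *)
Definition quantile_within X (a c r : R) := [/\ a <= c,
  forall s : R, 0 < s < 1 -> s <= p -> a <= quantile X s <= a + r &
  forall s : R, 0 < s < 1 -> p < s -> c <= quantile X s <= c + r].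

(** The variable lies between two steps at [U = p], one from [a] up to [c] and the other the same
    raised by [r]. Both are translates of [two_point (c - a) p], whose risk is 0. *)
Lemma within_bounds phi X a c r : monetary_risk_measure phi -> pointwise_lsc phi ->
  phi 0 = 0 -> averse (tail_class p) phi -> quantile_within X a c r -> c <= phi X <= c + r.
Proof.
move=> mphi lsc phi0 aphi [ac hlow hhigh]; have [mono tr] := mphi.
have TP : phi (two_point (c - a) p) = 0 by apply: averse_lsc_two_point; rewrite ?subr_ge0.
rewrite (averse_law aphi (on_uniform_law X)).
have E w y : (two_point (c - a) p + Linf_cst P y) w = (if U w <= p then a - c else 0) + y.
  by rewrite -[LHS]/(two_point (c - a) p w + y) two_pointE opprB.
have e y : phi (two_point (c - a) p + Linf_cst P y) = y by rewrite tr TP add0r.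
apply/andP; split; [rewrite -[leLHS](e c)|rewrite -[leRHS](e (c + r))]; apply: mono => w;
  rewrite E -[on_uniform X w]/(quantile X (U w));
  have [h|h] := leP (U w) p;
  by [have := hlow _ (U01 w) h; lra|have := hhigh _ (U01 w) h; lra].
Qed.

Lemma quantile_ge X (s y : R) : 0 < s < 1 -> pr [set w | X w < y] < s -> y <= quantile X s.
Proof.
move=> s01 Xs; rewrite leNgt; apply/negP => qy; have := lexx (quantile X s).
rewrite quantile_le inner_id// leNgt => /negP; apply; apply: le_lt_trans Xs.
rewrite dfunE; apply: le_pr; [exact: measurable_le| |by move=> w /= /le_lt_trans; exact].
by apply: measurable_ltr; exact: Linf_measurable.
Qed.

(** A point and its reflection lie on opposite sides of the fixed point of the reflection. One
    quantile is then at most the middle value and the other at least that, which confines their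
    average to half the range. [H] serves all functionals at once, so two of them can be
    compared. *)
Lemma halve_within X a c r : quantile_within X a c r -> exists H a' c',
  quantile_within H a' c' (r / 2) /\
  forall phi, averse (tail_class p) phi -> phi X = phi H.
Proof.
move=> [ac hlow hhigh].
(* [averse_reflect] concerns a doubled variable, so it is applied to half of [X]. *)
have bX' : bounded_measurable (fun w => 2^-1 * on_uniform X w).
  by apply: bmZ; exact: (bm_comp (quantile_bm X) hU.1).
pose X' := Linf_of P bX'.
have qX' s : quantile X' s = quantile X s / 2.
  suff E x : (quantile X' s <= x) = (quantile X s / 2 <= x).
    by apply/eqP; rewrite eq_le E lexx -E lexx.
  rewrite ler_pdivrMr// !quantile_le (eq_in_law_dfun (on_uniform_law X)); congr (_ <= _).
  rewrite !dfunE; congr (pr _); apply/seteqP; split => w h.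
    have {}h : 2^-1 * on_uniform X w <= x by exact: h.
    by rewrite /=; lra.
  suff : 2^-1 * on_uniform X w <= x by [].
  by move: h => /=; lra.
pose H := on_uniform X' + on_reflected X'.
have phiE phi : averse (tail_class p) phi -> phi X = phi H.
  move=> aphi; rewrite -averse_reflect//; apply: (averse_law aphi).
  apply: eq_in_law_trans (on_uniform_law X) _; apply: eq_in_law_pointwise => w.
  by rewrite -[RHS]/(2^-1 * on_uniform X w + 2^-1 * on_uniform X w); lra.
(* The quantiles at the fixed points [p / 2] and [(1 + p) / 2] of the two reflections. *)
pose m := quantile X (p / 2); pose m' := quantile X ((1 + p) / 2).
have pp0 := p0; have pp1 := p1.
have p2 : 0 < p / 2 < 1 by lra.
have p3 : 0 < (1 + p) / 2 < 1 by lra.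
pose a' := (a + m) / 2; pose c' := (c + m') / 2.
have mm' : m <= m' by apply: quantile_mono; lra.
have ac' : a' <= c' by rewrite /a' /c'; lra.
pose N := U' @^-1` (~` `]0, 1[%classic).
have mN : measurable N.
  by rewrite -[X in measurable X]setTI; apply: hU'.1 => //; exact: measurableC.
have N0 : pr N = 0 by rewrite /pr hU'.2; [exact: pr_not01|exact: measurableC].
have nNE w : ~ N w -> 0 < U' w < 1.
  by move=> nN; apply: contrapT => h; apply: nN; rewrite /N /= in_itv.
have HE w : H w = (quantile X (U w) + quantile X (U' w)) / 2.
  by rewrite -[LHS]/(quantile X' (U w) + quantile X' (U' w)) !qX' mulrDl.
have qm s t : 0 < s < 1 -> 0 < t < 1 -> s <= t -> quantile X s <= quantile X t.
  by move=> /andP[s0 _] /andP[_ t1] st; exact: quantile_mono.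
have Hlow w : ~ N w -> U w <= p -> a' <= H w <= a' + r / 2.
  move=> /nNE u' up; have u'E : U' w = p - U w by rewrite /U' /reflect_at up.
  have u'p : U' w <= p by have /andP[] := U01 w; lra.
  have := hlow _ (U01 w) up; have := hlow _ u' u'p; rewrite HE /a'.
  have [h|h] := leP (U w) (p / 2).
    have := qm _ _ (U01 w) p2 h; have := qm _ _ p2 u'; rewrite -/m => /(_ ltac:(lra)); lra.
  have := qm _ _ p2 (U01 w) (ltW h); have := qm _ _ u' p2; rewrite -/m => /(_ ltac:(lra)); lra.
have Hhigh w : ~ N w -> p < U w -> c' <= H w <= c' + r / 2.
  move=> /nNE u' up; have u'E : U' w = 1 + p - U w by rewrite /U' /reflect_at leNgt up.
  have u'p : p < U' w by have /andP[] := U01 w; lra.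
  have := hhigh _ (U01 w) up; have := hhigh _ u' u'p; rewrite HE /c'.
  have [h|h] := leP (U w) ((1 + p) / 2).
    have := qm _ _ (U01 w) p3 h; have := qm _ _ p3 u'; rewrite -/m' => /(_ ltac:(lra)); lra.
  have := qm _ _ p3 (U01 w) (ltW h); have := qm _ _ u' p3; rewrite -/m' => /(_ ltac:(lra)); lra.
have mlt y : measurable [set w | H w < y] by apply: measurable_ltr; exact: Linf_measurable.
have mUp : measurable [set w | U w <= p] by exact: measurable_ler hU.1.
have prU : pr [set w | U w <= p] = p by rewrite (pr_law_cdf _ hU) clip_id//; lra.
(* [H] is controlled as a function of [U]. Since {U <= p} has mass exactly [p], the same bounds pass
   to the quantiles of [H] up to [p] and beyond it. *)
exists H, a', c'; split=> //; split=> // s s01 sp; apply/andP; split.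
- apply: (quantile_ge s01); apply: (@le_lt_trans _ _ (pr set0)).
    apply: (pr_le_null _ _ mN N0) => // w h; right; apply: contrapT => nN; have {}h : H w < a' by exact: h.
    by have [up|up] := leP (U w) p; [have := Hlow w nN up|have := Hhigh w nN up]; lra.
  by rewrite pr0; have /andP[] := s01.
- rewrite quantile_le inner_id// (le_trans sp)// -{1}prU dfunE.
  apply: (pr_le_null _ _ mN N0) => //; first exact: measurable_le.
  move=> w /= up; have [|nN] := pselect (N w); [by right|left].
  by have /andP[] := Hlow w nN up.
- apply: (quantile_ge s01); apply: le_lt_trans sp; rewrite -[leRHS]prU.
  apply: (pr_le_null _ _ mN N0) => // w h; have {}h : H w < c' by exact: h.
  have [|nN] := pselect (N w); [by right|left].
  by rewrite /= leNgt; apply/negP => up; have := Hhigh w nN up; lra.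
- rewrite quantile_le inner_id//; apply: (@le_trans _ _ 1); first by have /andP[_ /ltW] := s01.
  rewrite -[leLHS](prT P) dfunE; apply: (pr_le_null _ _ mN N0) => //; first exact: measurable_le.
  move=> w _; have [|nN] := pselect (N w); [by right|left].
  suff : H w <= c' + r / 2 by [].
  have [up|up] := leP (U w) p; first by have := Hlow w nN up; lra.
  by have := Hhigh w nN up; lra.
Qed.

(** Both values lie between [c] and [c + r]. Replacing [X] by [H] changes neither value and halves
    [r]. *)
Lemma averse_lsc_unique phi psi X :
  monetary_risk_measure phi -> pointwise_lsc phi -> phi 0 = 0 -> averse (tail_class p) phi ->
  monetary_risk_measure psi -> pointwise_lsc psi -> psi 0 = 0 -> averse (tail_class p) psi ->
  phi X = psi X.
Proof.
move=> m1 l1 z1 a1 m2 l2 z2 a2.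
have step n : forall X a c r, quantile_within X a c r -> `|phi X - psi X| <= r / 2 ^+ n.
  elim: n => [|n ih] {}X a c r w.
    have := within_bounds m1 l1 z1 a1 w; have := within_bounds m2 l2 z2 a2 w.
    by rewrite expr0 divr1 ler_norml => /andP[? ?] /andP[? ?]; apply/andP; split; lra.
  have [H [a' [c' [wH HE]]]] := halve_within w.
  by rewrite (HE _ a1) (HE _ a2) exprS invfM mulrA; exact: ih wH.
have [M M0 hM] := Linf_ae_bounded X.
(* Initially both base levels are the lower bound [- M], and the range is that of all quantiles. *)
have w : quantile_within X (- M) (- M) (2 * M).
  by split=> // s _ _; have := quantile_norm s hM; rewrite ler_norml; lra.
apply/eqP; rewrite -subr_eq0 -normr_eq0 eq_le normr_ge0 andbT leNgt; apply/negP => e0.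
have [n hn] := exp2_small (2 * M) e0.
by have := step n _ _ _ _ w; rewrite leNgt hn.
Qed.

End averse.

Theorem theorem6 (R : realType) (d : measure_display) (T : measurableType d)
    (P : probability T R) (hP : atomless P)
    (rho : Linf P -> R) (hrho : monetary_risk_measure rho) :
  [/\ pointwise_lsc rho, rho 0 = 0 &
      exists D : set (R -> R -> R),
        maximal_concentration_class P D /\ averse D rho] <->
  exists p : R, 0 < p < 1 /\ forall X : Linf P, rho X = ES p X.
Proof.
split.
  move=> [lsc rho0 [D [/(maximal_concentration_classE hP)[p [p01 ->]] arho]]].
  have [U [V [hUV _ _]]] := exists_independent_uniforms hP.
  (* Composing with [inner] keeps the uniform law and puts all values strictly inside (0,1). *)
  have hU := has_law_comp (has_law_comp hUV fst_law) inner_law.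
  exists p; split => // X.
  apply: (averse_lsc_unique p01 hU) => //.
  - by move=> w; exact: inner01.
  - exact: ES_monetary.
  - exact: ES_lsc.
  - exact: ES0.
  - exact: ES_averse.
move=> [p [p01 /funext ->]]; split.
- exact: ES_lsc.
- exact: ES0.
- by exists (tail_class p); split; [exact: tail_class_maximal|exact: ES_averse].
Qed.
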